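(* Fix $0<p<\infty$. Let $f:\mathbb{D}\to\mathbb{D}$ be an inner function. Then $f$ has finite $\mathcal{L}(p)$-entropy, that is, $\log|f'|\in L^p(\mathbb{T})$, if and only if $A(f)\in L^p(\mathbb{T})$.
   Context: $\mathbb{D}$ is the open unit disc in $\mathbb{C}$, $\mathbb{T}$ the unit circle, $m$ the normalized Lebesgue measure on $\mathbb{T}$; $L^p(\mathbb{T})$ is with respect to $m$. Inner functions are analytic self-mappings $f:\mathbb{D}\to\mathbb{D}$ such that the radial limits $\lim_{r\to1}f(r\xi)$ have modulus one for $m$-almost every $\xi\in\mathbb{T}$. Angular derivative: an analytic $f:\mathbb{D}\to\mathbb{D}$ has a finite angular derivative at $\xi\in\mathbb{T}$ if $\lim_{r\to1}f(r\xi)$ exists and belongs to $\mathbb{T}$ and $\lim_{r\to1}f'(r\xi)$ exists finitely; in this case $|f'(\xi)|:=\lim_{r\to1}|f'(r\xi)|$. If $f$ does not have a finite angular derivative at $\xi$, set $|f'(\xi)|:=\infty$ (and $\log|f'(\xi)|=\infty$). On $\mathbb{T}$, $|f'|$ always denotes this function. An inner function $f$ has finite $\mathcal{L}(p)$-entropy if $|f'(\xi)|$ is finite at $m$-almost every $\xi\in\mathbb{T}$ and $\log|f'(\xi)|\in L^p(\mathbb{T})$. Hyperbolic derivative: $D_hf(z)=\frac{(1-|z|^2)|f'(z)|}{1-|f(z)|^2}\le 1$, $z\in\mathbb{D}$. Möbius distortion: $\mu(f)(z)=1-D_hf(z)$. Accumulated Möbius distortion: $A(f)(\xi)=\int_0^1\mu(f)(r\xi)\frac{2\,dr}{1-r^2}\in[0,\infty]$,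 $\xi\in\mathbb{T}$. *)

(* Defs.v *)
From HB Require Import structures.
From mathcomp Require Import all_boot all_order all_algebra.
From mathcomp Require Import all_classical all_reals all_analysis.
From mathcomp Require Import measurable_realfun complex ring lra.

Set Implicit Arguments.
Unset Strict Implicit.
Unset Printing Implicit Defensive.
Import Order.TTheory GRing.Theory Num.Theory.
Import numFieldNormedType.Exports.

Local Open Scope classical_set_scope.
Local Open Scope complex_scope.
Local Open Scope ring_scope.

(* [R[i]] carries no topology of its own in the library; its regular module
   [R[i]^o] carries the one induced by the modulus, hence the casts below.
   Functions on the disc are total functions on [R[i]] whose values outside the
   disc are never used; functions on the circle are total likewise. *)

Section circle_measure.
Variable R : realType.

Definition disc : set R[i] := [set z | `|z| < 1].

Definition circle : set R[i] := [set z | `|z| = 1].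

Definition Cborel := g_sigma_algebraType (@open (R[i]^o)).
HB.instance Definition _ := Measurable.on Cborel.

Definition expi (t : measurableTypeR R) : Cborel := cos t +i* sin t.

Lemma expi_continuous : continuous (expi : R -> R[i]^o).
Proof.
move=> t; apply/cvgrPdist_lt => -[e e'] /[dup] e0.
rewrite ltcE/= => /andP[/eqP -> {}e'0]; rewrite -[_ +i* 0]/(e%:C).
have e2 : 0 < e / 2 by rewrite divr_gt0.
have /cvgrPdist_lt/(_ _ e2) cc := @continuous_cos R t.
have /cvgrPdist_lt/(_ _ e2) cs := @continuous_sin R t.
near=> s.
rewrite normc_def ltcR /=.
have c1 : `|cos t - cos s| < e / 2 by near: s.
have s1 : `|sin t - sin s| < e / 2 by near: s.
have -> : e = Num.sqrt (e ^+ 2) by rewrite sqrtr_sqr gtr0_norm.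
rewrite ltr_sqrt ?exprn_gt0//.
rewrite -[_ ^+ 2 in ltLHS]real_normK ?num_real//.
rewrite -[X in _ + X]real_normK ?num_real//.
have := normr_ge0 (cos t - cos s); have := normr_ge0 (sin t - sin s).
move: c1 s1; set u := `|cos _ - _|; set v := `|sin _ - _|; nra.
Unshelve. all: by end_near. Qed.

Lemma measurable_expi : measurable_fun [set: measurableTypeR R] expi.
Proof.
apply: (@measurability _ _ _ _ _ _ (@open (R[i]^o) : set (set Cborel))) => //.
move=> _ [B oB <-]; rewrite setTI; apply: open_measurable.
by apply: open_comp => // x _; exact: expi_continuous.
Qed.

HB.instance Definition _ := isMeasurableFun.Build _ _ _ _ expi measurable_expi.

Lemma twopi_gt0 : 0 < 2 * pi :> R.
Proof. by rewrite mulr_gt0// pi_gt0. Qed.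

(* Normalized Lebesgue measure of the circle, as a Borel probability measure on
   the plane: the law of [expi t] for [t] uniform on [0, 2 * pi]. *)
Definition circle_measure : {measure set Cborel -> \bar R} :=
  distribution (uniform_prob twopi_gt0) expi.

(* Membership in L^p for extended-valued functions; no finiteness hypothesis is
   needed, as a finite integral forces finiteness almost everywhere. The
   library's L^p classes require [1 <= p] and real values. *)
Definition mem_Lp (p : R) (g : R[i] -> \bar R) : Prop :=
  measurable_fun (circle : set Cborel) (g : Cborel -> \bar R) /\
  (\int[circle_measure]_(xi in circle) (`|g xi| `^ p) < +oo)%E.

End circle_measure.

Section inner_functions.
Variable R : realType.
Implicit Types (f g : R[i] -> R[i]) (z w xi : R[i]).

Definition modulus z : R := complex.Re `|z|.

Definition cderivable f z : Prop := derivable (f : R[i]^o -> R[i]^o) z 1.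

Definition cderiv f : R[i] -> R[i] := derive1 (f : R[i]^o -> R[i]^o).

Definition analytic_self_map f : Prop :=
  (forall z, disc z -> cderivable f z) /\ (forall z, disc z -> disc (f z)).

Definition radial_cvg g xi w : Prop :=
  (g (r%:C * xi) : R[i]^o) @[r --> (1 : R)^'-] --> (w : R[i]^o).

Definition inner_function f : Prop :=
  analytic_self_map f /\
  {ae circle_measure R, forall xi, exists2 w, circle w & radial_cvg f xi w}.

Definition finite_angular_derivative f xi : Prop :=
  (exists2 w, circle w & radial_cvg f xi w) /\
  (exists w, radial_cvg (cderiv f) xi w).

Definition abs_angular_derivative f xi : \bar R :=
  if `[< finite_angular_derivative f xi >]
  then (lim (modulus (cderiv f (r%:C * xi)) @[r --> (1 : R)^'-]))%:E
  else +oo%E.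

Definition finite_entropy (p : R) f : Prop :=
  {ae circle_measure R, forall xi, (abs_angular_derivative f xi < +oo)%E} /\
  mem_Lp p (fun xi => lne (abs_angular_derivative f xi)).

Definition hyperbolic_derivative f z : R :=
  (1 - modulus z ^+ 2) * modulus (cderiv f z) / (1 - modulus (f z) ^+ 2).

Definition mobius_distortion f z : R := 1 - hyperbolic_derivative f z.

(* The accumulated Moebius distortion of [f]. *)
Definition total_distortion f xi : \bar R :=
  (\int[lebesgue_measure]_(r in `[0%R, 1%R[)
    (mobius_distortion f (r%:C * xi) * (2 / (1 - r ^+ 2)))%:E)%E.

End inner_functions.

(* Main.v *)
(* Write z = r xi and consider along each radius the function
     v(r) = log (1 - |f|^2) + log ((1 + r) / (1 - r)).
   Its derivative is 2 / (1 - r^2) times 1 - Re b, where b = conj(f) f' xi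
   (1 - r^2) / (1 - |f|^2) has modulus at most the hyperbolic derivative. Hence v
   increases and A(f) <= lim v - v(0). By the Julia-Caratheodory argument, f has a
   finite angular derivative at xi exactly when v is bounded, and then
   log |f'(xi)| = lim v - log 4. This gives the direct implication pointwise.

   For the converse, put r = e^x and W = v + const >= 1, a function of (x, t) on a
   strip x < 0. With k = 2 r / (1 - r^2) and mu the Moebius distortion one has
     |grad W|^2 <= 2 k W_x,   - x k <= 1,   - x Lap W <= 2 k mu + O(1).
   With Phi(w) = w^p, the t-mean of Phi(W) - x Phi'(W) W_x has x-derivative the
   mean of - x (Phi''(W) |grad W|^2 + Phi'(W) Lap W). The bounds above integrate
   it in x: if a denotes A(f) truncated at r, so that a_x = k mu and 1 + a <= W,
   it is at most 2 Phi'(W) (2 + a + x) when p >= 1, and 2 (1 + a)^p + 2 p x when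
   p <= 1. Young's inequality then yields E W^p <= C + C E (2 + a)^p uniformly in
   x, and monotone convergence as x --> 0 concludes. *)

Require Import Defs.
From HB Require Import structures.
From mathcomp Require Import all_boot all_order all_algebra.
From mathcomp Require Import all_classical all_reals all_analysis.
From mathcomp Require Import measurable_realfun complex ring lra.

Set Implicit Arguments.
Unset Strict Implicit.
Unset Printing Implicit Defensive.
Import Order.TTheory GRing.Theory Num.Theory.
Import numFieldNormedType.Exports.
Local Open Scope classical_set_scope.
Local Open Scope complex_scope.
Local Open Scope ring_scope.

(** The obstacle in the converse is regularity in [t]. The density of [a] contains |f'|, which fails
    to be differentiable at zeros of f', so [a] is handled as a merely continuous function of [t].
    Stokes is therefore an inequality for fields with one-sided increment bounds; applied to smooth
    fields in the coordinate log z, the same statement yields the mean value property, and from it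
    Cauchy's formulas and the smoothness of f. The weight -x is log (1/|z|), the Green function of
    the disc with pole 0. It vanishes on the circle just fast enough to cancel one factor k. The two
    comparison functions come from the sign of Phi''. For p >= 1, 2 Phi''(W) W_x is the derivative
    of 2 Phi'(W), and multiplying it by 2 + a + x >= 1 (as x >= -1) only enlarges it, so a product
    rule gives the primitive. For p <= 1 the gradient term is dropped, and 1 + a <= W turns Phi'(W)
    a_x into at most the derivative of (1 + a)^p. For x < 0 all means are finite, so half of E W^p
    may be moved to the left-hand side. *)

Section cbasics. Variable R : realType.
Implicit Types (z w d : R[i]) (f g phi : R[i] -> R[i]).
Local Notation nm := (@modulus R).

(** * Modulus, continuity and complex differentiability *)

Lemma normE z : `|z| = (nm z)%:C.
Proof. by rewrite /modulus normc_def. Qed.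

Lemma nm_sqr z : nm z ^+ 2 = complex.Re z ^+ 2 + complex.Im z ^+ 2.
Proof. by rewrite /modulus normc_def /= sqr_sqrtr // addr_ge0 // sqr_ge0. Qed.

Lemma nm_ge0 z : 0 <= nm z.
Proof. by rewrite /modulus normc_def /= sqrtr_ge0. Qed.

Lemma nmM z w : nm (z * w) = nm z * nm w.
Proof. by apply: (@complexI R); rewrite rmorphM /= -!normE normrM. Qed.

Lemma nm0 : nm 0 = 0. Proof. by rewrite /modulus normr0. Qed.

Lemma nm_eq0 z : (nm z == 0) = (z == 0).
Proof. by rewrite -(inj_eq (@complexI R)) -normE normr_eq0. Qed.

Lemma nmD z w : nm (z + w) <= nm z + nm w.
Proof. by rewrite -lecR rmorphD /= -!normE ler_normD. Qed.

Lemma nmN z : nm (- z) = nm z.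
Proof. by rewrite /modulus normrN. Qed.

Lemma nmB z w : nm (z - w) = nm (w - z).
Proof. by rewrite -opprB nmN. Qed.

Lemma nm_real (x : R) : nm x%:C = `|x|.
Proof. by rewrite /modulus normc_def /= expr0n /= addr0 sqrtr_sqr. Qed.

Lemma nm1 : nm 1 = 1. Proof. by rewrite /modulus normr1. Qed.

Lemma nm_conj z : nm z^* = nm z.
Proof. by rewrite /modulus !normc_def; case: z => a b /=; rewrite sqrrN. Qed.

Lemma nmV z : nm z^-1 = (nm z)^-1.
Proof. by apply: (@complexI R); rewrite fmorphV /= -!normE normfV. Qed.

Lemma re_le_nm z : `|complex.Re z| <= nm z.
Proof.
by rewrite -(ler_pXn2r (ltn0Sn 1)) ?nnegrE ?nm_ge0// nm_sqr real_normK ?num_real// lerDl sqr_ge0.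
Qed.

Lemma im_le_nm z : `|complex.Im z| <= nm z.
Proof.
by rewrite -(ler_pXn2r (ltn0Sn 1)) ?nnegrE ?nm_ge0// nm_sqr real_normK ?num_real// lerDr sqr_ge0.
Qed.

Lemma nm_le z : nm z <= `|complex.Re z| + `|complex.Im z|.
Proof.
rewrite -(ler_pXn2r (ltn0Sn 1)) ?nnegrE ?nm_ge0 ?addr_ge0// nm_sqr sqrrD !real_normK ?num_real//.
by rewrite lerD2r lerDl mulrn_wge0// mulr_ge0.
Qed.

Lemma discE z : disc z <-> nm z < 1.
Proof. by rewrite /disc /= normE -(rmorph1 (real_complex R)) ltcR. Qed.

Lemma circleE z : circle z <-> nm z = 1.
Proof.
rewrite /circle /= normE -[1%R in X in X <-> _](rmorph1 (real_complex R)); split=> [/complexI //|->//].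
Qed.

(** The norm of [R[i]^o] takes values in [R[i]], so its radii are complex; a positive one has zero
    imaginary part, which allows real radii throughout. *)
Lemma ccontP phi z : {for z, continuous (phi : R[i]^o -> R[i]^o)} <->
  forall e : R, 0 < e -> exists2 d : R, 0 < d & forall w, nm (w - z) < d -> nm (phi w - phi z) < e.
Proof.
split.
- move=> /cvgrPdist_lt H e e0.
  have e0' : 0 < e%:C by rewrite ltcR.
  have := H _ e0' => -[[d d'] /=].
  rewrite ltcE/= => /andP[/eqP -> {}d'0] hd; exists d => // w hw.
  have := hd w; rewrite /ball_ /= !normE -[_ +i* 0]/(d%:C) !ltcR (nmB z w) (nmB (phi z)); exact.
- move=> H; apply/(@cvgrPdist_lt R[i] R[i]^o R[i]^o (nbhs (z:R[i]^o)) _) => -[e e'].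
  rewrite ltcE/= => /andP[/eqP -> {}e'0]; rewrite -[_ +i* 0]/(e%:C).
  have [d d0 hd] := H e e'0.
  exists d%:C; first by rewrite /= ltcR.
  by move=> w /=; rewrite !normE !ltcR (nmB z w) (nmB (phi z)); exact: hd.
Qed.

Lemma crcontP (h : R[i]^o -> R) z : {for z, continuous h} <->
  forall e : R, 0 < e -> exists2 d : R, 0 < d & forall w, nm (w - z) < d -> `|h w - h z| < e.
Proof.
split.
- move=> /cvgrPdist_lt H e e0.
  have := H _ e0 => -[[d d'] /=].
  rewrite ltcE/= => /andP[/eqP -> {}d'0] hd; exists d => // w hw.
  have := hd w; rewrite /ball_ /= !normE -[_ +i* 0]/(d%:C) !ltcR (nmB z w) distrC; exact.
- move=> H; apply/(@cvgrPdist_lt R R^o R[i]^o (nbhs (z:R[i]^o)) _) => e e0.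
  have [d d0 hd] := H e e0.
  exists d%:C; first by rewrite /= ltcR.
  by move=> w /=; rewrite !normE !ltcR (nmB z w) distrC; exact: hd.
Qed.

Lemma continuous_Re : continuous (@complex.Re R : R[i]^o -> R).
Proof.
move=> z; apply/crcontP => e e0; exists e => // w; apply: le_lt_trans.
by rewrite -raddfB re_le_nm.
Qed.

Lemma continuous_Im : continuous (@complex.Im R : R[i]^o -> R).
Proof.
move=> z; apply/crcontP => e e0; exists e => // w; apply: le_lt_trans.
by rewrite -raddfB im_le_nm.
Qed.

Lemma ler_dist_nm z w : `|nm w - nm z| <= nm (w - z).
Proof.
rewrite ler_norml; apply/andP; split.
  by have := nmD (z - w) w; rewrite subrK nmB; lra.
by have := nmD (w - z) z; rewrite subrK; lra.
Qed.

Lemma continuous_modulus : continuous (nm : R[i]^o -> R).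
Proof.
move=> z; apply/crcontP => e e0; exists e => // w; apply: le_lt_trans; exact: ler_dist_nm.
Qed.

Lemma cvg_complex (T : Type) (F : set_system T) (FF : Filter F) (h : T -> R[i]^o) (l : R[i]^o) :
  (complex.Re (h x) @[x --> F] --> complex.Re l) ->
  (complex.Im (h x) @[x --> F] --> complex.Im l) -> h @ F --> l.
Proof.
move=> /cvgrPdist_lt h1 /cvgrPdist_lt h2; apply/cvgrPdist_lt => -[e e'].
rewrite ltcE/= => /andP[/eqP -> {}e'0]; rewrite -[_ +i* 0]/(e%:C).
have e2 : 0 < e / 2 by rewrite divr_gt0.
have := h1 _ e2; have := h2 _ e2; apply: filterS2 => x H1 H2.
rewrite normE ltcR (le_lt_trans (nm_le _))// !raddfB/= [ltRHS]splitr ltrD//.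
Qed.

Section ccont.
Variables (u v : R[i]^o -> R[i]^o) (x : R[i]^o).
Hypotheses (cu : {for x, continuous u}) (cv : {for x, continuous v}).
Lemma ccontM : {for x, continuous (fun y : R[i]^o => u y * v y : R[i]^o)}.
Proof. exact: (@cvgM R[i] _ _ _ u v (u x) (v x) cu cv). Qed.
Lemma ccontD : {for x, continuous (fun y : R[i]^o => u y + v y : R[i]^o)}.
Proof. exact: (@cvgD _ _ _ _ _ u v (u x) (v x) cu cv). Qed.
Lemma ccontV : u x != 0 -> {for x, continuous (fun y : R[i]^o => (u y)^-1 : R[i]^o)}.
Proof. by move=> ux; exact: (@cvgV R[i] _ _ _ u (u x) ux cu). Qed.
End ccont.
Lemma ccont_cst (c x : R[i]^o) : {for x, continuous (fun _ : R[i]^o => c)}.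
Proof. exact: cst_continuous. Qed.
Lemma ccont_id (x : R[i]^o) : {for x, continuous (fun y : R[i]^o => y)}.
Proof. exact: cvg_id. Qed.
Lemma ccont_comp (u v : R[i]^o -> R[i]^o) (x : R[i]^o) : {for x, continuous u} ->
  {for u x, continuous v} -> {for x, continuous (fun y : R[i]^o => v (u y) : R[i]^o)}.
Proof. by move=> cu cv; exact: (@continuous_comp _ _ _ u v x cu cv). Qed.

Lemma ccont_ext (u v : R[i]^o -> R[i]^o) (x : R[i]^o) : (forall y, u y = v y) ->
  {for x, continuous v} -> {for x, continuous u}.
Proof. by move=> /funext ->. Qed.

Lemma ccont_near (u v : R[i]^o -> R[i]^o) (x : R[i]) (r : R) : 0 < r ->
  (forall y, modulus (y - x) < r -> u y = v y) ->
  {for x, continuous v} -> {for x, continuous u}.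
Proof.
move=> r0 uv /ccontP cv; apply/ccontP => e e0; have [d d0 hd] := cv e e0.
exists (Num.min r d); first by rewrite lt_min r0.
move=> w; rewrite lt_min => /andP[wr wd]; rewrite !uv ?subrr ?nm0//; exact: hd.
Qed.

(* Caratheodory's form of complex differentiability: the chain and product
   rules become algebra of continuous functions. *)
Definition cdiff f z d := exists phi : R[i]^o -> R[i]^o,
  [/\ {for z, continuous phi}, phi z = d & forall w, f w = f z + phi w * (w - z)].

Lemma cdiff_cont f z d : cdiff f z d -> {for z, continuous (f : R[i]^o -> R[i]^o)}.
Proof.
move=> [phi [cphi phiz fE]].
apply: (ccont_ext fE); exact: (ccontD (@ccont_cst (f z) z) (ccontM cphi (ccontD (@ccont_id z) (@ccont_cst (- z) z)))).
Qed.

Lemma cdiff_cst (c : R[i]) z : cdiff (fun=> c) z 0.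
Proof. by exists (fun=> 0); split=> [||w]; [exact: cst_continuous| |rewrite mul0r addr0]. Qed.

Lemma cdiff_id z : cdiff id z 1.
Proof. by exists (fun=> 1); split=> [||w]; [exact: cst_continuous| |rewrite mul1r addrC subrK]. Qed.

Lemma cdiffD f g z d e : cdiff f z d -> cdiff g z e -> cdiff (fun w => f w + g w) z (d + e).
Proof.
move=> [p [cp pz pE]] [q [cq qz qE]]; exists (fun w => p w + q w); split.
- exact: (ccontD cp cq).
- by rewrite pz qz.
- by move=> w; rewrite (pE w) (qE w); ring.
Qed.

Lemma cdiffM f g z d e : cdiff f z d -> cdiff g z e -> cdiff (fun w => f w * g w) z (d * g z + f z * e).
Proof.
move=> hf hg; have cg := cdiff_cont hg.
move: hf hg => [p [cp pz pE]] [q [cq qz qE]].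
exists (fun w => p w * g w + f z * q w); split.
- exact: (ccontD (ccontM cp cg) (ccontM (@ccont_cst (f z) z) cq)).
- by rewrite pz qz.
- by move=> w; rewrite (pE w) (qE w); ring.
Qed.

Lemma cdiffN f z d : cdiff f z d -> cdiff (fun w => - f w) z (- d).
Proof.
move=> hf; have := cdiffM (cdiff_cst (-1) z) hf; rewrite mul0r add0r mulN1r.
by under eq_fun do rewrite mulN1r.
Qed.

Lemma cdiffB f g z d e : cdiff f z d -> cdiff g z e -> cdiff (fun w => f w - g w) z (d - e).
Proof. by move=> hf hg; exact: (cdiffD hf (cdiffN hg)). Qed.

Lemma cdiff_comp f g z d e : cdiff g z e -> cdiff f (g z) d -> cdiff (fun w => f (g w)) z (d * e).
Proof.
move=> hg; have cg := cdiff_cont hg; move: hg => [q [cq qz qE]] [p [cp pz pE]].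
exists (fun w => p (g w) * q w); split.
- exact: (ccontM (ccont_comp cg cp) cq).
- by rewrite pz qz.
- by move=> w; rewrite (pE (g w)) {2}(qE w); ring.
Qed.

(** The factorization in [cdiff] is required at every [w], so locality is not immediate: away from
    the disc the slope is taken to be the difference quotient of [g]. *)
Lemma near_cdiff f g z d (r : R) : 0 < r -> (forall w, nm (w - z) < r -> f w = g w) ->
  cdiff f z d -> cdiff g z d.
Proof.
move=> r0 H [p [cp pz pE]].
have fgz : f z = g z by apply: H; rewrite subrr nm0.
exists (fun w => if w == z then p z else (g w - g z) / (w - z)); split.
- apply: (ccont_near r0 _ cp) => w /H fgw; case: eqP => [-> //|/eqP wz].
  by rewrite -fgw -fgz pE addrC addKr mulfK// subr_eq0.
- by rewrite eqxx.
- move=> w; case: eqP => [->|/eqP wz]; first by rewrite subrr mulr0 addr0.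
  by rewrite divfK ?subr_eq0// addrC subrK.
Qed.

Lemma cdiff_inv z : z != 0 -> cdiff (fun w => w^-1) z (- (z^-1 ^+ 2)).
Proof.
move=> z0.
have nz : 0 < nm z by rewrite lt_neqAle nm_ge0 eq_sym nm_eq0 z0.
have H w : nm (w - z) < nm z -> w != 0.
  by apply: contraTneq => ->; rewrite sub0r nmN ltxx.
(* The inverse is first replaced at 0, which is outside the disc of radius [nm z] around [z], by the
   value of its tangent line there; [near_cdiff] removes the change. *)
apply: (@near_cdiff (fun w => if w == 0 then z^-1 - z^-1 ^+2 * (w - z) else w^-1) _ _ _ _ nz).
  by move=> w /H/negbTE ->.
exists (fun w => if w == 0 then - (z^-1 ^+ 2) else - z^-1 * w^-1); split.
- apply: (ccont_near nz (v := fun w => - z^-1 * w^-1)); first by move=> w /H/negbTE ->.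
  exact: (ccontM (@ccont_cst (- z^-1) z) (ccontV (@ccont_id z) z0)).
- by rewrite (negbTE z0) expr2; ring.
- move=> w; rewrite (negbTE z0); case: eqP => [->|/eqP w0]; first by ring.
  by field; rewrite z0 w0.
Qed.

Lemma cdiffV f z d : f z != 0 -> cdiff f z d -> cdiff (fun w => (f w)^-1) z (- (f z)^-1 ^+ 2 * d).
Proof. by move=> fz hf; exact: (cdiff_comp hf (cdiff_inv fz)). Qed.

Lemma cderivable_cdiff f z : cderivable f z -> cdiff f z (cderiv f z).
Proof.
move=> fz; exists (fun w => if w == z then cderiv f z else (f w - f z) / (w - z)); split.
- apply/ccontP => e e0; rewrite eqxx.
  have := fz; rewrite /cderivable /derivable => /cvgrPdist_lt.
  have e0' : 0 < e%:C by rewrite ltcR.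
  move=> /(_ _ e0'); rewrite near_withinE => -[[d d'] /=].
  rewrite ltcE/= => /andP[/eqP -> {}d'0] hd; exists d => // w hw.
  case: eqP => [_|/eqP wz]; first by rewrite subrr nm0.
  have := hd (w - z); rewrite /ball_ /= !normE -[_ +i* 0]/(d%:C) !ltcR (nmB 0) subr0 subr_eq0 => /(_ hw wz).
  rewrite nmB; have -> : (w - z)%:A + z = w by rewrite /GRing.scale /= mulr1 subrK.
  rewrite mulrC.
  by rewrite /cderiv derive1E /derive /= .
- by rewrite eqxx.
- move=> w; case: eqP => [->|/eqP wz]; first by rewrite subrr mulr0 addr0.
  by rewrite divfK ?subr_eq0// addrC subrK.
Qed.
End cbasics.

Ltac slra := try (apply/andP; split); lra.

(** * Interval integrals and a Stokes inequality on rectangles *)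

Section intervals. Variable R : realType.
Implicit Types (a b c x t : R) (h k : R -> R).
Local Notation mu := (@lebesgue_measure R).

Definition itv_intble a b h := mu.-integrable `[a, b] (EFin \o h).
Definition itv_int a b h : R := \int[mu]_(x in `[a, b]) h x.

Lemma itv_intbleS a b c d h : c <= a -> b <= d -> itv_intble c d h -> itv_intble a b h.
Proof.
move=> ca bd; apply: integrableS => //.
by move=> x /=; rewrite !in_itv/= => /andP[? ?]; apply/andP; split; lra.
Qed.

Lemma itv_int_split a b c h : a <= c -> c <= b -> itv_intble a b h -> itv_int a b h = itv_int a c h + itv_int c b h.
Proof.
move=> ac cb ih; rewrite /itv_int -(@Rintegral_itv_obnd_cbnd _ c); last first.
  by apply: integrableS ih => //; apply: subset_itvr; rewrite bnd_simp.
by rewrite -(@Rintegral_itvB _ h (BLeft a) (BRight b) c)// ?bnd_simp//; ring.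
Qed.

Lemma itv_intble_cont a b h : {within `[a, b], continuous h} -> itv_intble a b h.
Proof. by move=> ch; apply: continuous_compact_integrable => //; exact: segment_compact. Qed.

Lemma itv_intble_cst a b c : itv_intble a b (fun=> c).
Proof. by apply: itv_intble_cont; apply: continuous_subspaceT => x; exact: cvg_cst. Qed.

Lemma itv_int_cst a b c : a <= b -> itv_int a b (fun=> c) = c * (b - a).
Proof.
move=> ab; rewrite /itv_int Rintegral_cst//= lebesgue_measure_itv/= lte_fin.
by case: ltP => // ba; have -> : b - a = 0 by lra.
Qed.

Lemma itv_int_leM a b h k : itv_intble a b h -> itv_intble a b k -> (forall x, a <= x <= b -> h x <= k x) ->
  itv_int a b h <= itv_int a b k.
Proof. by move=> ih ik hk; apply: le_Rintegral => // x /=; rewrite in_itv/=; exact: hk. Qed.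

Lemma itv_int_le a b h c : a <= b -> itv_intble a b h -> (forall x, a <= x <= b -> h x <= c) ->
  itv_int a b h <= c * (b - a).
Proof. by move=> ab ih hc; rewrite -itv_int_cst//; apply: itv_int_leM => //; exact: itv_intble_cst. Qed.

Lemma itv_intB a b h k : itv_intble a b h -> itv_intble a b k ->
  itv_int a b (fun x => h x - k x) = itv_int a b h - itv_int a b k.
Proof. by move=> ih ik; exact: RintegralB. Qed.

Lemma itv_intD a b h k : itv_intble a b h -> itv_intble a b k ->
  itv_int a b (fun x => h x + k x) = itv_int a b h + itv_int a b k.
Proof. by move=> ih ik; exact: RintegralD. Qed.

Lemma itv_intZ a b h c : itv_intble a b h -> itv_int a b (fun x => c * h x) = c * itv_int a b h.
Proof. by move=> ih; exact: RintegralZl. Qed.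

Lemma itv_intbleB a b h k : itv_intble a b h -> itv_intble a b k -> itv_intble a b (fun x => h x - k x).
Proof. by move=> ih ik; exact: (integrableB _ ih ik). Qed.

Lemma itv_intbleD a b h k : itv_intble a b h -> itv_intble a b k -> itv_intble a b (fun x => h x + k x).
Proof. by move=> ih ik; exact: (integrableD _ ih ik). Qed.

Lemma itv_intbleZ a b h c : itv_intble a b h -> itv_intble a b (fun x => c * h x).
Proof. by move=> ih; exact: (integrableZl _ c ih). Qed.

Lemma eq_itv_int a b h k : (forall x, a <= x <= b -> h x = k x) -> itv_int a b h = itv_int a b k.
Proof. by move=> hk; apply: eq_Rintegral => x; rewrite inE/= in_itv/=; exact: hk. Qed.

Lemma nested_intervals (a b : nat -> R) : (forall n, a n <= a n.+1) ->
  (forall n, b n.+1 <= b n) -> (forall n, a n <= b n) ->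
  exists x, forall n, a n <= x <= b n.
Proof.
move=> ha hb hab.
have am m n : (m <= n)%N -> a m <= a n.
  by elim: n => [|n IH]; [rewrite leqn0 => /eqP ->|rewrite leq_eqVlt => /predU1P[->//|/IH/le_trans]; exact].
have bm m n : (m <= n)%N -> b n <= b m.
  by elim: n => [|n IH]; [rewrite leqn0 => /eqP ->|rewrite leq_eqVlt => /predU1P[->//|/IH]; apply: le_trans].
have abmn m n : a m <= b n.
  case: (leqP m n) => [mn|/ltnW nm]; first exact: le_trans (am _ _ mn) (hab n).
  exact: le_trans (hab m) (bm _ _ nm).
exists (sup (range a)) => n; apply/andP; split.
  apply: ub_le_sup; last by exists n.
  by exists (b 0%N) => _ [m _ <-].
apply: ge_sup; first by exists (a 0%N), 0%N.
by move=> _ [m _ <-].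
Qed.

Lemma exists_half_lt (C d : R) : 0 < d -> exists n, C / 2 ^+ n < d.
Proof.
move=> d0; exists (Num.bound `|C / d|).
rewrite ltr_pdivrMr ?exprn_gt0// mulrC -ltr_pdivrMr//.
apply: (le_lt_trans (ler_norm _)); apply: (lt_trans (archi_boundP (normr_ge0 _))).
by rewrite -natrX ltr_nat ltn_expl.
Qed.

(* Goursat's bisection. No continuity of partial derivatives is assumed, only a
   one-sided first-order estimate around each point. *)
Section stokes.
Variables (P Q : R -> R -> R) (x1 x2 t1 t2 : R).
Hypotheses (x12 : x1 < x2) (t12 : t1 < t2).
Hypothesis iP : forall t, t1 <= t <= t2 -> itv_intble x1 x2 (P^~ t).
Hypothesis iQ : forall x, x1 <= x <= x2 -> itv_intble t1 t2 (Q x).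
Hypothesis PQ : forall x t (e : R), x1 <= x <= x2 -> t1 <= t <= t2 -> 0 < e ->
  exists c : R, exists2 d : R, 0 < d & forall y1 y2 s1 s2,
    x1 <= y1 -> y1 <= x -> x <= y2 -> y2 <= x2 -> y2 - y1 < d ->
    t1 <= s1 -> s1 <= t -> t <= s2 -> s2 <= t2 -> s2 - s1 < d ->
    (forall s, s1 <= s <= s2 ->
       Q y2 s - Q y1 s <= c * (y2 - y1) + e * ((y2 - y1) + (s2 - s1))) /\
    (forall y, y1 <= y <= y2 ->
       P y s1 - P y s2 <= - c * (s2 - s1) + e * ((y2 - y1) + (s2 - s1))).

Let I y1 y2 s1 s2 := itv_int y1 y2 (fun y => P y s1 - P y s2) + itv_int s1 s2 (fun s => Q y2 s - Q y1 s).

Let I_splitx y1 m y2 s1 s2 : x1 <= y1 -> y1 <= m -> m <= y2 -> y2 <= x2 ->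
  t1 <= s1 -> s1 <= s2 -> s2 <= t2 -> I y1 y2 s1 s2 = I y1 m s1 s2 + I m y2 s1 s2.
Proof.
move=> h1 h2 h3 h4 h5 h6 h7.
have iP' s : s1 <= s <= s2 -> itv_intble y1 y2 (P^~ s).
  by move=> /andP[? ?]; apply: itv_intbleS (iP _); slra.
have iQ' y : y1 <= y <= y2 -> itv_intble s1 s2 (Q y).
  by move=> /andP[? ?]; apply: itv_intbleS (iQ _); slra.
rewrite /I (@itv_int_split y1 y2 m)//; last by apply: itv_intbleB; apply: iP'; slra.
by rewrite !(@itv_intB s1 s2) //; try (by apply: iQ'; slra); ring.
Qed.

Let I_splitt y1 y2 s1 m s2 : x1 <= y1 -> y1 <= y2 -> y2 <= x2 ->
  t1 <= s1 -> s1 <= m -> m <= s2 -> s2 <= t2 -> I y1 y2 s1 s2 = I y1 y2 s1 m + I y1 y2 m s2.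
Proof.
move=> h1 h2 h3 h4 h5 h6 h7.
have iP' s : s1 <= s <= s2 -> itv_intble y1 y2 (P^~ s).
  by move=> /andP[? ?]; apply: itv_intbleS (iP _); slra.
have iQ' y : y1 <= y <= y2 -> itv_intble s1 s2 (Q y).
  by move=> /andP[? ?]; apply: itv_intbleS (iQ _); slra.
rewrite /I (@itv_int_split s1 s2 m)//; last by apply: itv_intbleB; apply: iQ'; slra.
by rewrite !(@itv_intB y1 y2) //; try (by apply: iP'; slra); ring.
Qed.

Let hx n := (x2 - x1) / 2 ^+ n.
Let ht n := (t2 - t1) / 2 ^+ n.

Let hxS n : hx n = hx n.+1 + hx n.+1.
Proof. by rewrite /hx exprS; field. Qed.
Let htS n : ht n = ht n.+1 + ht n.+1.
Proof. by rewrite /ht exprS; field. Qed.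
Let hx_gt0 n : 0 < hx n. Proof. by rewrite divr_gt0 ?subr_gt0 ?exprn_gt0. Qed.
Let ht_gt0 n : 0 < ht n. Proof. by rewrite divr_gt0 ?subr_gt0 ?exprn_gt0. Qed.

Variable e0 : R.
Hypotheses (e0_gt0 : 0 < e0) (I_big : e0 * ((x2 - x1) * (t2 - t1)) <= I x1 x2 t1 t2).

(** Halves the rectangle in x, then in t. Both [I] and [e0] times the area are additive, so when the
    lower bound fails on one half it holds on the other. *)
Let step n (z : R * R) : R * R :=
  let x' := if e0 * (hx n.+1 * ht n) <= I z.1 (z.1 + hx n.+1) z.2 (z.2 + ht n) then z.1
    else z.1 + hx n.+1 in
  let t' := if e0 * (hx n.+1 * ht n.+1) <= I x' (x' + hx n.+1) z.2 (z.2 + ht n.+1) then z.2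
    else z.2 + ht n.+1 in
  (x', t').

Fixpoint corner n : R * R := if n is m.+1 then step m (corner m) else (x1, t1).

Let cornerP n : [/\ x1 <= (corner n).1, (corner n).1 + hx n <= x2,
  t1 <= (corner n).2, (corner n).2 + ht n <= t2 &
  e0 * (hx n * ht n) <= I (corner n).1 ((corner n).1 + hx n) (corner n).2 ((corner n).2 + ht n)].
Proof.
elim: n => [|n [h1 h2 h3 h4 h5]] /=.
  rewrite /hx /ht expr0 !divr1 !lexx; split=> //; try lra.
  have -> : x1 + (x2 - x1) = x2 by ring.
  by have -> : t1 + (t2 - t1) = t2 by ring.
have := hxS n; have := htS n; have := hx_gt0 n.+1; have := ht_gt0 n.+1.
rewrite /step.
move: (corner n) h1 h2 h3 h4 h5 => [x t] /= h1 h2 h3 h4 h5 ht0 hx0 htE hxE.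
set x' := if _ then x else _.
have [hx1 hx2 hx3] : [/\ x1 <= x', x' + hx n.+1 <= x2 &
    e0 * (hx n.+1 * ht n) <= I x' (x' + hx n.+1) t (t + ht n)].
  rewrite /x'; case: ifPn => [?|]; first by split=> //; lra.
  rewrite -ltNge => hlt; split; try lra.
  move: h5; rewrite (@I_splitx x (x + hx n.+1) (x + hx n))//; try lra.
  have -> : x + hx n = x + hx n.+1 + hx n.+1 by lra.
  by rewrite {1}hxE; lra.
split=> //; case: ifPn => [?|]; rewrite -?ltNge; try lra.
move=> hlt; move: hx3; rewrite (@I_splitt x' (x' + hx n.+1) t (t + ht n.+1) (t + ht n))//; try lra.
have -> : t + ht n = t + ht n.+1 + ht n.+1 by lra.
by rewrite {1}htE; lra.
Qed.

Lemma stokes_contra : False.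
Proof.
have [x hx'] : exists x, forall n, (corner n).1 <= x <= (corner n).1 + hx n.
  apply: nested_intervals => n.
  - by rewrite /= ; case: ifPn => _ //; have := hx_gt0 n.+1; lra.
  - by have := hxS n; have := hx_gt0 n.+1; rewrite /=; case: ifPn => _; lra.
  - by have := hx_gt0 n; lra.
have [t ht'] : exists t, forall n, (corner n).2 <= t <= (corner n).2 + ht n.
  apply: nested_intervals => n.
  - by rewrite /=; case: ifPn => _ //; have := ht_gt0 n.+1; lra.
  - by have := htS n; have := ht_gt0 n.+1; rewrite /=; case: ifPn => _; lra.
  - by have := ht_gt0 n; lra.
have hxt : 0 < x2 - x1 + (t2 - t1) by rewrite addr_gt0 ?subr_gt0.
(* Chosen so that [e] times the square of the half-perimeter is half of [e0] times the area; both
   scale by 1/4 at each bisection, so this persists for all [n]. *)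
pose e := e0 * ((x2 - x1) * (t2 - t1)) / (2 * (x2 - x1 + (t2 - t1)) ^+ 2).
have e_gt0 : 0 < e by rewrite divr_gt0// ?mulr_gt0 ?exprn_gt0 ?subr_gt0.
have xx : x1 <= x <= x2 by have [? ? ? ? _] := cornerP 0; have /andP[? ?] := hx' 0%N; slra.
have tt : t1 <= t <= t2 by have [? ? ? ? _] := cornerP 0; have /andP[? ?] := ht' 0%N; slra.
have [c [d d0 H]] := PQ xx tt e_gt0.
have [n hn] := exists_half_lt (x2 - x1 + (t2 - t1)) d0.
have pn : 0 < 2 ^+ n :> R by rewrite exprn_gt0.
have hsum : hx n + ht n = (x2 - x1 + (t2 - t1)) / 2 ^+ n by rewrite /hx /ht -mulrDl.
have [c1 c2 c3 c4 c5] := cornerP n.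
have /andP[l1 l2] := hx' n; have /andP[l3 l4] := ht' n.
have hx0 := hx_gt0 n; have ht0 := ht_gt0 n.
move: c1 c2 c3 c4 c5 l1 l2 l3 l4; move: (corner n) => [y s] /= c1 c2 c3 c4 c5 l1 l2 l3 l4.
have d1 : y + hx n - y < d by lra.
have d2 : s + ht n - s < d by lra.
have [HQ HP] := H y (y + hx n) s (s + ht n) c1 l1 l2 c2 d1 c3 l3 l4 c4 d2.
have iP' r : s <= r <= s + ht n -> itv_intble y (y + hx n) (P^~ r).
  by move=> /andP[? ?]; apply: itv_intbleS (iP _); slra.
have iQ' r : y <= r <= y + hx n -> itv_intble s (s + ht n) (Q r).
  by move=> /andP[? ?]; apply: itv_intbleS (iQ _); slra.
have b1 : itv_int y (y + hx n) (fun r => P r s - P r (s + ht n)) <=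
    (- c * (s + ht n - s) + e * (y + hx n - y + (s + ht n - s))) * (y + hx n - y).
  by apply: itv_int_le => //; [lra|apply: itv_intbleB; apply: iP'; slra].
have b2 : itv_int s (s + ht n) (fun r => Q (y + hx n) r - Q y r) <=
    (c * (y + hx n - y) + e * (y + hx n - y + (s + ht n - s))) * (s + ht n - s).
  by apply: itv_int_le => //; [lra|apply: itv_intbleB; apply: iQ'; slra].
(* The terms in [c] of [b1] and [b2] cancel. *)
have {b1 b2 c5} : e0 * (hx n * ht n) <= e * (hx n + ht n) ^+ 2.
  by apply: (le_trans c5); rewrite /I; apply: (le_trans (lerD b1 b2)); lra.
have -> : e * (hx n + ht n) ^+ 2 = e0 * (hx n * ht n) / 2.
  rewrite hsum /e /hx /ht; field.
  by rewrite (gt_eqF pn) (gt_eqF hxt).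
by have := mulr_gt0 e0_gt0 (mulr_gt0 hx0 ht0); lra.
Qed.
End stokes.

Lemma stokes_le (P Q : R -> R -> R) (x1 x2 t1 t2 : R) : x1 < x2 -> t1 < t2 ->
  (forall t, t1 <= t <= t2 -> itv_intble x1 x2 (P^~ t)) ->
  (forall x, x1 <= x <= x2 -> itv_intble t1 t2 (Q x)) ->
  (forall x t (e : R), x1 <= x <= x2 -> t1 <= t <= t2 -> 0 < e ->
  exists c : R, exists2 d : R, 0 < d & forall y1 y2 s1 s2,
    x1 <= y1 -> y1 <= x -> x <= y2 -> y2 <= x2 -> y2 - y1 < d ->
    t1 <= s1 -> s1 <= t -> t <= s2 -> s2 <= t2 -> s2 - s1 < d ->
    (forall s, s1 <= s <= s2 ->
       Q y2 s - Q y1 s <= c * (y2 - y1) + e * ((y2 - y1) + (s2 - s1))) /\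
    (forall y, y1 <= y <= y2 ->
       P y s1 - P y s2 <= - c * (s2 - s1) + e * ((y2 - y1) + (s2 - s1)))) ->
  itv_int x1 x2 (fun y => P y t1 - P y t2) + itv_int t1 t2 (fun s => Q x2 s - Q x1 s) <= 0.
Proof.
move=> x12 t12 iP iQ H; rewrite leNgt; apply/negP => I0.
have area : 0 < (x2 - x1) * (t2 - t1) by rewrite mulr_gt0 ?subr_gt0.
apply: (stokes_contra x12 t12 iP iQ H (divr_gt0 I0 area)).
by rewrite divfK// gt_eqF.
Qed.
End intervals.

(** * Differentiability of real functions of two variables *)

Section rdiff. Variable R : realType.
Implicit Types (F G : R -> R -> R) (x t a b : R).

Lemma caratheodory (h : R -> R) (y0 d : R) : is_derive y0 (1 : R) h d <->
  exists eta : R -> R, [/\ {for y0, continuous eta}, eta y0 = d &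
    forall y, h y = h y0 + eta y * (y - y0)].
Proof.
split.
- move=> [hd hE].
  exists (fun y => if y == y0 then d else (h y - h y0) / (y - y0)); split.
  + apply/cvgrPdist_lt => e e_gt0; rewrite eqxx.
    have := hd; rewrite /derivable => /cvgrPdist_lt /(_ _ e_gt0).
    rewrite near_withinE => -[r /= r0 hr]; exists r => //= y /=.
    rewrite distrC => yr; case: eqP => [_|/eqP yy]; first by rewrite subrr normr0.
    have := hr (y - y0); rewrite /ball_ /= sub0r normrN subr_eq0 => /(_ yr yy).
    by rewrite [_%:A]mulr1 subrK -hE /derive /= [_ *: _]mulrC.
  + by rewrite eqxx.
  + move=> y; case: eqP => [->|/eqP yy]; first by rewrite subrr mulr0 addr0.
    by rewrite divfK ?subr_eq0// addrC subrK.
- move=> [eta [ce ed hE]].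
  have H : (fun k : R => k^-1 *: ((h \o shift y0) (k *: 1) - h y0)) @ 0^' --> d.
    apply/cvgrPdist_lt => e e_gt0; rewrite near_withinE.
    move/cvgrPdist_lt : ce => /(_ _ e_gt0) -[r /= r0 hr]; exists r => //= k /=.
    rewrite sub0r normrN => kr k0.
    have -> : k^-1 *: ((h \o shift y0) k%:A - h y0) = eta (k + y0).
      by rewrite /GRing.scale /= mulr1 (hE (k + y0)); field.
    rewrite -ed.
    by apply: hr => /=; rewrite opprD addrA addrAC subrr sub0r normrN.
  split; first by apply/cvg_ex; exists d.
  exact: (cvg_lim _ H).
Qed.

(* Frechet differentiability in Caratheodory's form. *)
Definition rdiff F x t a b := exists al be : R * R -> R,
  [/\ {for (x, t), continuous al}, {for (x, t), continuous be},
      al (x, t) = a, be (x, t) = b &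
      forall y s, F y s = F x t + al (y, s) * (y - x) + be (y, s) * (s - t)].

Lemma rdiff_cont F x t a b : rdiff F x t a b -> {for (x, t), continuous (fun z : R * R => F z.1 z.2)}.
Proof.
move=> [al [be [ca cb _ _ FE]]]; rewrite /prop_for/continuous_at.
have -> : F (x, t).1 (x, t).2 = F x t + al (x, t) * (x - x) + be (x, t) * (t - t) by rewrite !subrr; ring.
have /funext E : forall z : R * R, F z.1 z.2 = F x t + al z * (z.1 - x) + be z * (z.2 - t).
  by move=> [y s]; rewrite /= FE.
rewrite [X in X @ _ --> _]E.
have c1 : (fun z : R * R => z.1) @ (x, t) --> x by exact: cvg_fst.
have c2 : (fun z : R * R => z.2) @ (x, t) --> t by exact: cvg_snd.
by apply: cvgD; [apply: cvgD; [exact: cvg_cst|]|]; apply: cvgM => //; apply: cvgB => //; exact: cvg_cst.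
Qed.

Lemma eq_rdiff F G x t a b a' b' : (forall y s, F y s = G y s) -> a = a' -> b = b' ->
  rdiff F x t a b -> rdiff G x t a' b'.
Proof.
move=> FG <- <- [al [be [ca cb ea eb FE]]]; exists al, be; split=> // y s.
by rewrite -!FG FE.
Qed.

Lemma rdiff_cst (c : R) x t : rdiff (fun _ _ => c) x t 0 0.
Proof.
exists (fun=> 0), (fun=> 0); split=> // [||y s]; try exact: cst_continuous.
by rewrite !mul0r !addr0.
Qed.

Lemma rdiff_fst x t : rdiff (fun y _ => y) x t 1 0.
Proof.
exists (fun=> 1), (fun=> 0); split=> // [||y s]; try exact: cst_continuous.
by ring.
Qed.

Lemma rdiff_snd x t : rdiff (fun _ s => s) x t 0 1.
Proof.
exists (fun=> 0), (fun=> 1); split=> // [||y s]; try exact: cst_continuous.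
by ring.
Qed.

Lemma rdiffD F G x t a b c d : rdiff F x t a b -> rdiff G x t c d ->
  rdiff (fun y s => F y s + G y s) x t (a + c) (b + d).
Proof.
move=> [al [be [ca cb ea eb FE]]] [al' [be' [ca' cb' ea' eb' GE]]].
exists (fun z => al z + al' z), (fun z => be z + be' z); split=> [|| | |y s].
- exact: cvgD.
- exact: cvgD.
- by rewrite ea ea'.
- by rewrite eb eb'.
- by rewrite FE GE; ring.
Qed.

Lemma rdiffM F G x t a b c d : rdiff F x t a b -> rdiff G x t c d ->
  rdiff (fun y s => F y s * G y s) x t (a * G x t + F x t * c) (b * G x t + F x t * d).
Proof.
move=> hF hG; have cG := rdiff_cont hG; move: hF hG.
move=> [al [be [ca cb ea eb FE]]] [al' [be' [ca' cb' ea' eb' GE]]].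
exists (fun z => al z * G z.1 z.2 + F x t * al' z), (fun z => be z * G z.1 z.2 + F x t * be' z); split=> [|| | |y s].
- by apply: cvgD; apply: cvgM => //; exact: cvg_cst.
- by apply: cvgD; apply: cvgM => //; exact: cvg_cst.
- by rewrite ea ea'.
- by rewrite eb eb'.
- by rewrite /= (FE y s) (GE y s); ring.
Qed.

Lemma rdiff_comp (h : R -> R) F x t a b (h' : R) : rdiff F x t a b -> is_derive (F x t) (1 : R) h h' ->
  rdiff (fun y s => h (F y s)) x t (h' * a) (h' * b).
Proof.
move=> hF; have cF := rdiff_cont hF; move: hF => [al [be [ca cb ea eb FE]]].
move=> /caratheodory[eta [ce ed hE]].
have ceF : {for (x, t), continuous (fun z : R * R => eta (F z.1 z.2))}.
  exact: (@continuous_comp _ _ _ (fun z : R * R => F z.1 z.2) eta (x, t) cF ce).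
exists (fun z => eta (F z.1 z.2) * al z), (fun z => eta (F z.1 z.2) * be z); split=> [|| | |y s].
- exact: (cvgM ceF ca).
- exact: (cvgM ceF cb).
- by rewrite /= ed ea.
- by rewrite /= ed eb.
- by rewrite (hE (F y s)) /= {2}(FE y s); ring.
Qed.

Lemma rdiffZ (c : R) F x t a b : rdiff F x t a b -> rdiff (fun y s => c * F y s) x t (c * a) (c * b).
Proof. by move=> /(rdiffM (rdiff_cst c x t)); apply: eq_rdiff => //; ring. Qed.

Lemma rdiffN F x t a b : rdiff F x t a b -> rdiff (fun y s => - F y s) x t (- a) (- b).
Proof. by move=> /(rdiffZ (-1)); apply: eq_rdiff => *; ring. Qed.

Lemma rdiffB F G x t a b c d : rdiff F x t a b -> rdiff G x t c d ->
  rdiff (fun y s => F y s - G y s) x t (a - c) (b - d).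
Proof. by move=> hF /rdiffN; exact: rdiffD. Qed.

Lemma rdiffV F x t a b : rdiff F x t a b -> F x t != 0 ->
  rdiff (fun y s => (F y s)^-1) x t (- a / F x t ^+ 2) (- b / F x t ^+ 2).
Proof.
move=> hF F0.
have H : is_derive (F x t) (1:R) (fun y : R => y^-1) (- (F x t) ^- 2).
  apply: DeriveDef; first by apply: derivableV.
  by rewrite deriveV// derive_id [_ *: _]mulr1.
by apply: eq_rdiff (rdiff_comp hF H) => //; rewrite !mulNr mulrC.
Qed.

Lemma rdiff_sym F x t a b : rdiff F x t a b -> rdiff (fun y s => F s y) t x b a.
Proof.
move=> [al [be [ca cb ea eb FE]]].
have sw : {for (t, x), continuous (fun z : R * R => (z.2, z.1))}.
  exact: (@swap_continuous R R (t, x)).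
exists (fun z => be (z.2, z.1)), (fun z => al (z.2, z.1)); split=> //= [||y s].
- exact: (@continuous_comp _ _ _ (fun z : R * R => (z.2, z.1)) be (t, x) sw cb).
- exact: (@continuous_comp _ _ _ (fun z : R * R => (z.2, z.1)) al (t, x) sw ca).
- by rewrite FE; ring.
Qed.

Lemma rdiff_dx F x t a b : rdiff F x t a b -> is_derive x (1:R) (F^~ t) a.
Proof.
move=> [al [be [ca cb ea eb FE]]]; apply/caratheodory.
exists (fun y => al (y, t)); split=> //; last by move=> y; rewrite FE; ring.
apply: (@continuous_comp _ _ _ (fun y : R => (y, t)) al x _ ca).
apply: (@cvg_pair R R R (nbhs x) (nbhs x) (nbhs t) _ _ _ id (fun=> t)); [exact: cvg_id|exact: cvg_cst].
Qed.

Lemma rdiff_dt F x t a b : rdiff F x t a b -> is_derive t (1:R) (F x) b.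
Proof. by move=> /rdiff_sym/rdiff_dx. Qed.

Lemma rdiff_small F x t a b e : rdiff F x t a b -> 0 < e -> exists2 d : R, 0 < d &
  forall y s, `|y - x| < d -> `|s - t| < d ->
  `|F y s - F x t - a * (y - x) - b * (s - t)| <= e * (`|y - x| + `|s - t|).
Proof.
move=> [al [be [/cvgrPdist_lt ca /cvgrPdist_lt cb ea eb FE]]] e0.
have [d1 /= d1_gt0 h1] : exists2 d : R, 0 < d & forall y s, `|y - x| < d -> `|s - t| < d ->
    `|al (y, s) - a| < e /\ `|be (y, s) - b| < e.
  have := filterI (ca _ e0) (cb _ e0) => -[[A B] /= [[r1 /= r10 hA] [r2 /= r20 hB]] AB].
  exists (Num.min r1 r2); first by rewrite lt_min r10.
  move=> y s; rewrite !lt_min => /andP[y1 y2] /andP[s1 s2].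
  have Ay : A y by apply: hA; rewrite /= distrC.
  have Bs : B s by apply: hB; rewrite /= distrC.
  have [] := AB (y, s) (conj Ay Bs).
  by rewrite ea eb !(distrC _ a) !(distrC _ b).
exists d1 => // y s yd sd; have [ha hb] := h1 y s yd sd.
have -> : F y s - F x t - a * (y - x) - b * (s - t) =
  (al (y, s) - a) * (y - x) + (be (y, s) - b) * (s - t) by rewrite FE; ring.
rewrite (le_trans (ler_normD _ _))// !normrM mulrDr lerD// ler_wpM2r// ltW//.
Qed.

End rdiff.

(** * Increment bounds and the resulting forms of Stokes *)

Section inc. Variable R : realType.
Implicit Types (F G P Q : R -> R -> R) (x t a b c e : R).

(* An upper bound on increments across the point, weaker than differentiability:
   the comparison function in the mean estimates is only monotone in [x]. *)
Definition increment_x F x t c e := exists2 d : R, 0 < d & forall y1 y2 s,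
  y1 <= x -> x <= y2 -> y2 - y1 < d -> `|s - t| < d ->
  F y2 s - F y1 s <= c * (y2 - y1) + e * ((y2 - y1) + `|s - t|).

Definition increment_t F x t c e := increment_x (fun s y => F y s) t x c e.

Lemma rdiff_increment_x F x t a b e : rdiff F x t a b -> 0 < e -> increment_x F x t a e.
Proof.
(* The increment is split at [x], and the error in [|s - t|] is then counted twice. *)
move=> hF e0; have e2 : 0 < e / 2 by rewrite divr_gt0.
have [d d0 hd] := rdiff_small hF e2; exists d => // y1 y2 s y1x xy2 yd sd.
have n1 : `|y1 - x| = x - y1 by rewrite ler0_norm; lra.
have n2 : `|y2 - x| = y2 - x by rewrite ger0_norm; lra.
have := hd y1 s _ sd; have := hd y2 s _ sd.
rewrite n1 n2 => /(_ ltac:(lra)) H2 /(_ ltac:(lra)) H1.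
have /andP[_ l2] : - (e / 2 * (y2 - x + `|s - t|)) <= F y2 s - F x t - a * (y2 - x) - b * (s - t) <= (e / 2 * (y2 - x + `|s - t|)) by rewrite -ler_norml.
have /andP[l1 _] : - (e / 2 * (x - y1 + `|s - t|)) <= F y1 s - F x t - a * (y1 - x) - b * (s - t) <= (e / 2 * (x - y1 + `|s - t|)) by rewrite -ler_norml.
have := normr_ge0 (s - t); nra.
Qed.

Lemma rdiff_increment_t F x t a b e : rdiff F x t a b -> 0 < e -> increment_t F x t b e.
Proof. by move=> /rdiff_sym; exact: rdiff_increment_x. Qed.

Lemma stokes_inc P Q (x1 x2 t1 t2 : R) : x1 < x2 -> t1 < t2 ->
  (forall t, t1 <= t <= t2 -> itv_intble x1 x2 (P^~ t)) ->
  (forall x, x1 <= x <= x2 -> itv_intble t1 t2 (Q x)) ->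
  (forall x t e, x1 <= x <= x2 -> t1 <= t <= t2 -> 0 < e ->
    exists q p, [/\ increment_x Q x t q e, increment_t (fun y s => - P y s) x t p e & q + p <= 0]) ->
  itv_int x1 x2 (fun y => P y t1 - P y t2) + itv_int t1 t2 (fun s => Q x2 s - Q x1 s) <= 0.
Proof.
move=> x12 t12 iP iQ H; apply: stokes_le => // x t e xx tt e0.
have [q [p [[d1 d10 h1] [d2 d20 h2] qp]]] := H x t e xx tt e0.
exists q, (Num.min d1 d2); first by rewrite lt_min d10.
move=> y1 y2 s1 s2 a1 a2 a3 a4; rewrite lt_min => /andP[a5 a6] a7 a8 a9 a10.
rewrite lt_min => /andP[a11 a12]; split.
- move=> s /andP[ss1 ss2].
  have st : `|s - t| <= s2 - s1 by rewrite ler_norml; slra.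
  apply: (le_trans (h1 y1 y2 s a2 a3 a5 (le_lt_trans st a11))).
  have : e * (y2 - y1 + `|s - t|) <= e * (y2 - y1 + (s2 - s1)) by rewrite ler_pM2l// lerD2l.
  lra.
- move=> y /andP[yy1 yy2].
  have st : `|y - x| <= y2 - y1 by rewrite ler_norml; slra.
  have := h2 s1 s2 y a8 a9 a12 (le_lt_trans st a6).
  have : e * (s2 - s1 + `|y - x|) <= e * (s2 - s1 + (y2 - y1)) by rewrite ler_pM2l// lerD2l.
  have : 0 <= s2 - s1 by lra.
  nra.
Qed.

Lemma itv_intble_cont_at a b (h : R -> R) : (forall x, a <= x <= b -> {for x, continuous h}) -> itv_intble a b h.
Proof.
move=> ch; apply: itv_intble_cont; apply/continuous_in_subspaceT => x; rewrite inE/= in_itv/=; exact: ch.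
Qed.

Lemma derive_cont (h : R -> R) (x d : R) : is_derive x (1 : R) h d -> {for x, continuous h}.
Proof. by move=> [hd _]; apply: differentiable_continuous; apply/derivable1_diffP. Qed.

Lemma stokes_rdiff P Q (x1 x2 t1 t2 : R) : x1 < x2 -> t1 < t2 ->
  (forall x t, x1 <= x <= x2 -> t1 <= t <= t2 ->
    exists qa qb pa pb, [/\ rdiff Q x t qa qb, rdiff P x t pa pb & qa <= pb]) ->
  itv_int x1 x2 (fun y => P y t1 - P y t2) + itv_int t1 t2 (fun s => Q x2 s - Q x1 s) <= 0.
Proof.
move=> x12 t12 H; apply: stokes_inc => // [t tt|x xx|x t e xx tt e0].
- apply: itv_intble_cont_at => x xx; have [qa [qb [pa [pb [_ hP _]]]]] := H x t xx tt.
  exact: derive_cont (rdiff_dx hP).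
- apply: itv_intble_cont_at => t tt; have [qa [qb [pa [pb [hQ _ _]]]]] := H x t xx tt.
  exact: derive_cont (rdiff_dt hQ).
- have [qa [qb [pa [pb [hQ hP qp]]]]] := H x t xx tt.
  exists qa, (- pb); split; [exact: rdiff_increment_x hQ e0|exact: rdiff_increment_t (rdiffN hP) e0|lra].
Qed.

End inc.

(** * Cauchy-Riemann equations and the complex exponential *)

Section holo. Variable R : realType.
Implicit Types (z w d : R[i]) (f g k : R[i] -> R[i]).
Local Notation nm := (@modulus R).

Lemma cont_pair (x t : R) : {for (x, t), continuous (fun z : R * R => z.1 +i* z.2 : R[i]^o)}.
Proof.
apply: cvg_complex => /=; first by apply: cvg_fst.
by apply: cvg_snd.
Qed.

Lemma cdiff_rdiff_Re g (x t : R) d : cdiff g (x +i* t) d ->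
  rdiff (fun y s => complex.Re (g (y +i* s))) x t (complex.Re d) (- complex.Im d).
Proof.
move=> [phi [cphi <- gE]].
have cP : {for (x, t), continuous (fun z : R * R => phi (z.1 +i* z.2))}.
  exact: (@continuous_comp _ _ _ (fun z : R * R => z.1 +i* z.2 : R[i]^o) phi (x, t) (@cont_pair x t) cphi).
exists (fun u : R * R => complex.Re (phi (u.1 +i* u.2))), (fun u : R * R => - complex.Im (phi (u.1 +i* u.2))).
split=> // [||y s].
- apply: (@continuous_comp _ _ _ (fun z : R * R => phi (z.1 +i* z.2)) (@complex.Re R : R[i]^o -> R) (x, t) cP).
  exact: continuous_Re.
- apply: cvgN.
  apply: (@continuous_comp _ _ _ (fun z : R * R => phi (z.1 +i* z.2)) (@complex.Im R : R[i]^o -> R) (x, t) cP).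
  exact: continuous_Im.
- rewrite (gE (y +i* s)) /=; case: (phi _) => u v; case: (g _) => u' v' /=; ring.
Qed.

(** The imaginary part of [g] is the real part of -i g. *)
Lemma cdiff_rdiff_Im g (x t : R) d : cdiff g (x +i* t) d ->
  rdiff (fun y s => complex.Im (g (y +i* s))) x t (complex.Im d) (complex.Re d).
Proof.
move=> hg; have := cdiff_rdiff_Re (cdiffM (cdiff_cst (0 +i* (-1)) (x +i* t)) hg).
apply: eq_rdiff => [y s||]; last 2 first.
- by rewrite mul0r add0r; case: d {hg} => u v /=; ring.
- by rewrite mul0r add0r; case: d {hg} => u v /=; ring.
by case: (g _) => u v /=; ring.
Qed.

Lemma rdiff_cdiff (U V : R -> R -> R) (x t p q : R) : rdiff U x t p (- q) -> rdiff V x t q p ->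
  cdiff (fun w => U (complex.Re w) (complex.Im w) +i* V (complex.Re w) (complex.Im w)) (x +i* t) (p +i* q).
Proof.
move=> hU hV; set g := fun w => _.
exists (fun w => if w == x +i* t then p +i* q else (g w - g (x +i* t)) / (w - (x +i* t))); split.
- apply/ccontP => e e0; rewrite eqxx.
  (* The real and imaginary remainders are each at most e / 8 times 2 N, N being the distance to the
     point, which leaves e / 2 < e for the quotient. *)
  have e8 : 0 < e / 8 by rewrite divr_gt0.
  have [d1 d10 h1] := rdiff_small hU e8; have [d2 d20 h2] := rdiff_small hV e8.
  exists (Num.min d1 d2); first by rewrite lt_min d10.
  move=> w; rewrite lt_min => /andP[w1 w2]; case: eqP => [_|/eqP wz]; first by rewrite subrr nm0.
  have nz : 0 < nm (w - (x +i* t)) by rewrite lt_neqAle nm_ge0 eq_sym nm_eq0 subr_eq0 wz.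
  have -> : (g w - g (x +i* t)) / (w - (x +i* t)) - (p +i* q) =
    (g w - g (x +i* t) - (p +i* q) * (w - (x +i* t))) / (w - (x +i* t)).
    by rewrite [in RHS]mulrBl mulfK// subr_eq0.
  rewrite nmM nmV ltr_pdivrMr//; apply: (le_lt_trans (nm_le _)).
  have rw := re_le_nm (w - (x +i* t)); have iw := im_le_nm (w - (x +i* t)).
  move: w1 w2 nz rw iw {wz}; rewrite /g; case: w => y s /=;
  set N := nm _ => w1 w2 nz rw iw.
  have := h1 y s (le_lt_trans rw w1) (le_lt_trans iw w1).
  have := h2 y s (le_lt_trans rw w2) (le_lt_trans iw w2).
  have -> : U y s - U x t - (p * (y - x) - q * (s - t)) = U y s - U x t - p * (y - x) - - q * (s - t) by ring.
  have -> : V y s - V x t - (p * (s - t) + q * (y - x)) = V y s - V x t - q * (y - x) - p * (s - t) by ring.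
  by nra.
- by rewrite eqxx.
- move=> w; case: eqP => [->|/eqP wz]; first by rewrite subrr mulr0 addr0.
  by rewrite divfK ?subr_eq0// addrC subrK.
Qed.

(* [expi] without its cast to [Cborel]. *)
Definition ei (t : R) : R[i] := cos t +i* sin t.
Definition cexp z : R[i] := (expR (complex.Re z))%:C * ei (complex.Im z).

Lemma nm_ei (t : R) : nm (ei t) = 1.
Proof.
apply/eqP; rewrite -(@pexpr_eq1 _ _ 2)// ?nm_ge0// nm_sqr /= cos2Dsin2 //.
Qed.

Lemma nm_cexp z : nm (cexp z) = expR (complex.Re z).
Proof. by rewrite nmM nm_ei mulr1 nm_real gtr0_norm// expR_gt0. Qed.

Lemma cdiff_cexp z : cdiff cexp z (cexp z).
Proof.
case: z => x t.
have h1 := rdiffM (rdiff_comp (rdiff_fst x t) (is_derive_expR x)) (rdiff_comp (rdiff_snd x t) (is_derive_cos t)).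
have h2 := rdiffM (rdiff_comp (rdiff_fst x t) (is_derive_expR x)) (rdiff_comp (rdiff_snd x t) (is_derive_sin t)).
have -> : cexp (x +i* t) = (expR x * cos t) +i* (expR x * sin t).
  by rewrite /cexp /ei /=; apply/eqP; rewrite eq_complex /=; apply/andP; split; apply/eqP; ring.
have H : cdiff (fun w => (expR (complex.Re w) * cos (complex.Im w)) +i* (expR (complex.Re w) * sin (complex.Im w)))
   (x +i* t) ((expR x * cos t) +i* (expR x * sin t)).
  by apply: (@rdiff_cdiff (fun y s => expR y * cos s) (fun y s => expR y * sin s)); [apply: eq_rdiff h1|apply: eq_rdiff h2] => //; ring.
have -> // : cexp = (fun w => (expR (complex.Re w) * cos (complex.Im w)) +i* (expR (complex.Re w) * sin (complex.Im w))).
apply/funext => w; rewrite /cexp /ei /=; apply/eqP; rewrite eq_complex /=; apply/andP; split; apply/eqP; ring.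
Qed.

End holo.

(** * Circle means and the mean value property *)

Section mean. Variable R : realType.
Implicit Types (z w d a : R[i]) (f k : R[i] -> R[i]) (g h : R -> R[i]) (rho t x : R).
Local Notation nm := (@modulus R).
Local Notation twopi := (2 * pi : R).

(** A wrapper that is not convertible to continuity and keeps the cast to [R[i]^o] out of the
    statements about curves. *)
Variant ccurve g : Prop := Ccurve of continuous (g : R -> R[i]^o).

Lemma ccurveP g : ccurve g -> continuous (g : R -> R[i]^o).
Proof. by case. Qed.

Lemma ccurve_Re g : ccurve g -> continuous (fun t => complex.Re (g t)).
Proof. by move=> [cg] t; apply: (@continuous_comp _ _ _ (g : R -> R[i]^o) (@complex.Re R : R[i]^o -> R) t (cg t)); exact: continuous_Re. Qed.

Lemma ccurve_Im g : ccurve g -> continuous (fun t => complex.Im (g t)).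
Proof. by move=> [cg] t; apply: (@continuous_comp _ _ _ (g : R -> R[i]^o) (@complex.Im R : R[i]^o -> R) t (cg t)); exact: continuous_Im. Qed.

Lemma ccurveM g h : ccurve g -> ccurve h -> ccurve (fun t => g t * h t).
Proof. by move=> [cg] [ch]; split=> t; exact: (@cvgM R[i] _ _ _ (g : R -> R[i]^o) (h : R -> R[i]^o) (g t) (h t) (cg t) (ch t)). Qed.

Lemma ccurveD g h : ccurve g -> ccurve h -> ccurve (fun t => g t + h t).
Proof. by move=> [cg] [ch]; split=> t; exact: (@cvgD _ _ _ _ _ (g : R -> R[i]^o) (h : R -> R[i]^o) (g t) (h t) (cg t) (ch t)). Qed.

Lemma ccurve_cst (c : R[i]) : ccurve (fun=> c).
Proof. by split=> t; exact: cst_continuous. Qed.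

Lemma ccurveZ (c : R[i]) g : ccurve g -> ccurve (fun t => c * g t).
Proof. by move=> cg; exact: ccurveM (ccurve_cst c) cg. Qed.

Lemma ccurveB g h : ccurve g -> ccurve h -> ccurve (fun t => g t - h t).
Proof.
move=> cg ch; have := ccurveD cg (ccurveZ (-1) ch).
by under eq_fun do rewrite mulN1r.
Qed.

Lemma ccurve_ei : ccurve (@ei R).
Proof. by split=> t; apply: cvg_complex; [exact: continuous_cos|exact: continuous_sin]. Qed.

Definition circ a rho t : R[i] := a + rho%:C * ei t.

Lemma nm_circ a rho t : 0 <= rho -> nm (circ a rho t - a) = rho.
Proof. by move=> r0; rewrite /circ addrC addKr nmM nm_ei nm_real mulr1 ger0_norm. Qed.

Lemma ccurve_circ a rho : ccurve (circ a rho).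
Proof. by apply: ccurveD; [exact: ccurve_cst|apply: ccurveM; [exact: ccurve_cst|exact: ccurve_ei]]. Qed.

Lemma ccurve_comp f g : ccurve g -> (forall t, {for g t, continuous (f : R[i]^o -> R[i]^o)}) ->
  ccurve (fun t => f (g t)).
Proof. by move=> [cg] cf; split=> t; exact: (@continuous_comp _ _ _ (g : R -> R[i]^o) (f : R[i]^o -> R[i]^o) t (cg t) (cf t)). Qed.

Lemma continuous_conj a : {for a, continuous (fun z : R[i]^o => z^* : R[i]^o)}.
Proof. by apply/ccontP => e e0; exists e => // w; rewrite -rmorphB nm_conj. Qed.

Lemma ccurve_conj g : ccurve g -> ccurve (fun t => (g t)^*).
Proof. by move=> cg; apply: (ccurve_comp cg) => t; exact: continuous_conj. Qed.

Definition cmean g : R[i] := twopi^-1 * itv_int 0 twopi (fun t => complex.Re (g t)) +i*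
  (twopi^-1 * itv_int 0 twopi (fun t => complex.Im (g t))).

Lemma twopi0 : 0 < twopi. Proof. exact: twopi_gt0. Qed.

Lemma continuous_itv_intble (h : R -> R) (a b : R) : continuous h -> itv_intble a b h.
Proof. by move=> ch; apply: itv_intble_cont; exact: continuous_subspaceT. Qed.

(* In the coordinate [a + cexp z] the punctured disc is a strip on which
   Stokes applies; continuity at [a] controls the other end of the strip. *)
Lemma Re_mean_value k a rho : 0 < rho ->
  (forall z, 0 < nm (z - a) -> nm (z - a) <= rho -> exists d, cdiff k z d) ->
  {for a, continuous (k : R[i]^o -> R[i]^o)} ->
  itv_int 0 twopi (fun t => complex.Re (k (circ a rho t))) <= twopi * complex.Re (k a).
Proof.
move=> r0 hk /ccontP ck.
apply/ler_addgt0Pr => e e0.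
have e1 : 0 < e / twopi by rewrite divr_gt0 ?twopi0.
have [d d0 hd] := ck _ e1.
(* The left side of the strip: strictly left of [ln rho], and mapped to a circle of radius at most d
   / 2, where [k] is within e / (2 pi) of [k a]. *)
pose x1 := Num.min (ln rho - 1) (ln (d / 2)).
have x1r : x1 < ln rho by rewrite gt_min; apply/orP; left; lra.
have ex1 : expR x1 < d.
  have : expR x1 <= d / 2 by rewrite -[leRHS]lnK ?posrE ?divr_gt0// ler_expR ge_min lexx orbT.
  lra.
pose g w := k (a + cexp w).
have hg x t : x <= ln rho -> exists d, cdiff g (x +i* t) d.
  move=> xr; have [] := hk (a + cexp (x +i* t)).
  - by rewrite addrC addKr nm_cexp expR_gt0.
  - by rewrite addrC addKr nm_cexp -[leRHS]lnK ?posrE// ler_expR.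
  - move=> d' hd'; exists (d' * (0 + cexp (x +i* t))).
    exact: (cdiff_comp (cdiffD (cdiff_cst a _) (cdiff_cexp _)) hd').
have gE x t : g (x +i* t) = k (circ a (expR x) t) by [].
pose P y s := complex.Im (g (y +i* s)).
pose Q y s := complex.Re (g (y +i* s)).
have H x t : x1 <= x <= ln rho -> 0 <= t <= twopi ->
    exists qa qb pa pb, [/\ rdiff Q x t qa qb, rdiff P x t pa pb & qa <= pb].
  move=> /andP[_ xr] _; have [d' hd'] := hg x t xr.
  by do 4 eexists; split; [exact: cdiff_rdiff_Re hd'|exact: cdiff_rdiff_Im hd'|].
have cQ x : x <= ln rho -> continuous (Q x).
  by move=> xr t; have [d' /cdiff_rdiff_Re/rdiff_dt/derive_cont] := hg x t xr.
have := stokes_rdiff x1r twopi0 H.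
(* The sides t = 0 and t = 2 pi have the same image, so their contributions cancel. *)
rewrite (@eq_itv_int _ _ _ _ (fun=> 0)); last first.
  move=> y _; rewrite /P !gE /circ /ei.
  by rewrite cos0 sin0 -[2 * pi]add0r mulr_natl cosD2pi sinD2pi cos0 sin0 subrr.
rewrite itv_int_cst ?mul0r ?add0r; last exact: ltW.
rewrite itv_intB; try by apply: continuous_itv_intble; apply: cQ; lra.
rewrite subr_le0.
have -> : Q (ln rho) = (fun t => complex.Re (k (circ a rho t))).
  by apply/funext => t; rewrite /Q gE lnK.
move=> /le_trans; apply.
have -> : twopi * complex.Re (k a) + e = (complex.Re (k a) + e / twopi) * (twopi - 0).
  by rewrite subr0 [RHS]mulrDl divfK ?gt_eqF ?twopi0// [twopi * _]mulrC.
apply: itv_int_le; [exact: ltW twopi0|by apply: continuous_itv_intble; apply: cQ; lra|move=> t _].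
have : nm (k (circ a (expR x1) t) - k a) < e / twopi.
  by apply: hd; rewrite nm_circ// expR_ge0.
move=> /(le_lt_trans (re_le_nm _)); rewrite raddfB /Q gE => /(le_lt_trans (ler_norm _)); lra.
Qed.

Lemma ReNl z w : complex.Re (- z * w) = - complex.Re (z * w).
Proof. by rewrite mulNr raddfN. Qed.

(** The inequality of [Re_mean_value] for c k and for -c k gives an equality of real parts; c = 1
    and c = -i recover both components. Differentiability at the centre is not assumed, so that the
    lemma applies to difference quotients. *)
Lemma mean_value k a rho : 0 < rho ->
  (forall z, 0 < nm (z - a) -> nm (z - a) <= rho -> exists d, cdiff k z d) ->
  {for a, continuous (k : R[i]^o -> R[i]^o)} ->
  cmean (fun t => k (circ a rho t)) = k a.
Proof.
move=> r0 hk ck.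
have ReE (c : R[i]) : itv_int 0 twopi (fun t => complex.Re (c * k (circ a rho t))) = twopi * complex.Re (c * k a).
  have le (c' : R[i]) : itv_int 0 twopi (fun t => complex.Re (c' * k (circ a rho t))) <= twopi * complex.Re (c' * k a).
    have h1 z : 0 < nm (z - a) -> nm (z - a) <= rho -> exists d, cdiff (fun z => c' * k z) z d.
      by move=> z1 z2; have [d hd] := hk z z1 z2; eexists; exact: (cdiffM (cdiff_cst c' z) hd).
    have h2 : {for a, continuous (fun z : R[i]^o => c' * k z : R[i]^o)} := ccontM (@ccont_cst _ c' a) ck.
    exact: (Re_mean_value r0 h1 h2).
  apply/eqP; rewrite eq_le le /=.
  have := le (- c); rewrite ReNl.
  rewrite (@eq_itv_int _ _ _ _ (fun t => (-1) * complex.Re (c * k (circ a rho t)))); last first.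
    by move=> t _; rewrite ReNl mulN1r.
  rewrite itv_intZ ?mulN1r ?mulrN ?lerN2//.
  have radial_defect t : {for circ a rho t, continuous (k : R[i]^o -> R[i]^o)}.
    have n1 : nm (circ a rho t - a) = rho by apply: nm_circ; exact: ltW.
    have [d hd] : exists d, cdiff k (circ a rho t) d by apply: hk; rewrite n1.
    exact: cdiff_cont hd.
  apply: continuous_itv_intble; apply: ccurve_Re; apply: ccurveM; first exact: ccurve_cst.
  exact: (ccurve_comp (ccurve_circ a rho) radial_defect).
have p0 : twopi != 0 by rewrite gt_eqF// twopi0.
apply/eqP; rewrite eq_complex /=; apply/andP; split; apply/eqP.
  by have := ReE 1; under eq_fun do rewrite mul1r; rewrite mul1r => ->; rewrite mulKf.
have := ReE (0 -i* 1).
have E (z : R[i]) : complex.Re ((0 -i* 1) * z) = complex.Im z by case: z => u v /=; ring.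
by under eq_fun do rewrite E; rewrite E => ->; rewrite mulKf.
Qed.
End mean.

(** * Cauchy's formula and estimate for the first derivative *)

Section cauchy. Variable R : realType.
Implicit Types (z w d a : R[i]) (f k : R[i] -> R[i]) (g h : R -> R[i]) (rho t x : R).
Local Notation nm := (@modulus R).
Local Notation twopi := (2 * pi : R).

Lemma eq_cmean g h : (forall t, g t = h t) -> cmean g = cmean h.
Proof. by move=> /funext ->. Qed.

Lemma cmeanD g h : ccurve g -> ccurve h -> cmean (fun t => g t + h t) = cmean g + cmean h.
Proof.
move=> cg ch; apply/eqP; rewrite eq_complex /=; apply/andP; split; apply/eqP; rewrite -mulrDr -itv_intD;
 try (by apply: continuous_itv_intble; exact: ccurve_Re); try (by apply: continuous_itv_intble; exact: ccurve_Im).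
- by congr (_ * _); apply: eq_itv_int => t _; rewrite raddfD.
- by congr (_ * _); apply: eq_itv_int => t _; rewrite raddfD.
Qed.

Lemma cmeanZ (c : R[i]) g : ccurve g -> cmean (fun t => c * g t) = c * cmean g.
Proof.
move=> cg; have i1 := continuous_itv_intble 0 twopi (ccurve_Re cg); have i2 := continuous_itv_intble 0 twopi (ccurve_Im cg).
case: c => u v; apply/eqP; rewrite eq_complex /=; apply/andP; split; apply/eqP.
- rewrite (@eq_itv_int _ _ _ _ (fun t => u * complex.Re (g t) - v * complex.Im (g t))).
    by rewrite itv_intB ?itv_intZ//; [ring|exact: itv_intbleZ|exact: itv_intbleZ].
  by move=> t _; case: (g t).
- rewrite (@eq_itv_int _ _ _ _ (fun t => u * complex.Im (g t) + v * complex.Re (g t))).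
    by rewrite itv_intD ?itv_intZ//; [ring|exact: itv_intbleZ|exact: itv_intbleZ].
  by move=> t _; case: (g t).
Qed.

Lemma cmeanB g h : ccurve g -> ccurve h -> cmean (fun t => g t - h t) = cmean g - cmean h.
Proof.
move=> cg ch; rewrite (@eq_cmean _ (fun t => g t + (-1) * h t)); last by move=> t; rewrite mulN1r.
by rewrite (cmeanD cg (ccurveZ _ ch)) (cmeanZ _ ch) mulN1r.
Qed.

Lemma cmean_conj g : ccurve g -> cmean (fun t => (g t)^*) = (cmean g)^*.
Proof.
move=> cg; apply/eqP; rewrite eq_complex /=; apply/andP; split; apply/eqP.
  by congr (_ * _); apply: eq_itv_int => t _; case: (g t).
rewrite -mulrN; congr (_ * _); rewrite -mulN1r -itv_intZ; last by apply: continuous_itv_intble; exact: ccurve_Im.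
by apply: eq_itv_int => t _; rewrite mulN1r; case: (g t).
Qed.

Lemma Re_cmean_le g (M : R) : ccurve g -> (forall t, complex.Re (g t) <= M) ->
  complex.Re (cmean g) <= M.
Proof.
move=> cg gM; rewrite /= ler_pdivrMl ?twopi0//; have -> : twopi * M = M * (twopi - 0) by ring.
by apply: itv_int_le => //; [exact: ltW (twopi0 R)|apply: continuous_itv_intble; exact: ccurve_Re].
Qed.

Lemma Re_conjM z : complex.Re (z^* * z) = nm z ^+ 2.
Proof. by rewrite nm_sqr; case: z => u v /=; ring. Qed.

(** Multiplying by the conjugate of the mean reduces the modulus to a real part. *)
Lemma nm_cmean_le g (M : R) : ccurve g -> (forall t, nm (g t) <= M) -> nm (cmean g) <= M.
Proof.
move=> cg gM; have [->|z0] := eqVneq (cmean g) 0.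
  by rewrite nm0 (le_trans (nm_ge0 _) (gM 0)).
have nz : 0 < nm (cmean g) by rewrite lt_neqAle nm_ge0 eq_sym nm_eq0 z0.
have : complex.Re (cmean (fun t => (cmean g)^* * g t)) <= nm (cmean g) * M.
  apply: Re_cmean_le; first by exact: ccurveZ.
  move=> t; apply: (le_trans (ler_norm _)); apply: (le_trans (re_le_nm _)).
  by rewrite nmM nm_conj ler_pM2l.
by rewrite cmeanZ// Re_conjM expr2 ler_pM2l.
Qed.

Lemma conj_ei t : (ei t)^* * ei t = 1.
Proof.
rewrite /ei; apply/eqP; rewrite eq_complex /=; apply/andP; split; apply/eqP; last by ring.
by rewrite -(cos2Dsin2 t); ring.
Qed.

Lemma ei_neq0 t : ei t != 0.
Proof. by rewrite -nm_eq0 nm_ei oner_eq0. Qed.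

Lemma circ0 rho t : circ 0 rho t = rho%:C * ei t. Proof. by rewrite /circ add0r. Qed.

Lemma ccurve_conjei : ccurve (fun t => (ei t)^*).
Proof. by apply: ccurve_conj; exact: ccurve_ei. Qed.

Lemma cmean_ei : cmean (@ei R) = 0.
Proof.
have := @mean_value R id 0 1 ltr01 (fun z _ _ => ex_intro _ _ (cdiff_id z)) (@ccont_id _ 0).
by under eq_cmean do rewrite circ0 mul1r.
Qed.

Lemma cmean_conjei : cmean (fun t => (ei t)^*) = 0.
Proof. by rewrite cmean_conj ?cmean_ei ?rmorph0//; exact: ccurve_ei. Qed.

Lemma ccurve_on_circ f f1 a rho : 0 <= rho -> (forall z, nm (z - a) <= rho -> cdiff f z (f1 z)) ->
  ccurve (fun t => f (circ a rho t)).
Proof.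
move=> r0 hf; apply: ccurve_comp; first exact: ccurve_circ.
by move=> t; apply: cdiff_cont (hf _ _); rewrite nm_circ.
Qed.

(** The mean value property of the Caratheodory slope [phi], which is continuous at [a] with value
    [f1 a] and differentiable elsewhere. The term in [f a] disappears because the conjugate of [ei]
    has mean zero. *)
Lemma cauchy1 f f1 a rho : 0 < rho -> (forall z, nm (z - a) <= rho -> cdiff f z (f1 z)) ->
  f1 a = (rho%:C)^-1 * cmean (fun t => f (circ a rho t) * (ei t)^*).
Proof.
move=> r0 hf; have cf := ccurve_on_circ (ltW r0) hf.
have : cdiff f a (f1 a) by apply: hf; rewrite subrr nm0 ltW.
move=> [phi [cphi <- fE]].
have phiE z : z != a -> phi z = (f z - f a) / (z - a).
  by move=> za; rewrite (fE z) addrC addKr mulfK// subr_eq0.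
have rn0 : rho%:C != 0 by rewrite -nm_eq0 nm_real gtr0_norm// gt_eqF.
rewrite -(@mean_value R phi a rho)//; last first.
  move=> z z0 zr.
  have za : z - a != 0 by rewrite -nm_eq0 gt_eqF.
  have H1 := cdiffB (hf z zr) (cdiff_cst (f a) z).
  have H2 := cdiffV (f := fun w => w - a) za (cdiffB (cdiff_id z) (cdiff_cst a z)).
  have H := cdiffM H1 H2.
  have hn w : nm (w - z) < nm (z - a) -> (f w - f a) / (w - a) = phi w.
    move=> wz; rewrite phiE; first by [].
    by apply: contraTneq wz => ->; rewrite nmB ltxx.
  by eexists; exact: (near_cdiff z0 hn H).
rewrite (@eq_cmean _ (fun t => rho%:C^-1 * (f (circ a rho t) * (ei t)^*) - (rho%:C^-1 * f a) * (ei t)^*)).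
  have c1 := ccurveM cf ccurve_conjei.
  rewrite (cmeanB (ccurveZ _ c1) (ccurveZ _ ccurve_conjei)) (cmeanZ _ c1).
  by rewrite (cmeanZ _ ccurve_conjei) cmean_conjei mulr0 subr0.
move=> t; rewrite phiE; last by rewrite -subr_eq0 -nm_eq0 nm_circ ?gt_eqF// ltW.
have -> : (ei t)^* = (ei t)^-1 by rewrite -[LHS](mulfK (ei_neq0 t)) conj_ei mul1r.
have -> : circ a rho t - a = rho%:C * ei t by rewrite /circ addrC addKr.
by field; rewrite ei_neq0 rn0.
Qed.

Lemma cauchy_est f f1 a rho (M : R) : 0 < rho -> (forall z, nm (z - a) <= rho -> cdiff f z (f1 z)) ->
  (forall z, nm (z - a) <= rho -> nm (f z) <= M) -> nm (f1 a) <= M / rho.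
Proof.
move=> r0 hf fM; have cf := ccurve_on_circ (ltW r0) hf.
rewrite (cauchy1 r0 hf) nmM nmV nm_real gtr0_norm// mulrC ler_pM2r ?invr_gt0//.
apply: nm_cmean_le; first by apply: ccurveM => //; exact: ccurve_conjei.
by move=> t; rewrite nmM nm_conj nm_ei mulr1 fM// nm_circ// ltW.
Qed.

End cauchy.

(** * Blaschke factors and the Schwarz-Pick inequality *)

Section schwarzpick. Variable R : realType.
Implicit Types (z w d a c : R[i]) (f k : R[i] -> R[i]) (rho t x : R).
Local Notation nm := (@modulus R).

Lemma conjM_real c : c^* * c = (nm c ^+ 2)%:C.
Proof.
rewrite nm_sqr; case: c => u v; apply/eqP; rewrite eq_complex /=; apply/andP; split; apply/eqP; ring.
Qed.

Lemma blaschke_den c w : nm c < 1 -> nm w < 1 -> 1 - c^* * w != 0.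
Proof.
move=> c1 w1; rewrite subr_eq0; apply: contraTneq (isT) => /(congr1 nm).
rewrite nm1 nmM nm_conj => H.
have := nm_ge0 c; have := nm_ge0 w; nra.
Qed.

Definition blaschke c w := (w - c) / (1 - c^* * w).
Definition blaschke1 c w := (1 - c^* * c) / (1 - c^* * w) ^+ 2.

Lemma blaschke_lt1 c w : nm c < 1 -> nm w < 1 -> nm (blaschke c w) < 1.
Proof.
move=> c1 w1; have d0 := blaschke_den c1 w1.
have dp : 0 < nm (1 - c^* * w) by rewrite lt_neqAle nm_ge0 eq_sym nm_eq0 d0.
rewrite /blaschke nmM nmV ltr_pdivrMr// mul1r.
rewrite -(ltr_pXn2r (ltn0Sn 1)) ?nnegrE ?nm_ge0// !nm_sqr.
have hc : complex.Re c ^+ 2 + complex.Im c ^+ 2 < 1 by rewrite -nm_sqr -[ltRHS](expr1n R 2) ltr_pXn2r ?nnegrE ?nm_ge0.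
have hw : complex.Re w ^+ 2 + complex.Im w ^+ 2 < 1 by rewrite -nm_sqr -[ltRHS](expr1n R 2) ltr_pXn2r ?nnegrE ?nm_ge0.
case: c w {c1 w1 d0 dp} hc hw => c1 c2 [w1 w2] /= hc hw.
have : 0 < (1 - (c1 ^+ 2 + c2 ^+ 2)) * (1 - (w1 ^+ 2 + w2 ^+ 2)) by rewrite mulr_gt0// subr_gt0.
rewrite -subr_gt0 => /lt_le_trans; apply; rewrite le_eqVlt; apply/orP; left; apply/eqP; ring.
Qed.

Lemma cdiff_blaschke c w : nm c < 1 -> nm w < 1 -> cdiff (blaschke c) w (blaschke1 c w).
Proof.
move=> c1 w1; have d0 := blaschke_den c1 w1.
have H1 := cdiffB (cdiff_id w) (cdiff_cst c w).
have H2 := cdiffV (f := fun w => 1 - c^* * w) d0 (cdiffB (cdiff_cst 1 w) (cdiffM (cdiff_cst (c^*) w) (cdiff_id w))).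
have := cdiffM H1 H2; rewrite /blaschke /blaschke1.
suff -> : (1 - 0) * (1 - c^* * w)^-1 + (id w - c) * (- (1 - c^* * w)^-1 ^+ 2 * (0 - (0 * id w + c^* * 1))) = (1 - c^* * c) / (1 - c^* * w) ^+ 2 by [].
by rewrite /=; move: d0; move: (c^*) => c' d0; field.
Qed.

Variables (f f1 : R[i] -> R[i]).
Hypothesis hf : forall z, nm z < 1 -> cdiff f z (f1 z).
Hypothesis fD : forall z, nm z < 1 -> nm (f z) < 1.

(* Cauchy's estimate at 0 for the map conjugated by Blaschke factors. *)
Lemma schwarz_pick a : nm a < 1 -> (1 - nm a ^+ 2) * nm (f1 a) <= 1 - nm (f a) ^+ 2.
Proof.
move=> a1; set c := f a; have c1 : nm c < 1 := fD a1.
have na1 : nm (- a) < 1 by rewrite nmN.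
pose k z := blaschke c (f (blaschke (- a) z)).
pose k1 z := blaschke1 c (f (blaschke (- a) z)) * (f1 (blaschke (- a) z) * blaschke1 (- a) z).
have hk z : nm z < 1 -> cdiff k z (k1 z).
  move=> z1; have t1 := blaschke_lt1 na1 z1.
  exact: cdiff_comp (cdiff_comp (cdiff_blaschke na1 z1) (hf t1)) (cdiff_blaschke c1 (fD t1)).
have kD z : nm z < 1 -> nm (k z) < 1.
  by move=> z1; apply: blaschke_lt1 => //; apply: fD; exact: blaschke_lt1.
have B0 : blaschke (- a) 0 = a by rewrite /blaschke mulr0 subr0 divr1 sub0r opprK.
have pa : 0 < 1 - nm a ^+ 2 by have := nm_ge0 a; nra.
have pc : 0 < 1 - nm c ^+ 2 by have := nm_ge0 c; nra.
have rE (d : R[i]) : 1 - d^* * d = (1 - nm d ^+ 2)%:C by rewrite conjM_real rmorphB rmorph1.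
have k10 : nm (k1 0) = (1 - nm a ^+ 2) * nm (f1 a) / (1 - nm c ^+ 2).
  rewrite /k1 B0 -/c /blaschke1 !nmM !rE nmN mulr0 subr0 expr1n invr1 nm1 mulr1.
  rewrite nmV nmM !nm_real !gtr0_norm//; field; exact: lt0r_neq0.
have est rho : 0 < rho -> rho < 1 -> nm (k1 0) <= 1 / rho.
  move=> r0 r1; apply: (@cauchy_est _ k k1 0 rho 1 r0) => z; rewrite subr0 => zr.
    by apply: hk; exact: le_lt_trans zr r1.
  by apply: ltW; apply: kD; exact: le_lt_trans zr r1.
have : nm (k1 0) <= 1.
  rewrite leNgt; apply/negP => k1g.
  (* Then 1 / rho is the midpoint of 1 and [nm (k1 0)], contradicting [est]. *)
  pose rho := 2 / (1 + nm (k1 0)).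
  have h := nm_ge0 (k1 0).
  have r0 : 0 < rho by rewrite divr_gt0//; lra.
  have r1 : rho < 1 by rewrite ltr_pdivrMr; lra.
  have := est rho r0 r1; rewrite /rho invf_div mul1r; lra.
by rewrite k10 ler_pdivrMr// mul1r.
Qed.

End schwarzpick.

(** * The derivative of a holomorphic function is holomorphic *)

Section regularity. Variable R : realType.
Implicit Types (z w d a c : R[i]) (f k : R[i] -> R[i]) (rho t x : R).
Local Notation nm := (@modulus R).

Lemma cdiff_line f z v (s : R) d : cdiff f (z + s%:C * v) d ->
  is_derive s (1 : R) (fun s => complex.Re (f (z + s%:C * v))) (complex.Re (d * v)).
Proof.
move=> hd.
have H1 : cdiff (fun w => z + w * v) (s +i* 0) (0 + (1 * v + (s +i* 0) * 0)).
  exact: cdiffD (cdiff_cst z _) (cdiffM (cdiff_id _) (cdiff_cst v _)).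
have H2 := cdiff_comp (f := f) H1 hd.
have := rdiff_dx (cdiff_rdiff_Re H2).
by rewrite mulr0 addr0 add0r mul1r.
Qed.

(** The real mean value theorem applied to the real part of conj(D) f, where D is the total
    increment, whose own increment is |D|^2. *)
Lemma complex_MVT f f1 z v (L : R) : (forall s : R, 0 <= s <= 1 -> cdiff f (z + s%:C * v) (f1 (z + s%:C * v))) ->
  (forall s : R, 0 <= s <= 1 -> nm (f1 (z + s%:C * v)) <= L) ->
  nm (f (z + v) - f z) <= L * nm v.
Proof.
move=> hf hL; set D := f (z + v) - f z.
have L0 : 0 <= L by apply: le_trans (nm_ge0 _) (hL 0 _); rewrite lexx ler01.
have [->|D0] := eqVneq D 0; first by rewrite nm0 mulr_ge0 ?nm_ge0.
have nD : 0 < nm D by rewrite lt_neqAle nm_ge0 eq_sym nm_eq0 D0.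
pose h (s : R) := complex.Re (D^* * f (z + s%:C * v)).
pose h' (s : R) := complex.Re ((0 * f (z + s%:C * v) + D^* * f1 (z + s%:C * v)) * v).
have hh (s : R) : 0 <= s <= 1 -> is_derive s (1 : R) h (h' s).
  move=> s01; exact: (cdiff_line (f := fun z => D^* * f z) (cdiffM (cdiff_cst (D^*) _) (hf s s01))).
have [] := @MVT R h h' 0 1 ltr01.
- by move=> s; rewrite in_itv/= => /andP[s0 s1]; apply: hh; rewrite !ltW.
- apply/continuous_in_subspaceT => s; rewrite inE/= in_itv/= => s01.
  exact: derive_cont (hh s s01).
move=> s; rewrite in_itv/= => /andP[s0 s1].
have s01 : 0 <= s <= 1 by rewrite !ltW.
have E1 : h 1 - h 0 = nm D ^+ 2.
  by rewrite /h -raddfB /= mul1r mul0r addr0 -mulrBr -/D Re_conjM.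
rewrite E1 subr0 mulr1 /h' mul0r add0r => E.
have : nm D ^+ 2 <= nm D * (L * nm v).
  rewrite E; apply: (le_trans (ler_norm _)); apply: (le_trans (re_le_nm _)).
  rewrite !nmM nm_conj -mulrA ler_pM2l// ler_wpM2r ?nm_ge0//; exact: hL.
by rewrite expr2 ler_pM2l.
Qed.

Lemma quadratic_cdiff f a d (r C : R) : 0 < r ->
  (forall h : R[i], nm h < r -> nm (f (a + h) - f a - d * h) <= C * nm h ^+ 2) -> cdiff f a d.
Proof.
move=> r0 H.
exists (fun w => if w == a then d else (f w - f a) / (w - a)); split.
- apply/ccontP => e e0; rewrite eqxx.
  have C0 : 0 < `|C| + 1 by rewrite ltr_wpDl.
  exists (Num.min r (e / (`|C| + 1))); first by rewrite lt_min r0 divr_gt0.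
  move=> w; rewrite lt_min => /andP[w1 w2]; case: eqP => [_|/eqP wz]; first by rewrite subrr nm0.
  have nz : 0 < nm (w - a) by rewrite lt_neqAle nm_ge0 eq_sym nm_eq0 subr_eq0 wz.
  have -> : (f w - f a) / (w - a) - d = (f w - f a - d * (w - a)) / (w - a).
    by rewrite [in RHS]mulrBl mulfK// subr_eq0.
  rewrite nmM nmV ltr_pdivrMr//.
  have := H (w - a) w1; rewrite [a + _]addrC subrK => /le_lt_trans; apply.
  rewrite expr2 mulrA ltr_pM2r//.
  move: w2; rewrite ltr_pdivlMr// => w2.
  have := ler_norm C; have := normr_ge0 C; nra.
- by rewrite eqxx.
- move=> w; case: eqP => [->|/eqP wz]; first by rewrite subrr mulr0 addr0.
  by rewrite divfK ?subr_eq0// addrC subrK.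
Qed.

Section deriv.
Variables (f f1 : R[i] -> R[i]) (a : R[i]) (r M : R).
Hypothesis r0 : 0 < r.
Hypothesis hf : forall z, nm (z - a) < 4 * r -> cdiff f z (f1 z).
Hypothesis fM : forall z, nm (z - a) < 4 * r -> nm (f z) <= M.

Let nmt u v w : nm (u - w) <= nm (u - v) + nm (v - w).
Proof. by have := nmD (u - v) (v - w); rewrite addrA subrK. Qed.

Lemma deriv_bound z : nm (z - a) <= 3 * r -> nm (f1 z) <= M / (r / 2).
Proof.
move=> za; apply: (@cauchy_est _ f f1 z (r / 2) M); first by rewrite divr_gt0.
- by move=> w wz; apply: hf; have := nmt w z a; move: r0; lra.
- by move=> w wz; apply: fM; have := nmt w z a; move: r0; lra.
Qed.

Let L := M / (r / 2).
Let rho := r / 2.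
Let rho0 : 0 < rho. Proof. by rewrite divr_gt0. Qed.

Let seg z v (s : R) (B : R) : nm (z - a) < B -> nm (z + v - a) < B -> 0 <= s <= 1 ->
  nm (z + s%:C * v - a) < B.
Proof.
move=> h1 h2 /andP[s0 s1].
have -> : z + s%:C * v - a = (1 - s)%:C * (z - a) + s%:C * (z + v - a).
  by rewrite rmorphB rmorph1; ring.
apply: (le_lt_trans (nmD _ _)); rewrite !nmM !nm_real !ger0_norm ?subr_ge0//.
have [->|sn0] := eqVneq s 0; first by rewrite subr0 mul1r mul0r addr0.
have : 0 < s by rewrite lt_neqAle eq_sym sn0.
nra.
Qed.

Let f_lip z v : nm (z - a) < 3 * r -> nm (z + v - a) < 3 * r -> nm (f (z + v) - f z) <= L * nm v.
Proof.
move=> h1 h2; apply: (@complex_MVT f f1) => s s01; have h := seg h1 h2 s01.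
- by apply: hf; move: r0; lra.
- by apply: deriv_bound; exact: ltW.
Qed.

Let hf_ball z w : nm (z - a) <= 3 * r -> nm (w - z) <= rho -> cdiff f w (f1 w).
Proof. by move=> h1 h2; apply: hf; have := nmt w z a; move: r0 h2; rewrite /rho; lra. Qed.

Let circD z v t : circ (z + v) rho t = circ z rho t + v.
Proof. by rewrite /circ; ring. Qed.

(** Cauchy's formula on circles of one fixed radius turns a difference of [f1] into a mean of
    differences of [f] between translated points. *)
Let f1_lip z v : nm (z - a) < 2 * r -> nm (z + v - a) < 2 * r -> nm (f1 (z + v) - f1 z) <= L / rho * nm v.
Proof.
move=> h1 h2.
have H1 : nm (z - a) <= 3 * r by move: r0; lra.
have H2 : nm (z + v - a) <= 3 * r by move: r0; lra.
rewrite (cauchy1 rho0 (fun w => @hf_ball z w H1)) (cauchy1 rho0 (fun w => @hf_ball (z + v) w H2)) -mulrBr.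
have c1 := ccurveM (ccurve_on_circ (ltW rho0) (fun w => @hf_ball z w H1)) (@ccurve_conjei R).
have c2 := ccurveM (ccurve_on_circ (ltW rho0) (fun w => @hf_ball (z + v) w H2)) (@ccurve_conjei R).
rewrite -(cmeanB c2 c1) nmM nmV nm_real gtr0_norm// mulrAC mulrC ler_pM2r ?invr_gt0//.
apply: nm_cmean_le.
  exact: ccurveB.
move=> t; rewrite -mulrBl nmM nm_conj nm_ei mulr1 circD.
have n1 : nm (circ z rho t - z) = rho by apply: nm_circ; exact: ltW.
have n2 : nm (circ (z + v) rho t - (z + v)) = rho by apply: nm_circ; exact: ltW.
apply: f_lip.
- by have := nmt (circ z rho t) z a; rewrite n1 /rho; move: r0; lra.
- by have := nmt (circ (z + v) rho t) (z + v) a; rewrite n2 circD /rho; move: r0; lra.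
Qed.

Let K := L / rho.

Let f_quad z v : nm (z - a) < 2 * r -> nm (z + v - a) < 2 * r ->
  nm (f (z + v) - f z - f1 z * v) <= K * nm v ^+ 2.
Proof.
move=> h1 h2.
have K0 : 0 <= K * nm v by have := f1_lip h1 h2; apply: le_trans; exact: nm_ge0.
have := @complex_MVT (fun w => f w - f1 z * w) (fun w => f1 w - (0 * w + f1 z * 1)) z v (K * nm v).
have -> : f (z + v) - f1 z * (z + v) - (f z - f1 z * z) = f (z + v) - f z - f1 z * v by ring.
rewrite -mulrA -expr2; apply.
  move=> s s01; apply: cdiffB (cdiffM (cdiff_cst (f1 z) _) (cdiff_id _)); apply: hf.
  by have := seg h1 h2 s01; move: r0; lra.
move=> s s01; rewrite mul0r add0r mulr1.
apply: (le_trans (f1_lip h1 (seg h1 h2 s01))).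
have /andP[s0 s1] := s01.
rewrite nmM nm_real ger0_norm// mulrCA ler_piMl//.
Qed.

Let f1_cont w : nm (w - a) < 2 * r -> {for w, continuous (f1 : R[i]^o -> R[i]^o)}.
Proof.
move=> wa; apply/ccontP => e e0.
have K0 : 0 < `|K| + 1 by rewrite ltr_wpDl.
exists (Num.min (2 * r - nm (w - a)) (e / (`|K| + 1))).
  by rewrite lt_min subr_gt0 wa divr_gt0.
move=> z; rewrite lt_min => /andP[z1 z2].
have E : z = w + (z - w) by rewrite addrC subrK.
have za : nm (w + (z - w) - a) < 2 * r by rewrite -E; have := nmt z w a; lra.
rewrite {1}E; apply: (le_lt_trans (f1_lip wa za)); rewrite -/K.
move: z2; rewrite ltr_pdivlMr//; have := nm_ge0 (z - w); have := ler_norm K; nra.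
Qed.

(** [d] is what differentiating [cauchy1] under the mean would give. Since [f_quad] holds uniformly
    along the circle, averaging it bounds the remainder of [f1] by a multiple of |h|^2, which
    replaces differentiation under the integral. *)
Lemma deriv_cdiff : exists d, cdiff f1 a d.
Proof.
pose d := rho%:C^-1 * cmean (fun t => f1 (circ a rho t) * (ei t)^*); exists d.
apply: (@quadratic_cdiff f1 a d rho (K / rho) rho0) => h hr.
have na : nm (a - a) = 0 by rewrite subrr nm0.
have nah : nm (a + h - a) = nm h by rewrite addrC addKr.
have H1 : nm (a - a) <= 3 * r by rewrite na; move: r0; lra.
have H2 : nm (a + h - a) <= 3 * r by rewrite nah; move: r0 hr; rewrite /rho; lra.
have n1 t : nm (circ a rho t - a) = rho by apply: nm_circ; exact: ltW.
have c1 := ccurveM (ccurve_on_circ (ltW rho0) (fun w => @hf_ball a w H1)) (@ccurve_conjei R).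
have c2 := ccurveM (ccurve_on_circ (ltW rho0) (fun w => @hf_ball (a + h) w H2)) (@ccurve_conjei R).
have c3 : ccurve (fun t => f1 (circ a rho t) * (ei t)^*).
  apply: ccurveM (@ccurve_conjei R); apply: ccurve_comp; first exact: ccurve_circ.
  by move=> t; apply: f1_cont; rewrite n1 /rho; move: r0; lra.
rewrite (cauchy1 rho0 (fun w => @hf_ball a w H1)) (cauchy1 rho0 (fun w => @hf_ball (a + h) w H2)).
have -> : rho%:C^-1 * cmean (fun t => f (circ (a + h) rho t) * (ei t)^*) -
    rho%:C^-1 * cmean (fun t => f (circ a rho t) * (ei t)^*) - d * h =
  rho%:C^-1 * (cmean (fun t => f (circ (a + h) rho t) * (ei t)^*) -
    cmean (fun t => f (circ a rho t) * (ei t)^*) - h * cmean (fun t => f1 (circ a rho t) * (ei t)^*)).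
  by rewrite /d; ring.
have c12 : ccurve (fun t => f (circ (a + h) rho t) * (ei t)^* - f (circ a rho t) * (ei t)^*).
  exact: ccurveB.
rewrite -(cmeanB c2 c1) -(cmeanZ h c3) -(cmeanB c12 (ccurveZ h c3)).
rewrite nmM nmV nm_real gtr0_norm// mulrAC mulrC ler_pM2r ?invr_gt0//.
apply: nm_cmean_le.
  exact: ccurveB c12 (ccurveZ h c3).
move=> t.
have -> : f (circ (a + h) rho t) * (ei t)^* - f (circ a rho t) * (ei t)^* - h * (f1 (circ a rho t) * (ei t)^*) =
  (f (circ (a + h) rho t) - f (circ a rho t) - f1 (circ a rho t) * h) * (ei t)^* by ring.
rewrite nmM nm_conj nm_ei mulr1 circD; apply: f_quad.
- by rewrite n1 /rho; move: r0; lra.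
- have := nmD (circ a rho t - a) h; rewrite n1 [circ a rho t - a + h]addrAC.
  by move: r0 hr; rewrite /rho; lra.
Qed.
End deriv.
End regularity.

(** * Formula and bound for the second derivative *)

Section second. Variable R : realType.
Implicit Types (z w d a c : R[i]) (f k : R[i] -> R[i]) (rho t x : R).
Local Notation nm := (@modulus R).
Local Notation twopi := (2 * pi : R).

Lemma itv_int_FTC (a b : R) (F F' : R -> R) : a < b -> (forall x, a <= x <= b -> is_derive x (1 : R) F (F' x)) ->
  {within `[a, b], continuous F'} -> itv_int a b F' = F b - F a.
Proof.
move=> ab dF cF'; rewrite /itv_int /Rintegral (@continuous_FTC2 R F' F)//.
  have cF x : a <= x <= b -> F @ x --> F x by move=> xab; exact: derive_cont (dF x xab).
  split.
  - move=> x; rewrite in_itv/= => /andP[h1 h2].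
    have xab : a <= x <= b by rewrite (ltW h1) (ltW h2).
    by have [] := dF x xab.
  - by apply: cvg_at_right_filter; apply: cF; rewrite lexx ltW.
  - by apply: cvg_at_left_filter; apply: cF; rewrite lexx ltW.
move=> x; rewrite in_itv/= => /andP[h1 h2]; rewrite derive1E.
have xab : a <= x <= b by rewrite (ltW h1) (ltW h2).
by have [_ ->] := dF x xab.
Qed.

(** The derivative of G(it) in t is i G1(it), and G takes equal values at both ends. *)
Lemma cmean_deriv0 (G G1 : R[i] -> R[i]) : (forall t, cdiff G (0 +i* t) (G1 (0 +i* t))) ->
  G (0 +i* 0) = G (0 +i* twopi) -> ccurve (fun t => G1 (0 +i* t)) -> cmean (fun t => G1 (0 +i* t)) = 0.
Proof.
move=> hG per cG1.
have h1 : itv_int 0 twopi (fun t => complex.Im (G1 (0 +i* t))) = 0.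
  have := @itv_int_FTC 0 twopi (fun t => - complex.Re (G (0 +i* t))) (fun t => complex.Im (G1 (0 +i* t))) (twopi0 R).
  rewrite per subrr; apply; last by apply: continuous_subspaceT; exact: ccurve_Im cG1.
  by move=> t _; have := rdiff_dt (rdiffN (cdiff_rdiff_Re (hG t))); rewrite opprK.
have h2 : itv_int 0 twopi (fun t => complex.Re (G1 (0 +i* t))) = 0.
  have := @itv_int_FTC 0 twopi (fun t => complex.Im (G (0 +i* t))) (fun t => complex.Re (G1 (0 +i* t))) (twopi0 R).
  rewrite per subrr; apply; last by apply: continuous_subspaceT; exact: ccurve_Re cG1.
  by move=> t _; exact: rdiff_dt (cdiff_rdiff_Im (hG t)).
by rewrite /cmean h1 h2 mulr0.
Qed.

Lemma ReB z w : complex.Re (z - w) = complex.Re z - complex.Re w.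
Proof. by case: z w => [? ?] [? ?]. Qed.

Lemma ReZ (u : R) z : complex.Re (u%:C * z) = u * complex.Re z.
Proof. by case: z => p q /=; ring. Qed.

Lemma nm_cmean_leR (g h : R -> R[i]) : ccurve g -> ccurve h -> (forall t, nm (g t) <= complex.Re (h t)) ->
  nm (cmean g) <= complex.Re (cmean h).
Proof.
move=> cg ch gh; have [->|z0] := eqVneq (cmean g) 0.
  rewrite nm0 -oppr_le0 -raddfN -[- cmean h]mulN1r -(cmeanZ _ ch); apply: Re_cmean_le; first exact: ccurveZ.
  by move=> t; rewrite mulN1r raddfN oppr_le0; exact: le_trans (nm_ge0 _) (gh t).
have nz : 0 < nm (cmean g) by rewrite lt_neqAle nm_ge0 eq_sym nm_eq0 z0.
rewrite -subr_le0 -(ler_pM2l nz) mulr0 mulrBr -expr2 -Re_conjM.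
rewrite -ReZ -(cmeanZ _ cg) -(cmeanZ _ ch) -ReB -cmeanB; [|exact: ccurveZ|exact: ccurveZ].
apply: Re_cmean_le; first by apply: ccurveB; exact: ccurveZ.
move=> t; rewrite ReB subr_le0 ReZ.
apply: (le_trans (ler_norm _)); apply: (le_trans (re_le_nm _)).
by rewrite nmM nm_conj ler_pM2l.
Qed.

Lemma cexp_it t : cexp (0 +i* t) = ei t.
Proof. by rewrite /cexp /= expR0 mul1r. Qed.

Lemma cexpN_it t : cexp (- (0 +i* t)) = (ei t)^*.
Proof.
rewrite /cexp /= oppr0 expR0 mul1r /ei cosN sinN.
by apply/eqP; rewrite eq_complex /= !eqxx.
Qed.

Lemma exists_phase c : exists2 u, nm u = 1 & u * c = (nm c)%:C.
Proof.
have [->|c0] := eqVneq c 0; first by exists 1; rewrite ?nm1// nm0 mulr0.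
have nc : 0 < nm c by rewrite lt_neqAle nm_ge0 eq_sym nm_eq0 c0.
exists ((nm c)^-1%:C * c^*).
  by rewrite nmM nm_conj nm_real ger0_norm ?invr_ge0 ?ltW// mulVf// gt_eqF.
rewrite -mulrA conjM_real -rmorphM /= expr2 mulrA mulVf ?gt_eqF// mul1r.
by [].
Qed.

Lemma cdiff_eq k z d d' : cdiff k z d -> d = d' -> cdiff k z d'.
Proof. by move=> h <-. Qed.

Variables (f f1 f2 : R[i] -> R[i]).
Hypothesis hf : forall z, nm z < 1 -> cdiff f z (f1 z).
Hypothesis hf1 : forall z, nm z < 1 -> cdiff f1 z (f2 z).
Hypothesis fD : forall z, nm z < 1 -> nm (f z) < 1.

(** Integration by parts in [cauchy1] for [f1]: along the circle, f e^(-2it) is periodic, so the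
    mean of its derivative vanishes. *)
Lemma second_deriv_mean a rho : 0 < rho -> nm a + rho < 1 ->
  f2 a * (rho%:C) ^+ 2 = 2 * cmean (fun t => f (circ a rho t) * (ei t)^* ^+ 2).
Proof.
move=> r0 ar.
have inD z : nm (z - a) <= rho -> nm z < 1.
  by move=> za; have := nmD (z - a) a; rewrite subrK; lra.
have nc t : nm (circ a rho t - a) = rho by apply: nm_circ; exact: ltW.
have cD t : nm (circ a rho t) < 1 by apply: inD; rewrite nc.
have rn0 : rho%:C != 0 by rewrite -nm_eq0 nm_real gtr0_norm// gt_eqF.
have cf : ccurve (fun t => f (circ a rho t)) := ccurve_on_circ (ltW r0) (fun z h => hf (inD z h)).
have cf1 : ccurve (fun t => f1 (circ a rho t)) := ccurve_on_circ (ltW r0) (fun z h => hf1 (inD z h)).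
have ce := @ccurve_conjei R.
have ce2 : ccurve (fun t => (ei t)^* ^+ 2) by exact: ccurveM.
have c1 := ccurveM cf1 ce. have c2 := ccurveM cf ce2.
rewrite (cauchy1 r0 (fun z h => hf1 (inD z h))).
pose G w := f (a + rho%:C * cexp w) * (cexp (- w) * cexp (- w)).
pose G1 w := f1 (a + rho%:C * cexp w) * (rho%:C * cexp w) * (cexp (- w) * cexp (- w))
  + f (a + rho%:C * cexp w) * ((-2) * (cexp (- w) * cexp (- w))).
have GE t : G1 (0 +i* t) = rho%:C * (f1 (circ a rho t) * (ei t)^*) - 2 * (f (circ a rho t) * (ei t)^* ^+ 2).
  rewrite /G1 cexpN_it cexp_it -/(circ a rho t).
  have -> : f1 (circ a rho t) * (rho%:C * ei t) * ((ei t)^* * (ei t)^*) = rho%:C * (f1 (circ a rho t) * (ei t)^*) * ((ei t)^* * ei t) by ring.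
  by rewrite conj_ei; ring.
have H := @cmean_deriv0 G G1.
have hG t : cdiff G (0 +i* t) (G1 (0 +i* t)).
  have D1 : nm (a + rho%:C * cexp (0 +i* t)) < 1 by rewrite cexp_it; exact: cD.
  have E1 := cdiffD (cdiff_cst a _) (cdiffM (cdiff_cst rho%:C _) (cdiff_cexp (0 +i* t))).
  have E2 := cdiff_comp (f := f) E1 (hf D1).
  have E3 := cdiff_comp (cdiffN (cdiff_id (0 +i* t))) (cdiff_cexp _).
  apply: (cdiff_eq (cdiffM E2 (cdiffM E3 E3))).
  by rewrite /G1 /=; ring.
have per : G (0 +i* 0) = G (0 +i* twopi).
  rewrite /G !cexp_it !cexpN_it.
  have -> : ei twopi = ei (0 : R).
    by rewrite /ei -[twopi]add0r mulr_natl cosD2pi sinD2pi.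
  by [].
have cG1 : ccurve (fun t => G1 (0 +i* t)).
  have := ccurveB (ccurveZ rho%:C c1) (ccurveZ 2 c2).
  by under [X in ccurve X -> _]eq_fun do rewrite -GE.
have := H hG per cG1.
rewrite (eq_cmean GE) (cmeanB (ccurveZ _ c1) (ccurveZ _ c2)) !cmeanZ; [|exact: c2|exact: c1].
move=> /eqP; rewrite subr_eq0 => /eqP <-.
by field.
Qed.

(* Caratheodory's trick: [1 - u f] has nonnegative real part for [|u| = 1]. *)
Lemma second_deriv_bound a rho : 0 < rho -> nm a + rho < 1 ->
  nm (f2 a) * rho ^+ 2 <= 4 * (1 - nm (f a)).
Proof.
move=> r0 ar.
have inD z : nm (z - a) <= rho -> nm z < 1.
  by move=> za; have := nmD (z - a) a; rewrite subrK; lra.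
have nc t : nm (circ a rho t - a) = rho by apply: nm_circ; exact: ltW.
have cD t : nm (circ a rho t) < 1 by apply: inD; rewrite nc.
have rn0 : rho%:C != 0 by rewrite -nm_eq0 nm_real gtr0_norm// gt_eqF.
have cf : ccurve (fun t => f (circ a rho t)) := ccurve_on_circ (ltW r0) (fun z h => hf (inD z h)).
have ce := @ccurve_ei R.
have ce2 : ccurve (fun t => ei t ^+ 2) by exact: ccurveM.
have cce2 : ccurve (fun t => (ei t)^* ^+ 2) by have := @ccurve_conjei R => radial_defect; exact: ccurveM.
have [u u1 ufa] := exists_phase (f a).
pose F t := 1 - u * f (circ a rho t).
have cF : ccurve F by apply: ccurveB; [exact: ccurve_cst|exact: ccurveZ].
have cFc := ccurve_conj cF.
(* The mean value property of k(z) (z - a)^2, which vanishes at the centre. *)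
have m0 (k k1 : R[i] -> R[i]) : (forall z, nm z < 1 -> cdiff k z (k1 z)) ->
    cmean (fun t => k (circ a rho t) * ei t ^+ 2) = 0.
  move=> hk.
  have ck : ccurve (fun t => k (circ a rho t)) := ccurve_on_circ (ltW r0) (fun z h => hk z (inD z h)).
  have hkz z : nm z < 1 -> cdiff (fun w => k w * ((w - a) * (w - a))) z
     (k1 z * ((z - a) * (z - a)) + k z * ((1 - 0) * (z - a) + (z - a) * (1 - 0))).
    move=> z1; have E := cdiffB (cdiff_id z) (cdiff_cst a z); exact: cdiffM (hk z z1) (cdiffM E E).
  have := @mean_value R _ a rho r0 (fun z _ h => ex_intro _ _ (hkz z (inD z h))) (cdiff_cont (hkz a _)).
  have a1 : nm a < 1 by have := nm_ge0 a; lra.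
  move=> /(_ a1); rewrite subrr !mulr0 => E.
  have : rho%:C ^+ 2 * cmean (fun t => k (circ a rho t) * ei t ^+ 2) = 0.
    rewrite -(cmeanZ _ (ccurveM ck ce2)) -[RHS]E; apply: eq_cmean => t.
    have -> : circ a rho t - a = rho%:C * ei t by rewrite /circ addrC addKr.
    by ring.
  by move=> /eqP; rewrite mulf_eq0 expf_eq0 /= (negbTE rn0) /= => /eqP.
have e20 : cmean (fun t => ei t ^+ 2) = 0.
  rewrite -(m0 (fun=> 1) (fun=> 0) (fun z _ => cdiff_cst 1 z)); apply: eq_cmean => t; by rewrite mul1r.
have ce20 : cmean (fun t => (ei t)^* ^+ 2) = 0.
  have := cmean_conj ce2; rewrite e20 rmorph0 => <-; apply: eq_cmean => t; by rewrite rmorphXn.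
have Fe20 : cmean (fun t => F t * ei t ^+ 2) = 0.
  exact: (m0 (fun z => 1 - u * f z) _ (fun z h => cdiffB (cdiff_cst 1 z) (cdiffM (cdiff_cst u z) (hf h)))).
(* Adding the conjugate of [F] costs nothing by [Fe20], and makes the factor real and nonnegative,
   so the modulus of the mean is at most the mean of 2 Re F, namely 2 (1 - |f a|). *)
have FE : cmean (fun t => (F t + (F t)^*) * (ei t)^* ^+ 2) = - u * cmean (fun t => f (circ a rho t) * (ei t)^* ^+ 2).
  have -> : cmean (fun t => (F t + (F t)^*) * (ei t)^* ^+ 2) =
      cmean (fun t => F t * (ei t)^* ^+ 2 + (F t * ei t ^+ 2)^*).
    by apply: eq_cmean => t; rewrite rmorphM rmorphXn mulrDl.
  rewrite (cmeanD (ccurveM cF cce2) (ccurve_conj (ccurveM cF ce2))) (cmean_conj (ccurveM cF ce2)).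
  rewrite Fe20 rmorph0 addr0.
  rewrite -(cmeanZ _ (ccurveM cf cce2)).
  have -> : cmean (fun t => F t * (ei t)^* ^+ 2) = cmean (fun t => (ei t)^* ^+ 2 - u * (f (circ a rho t) * (ei t)^* ^+ 2)).
    by apply: eq_cmean => t; rewrite /F; ring.
  rewrite (cmeanB cce2 (ccurveZ u (ccurveM cf cce2))) ce20 sub0r !(cmeanZ _ (ccurveM cf cce2)).
  by rewrite mulNr.
have Fa : cmean (fun t => 2 * F t) = 2 * (1 - (nm (f a))%:C).
  rewrite (cmeanZ _ cF) -ufa.
  have hk z : nm z < 1 -> cdiff (fun z => 1 - u * f z) z (0 - (0 * f z + u * f1 z)).
    by move=> h; exact: cdiffB (cdiff_cst 1 z) (cdiffM (cdiff_cst u z) (hf h)).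
  have a1 : nm a < 1 by have := nm_ge0 a; lra.
  by rewrite -(@mean_value R _ a rho r0 (fun z _ h => ex_intro _ _ (hk z (inD z h))) (cdiff_cont (hk a a1))).
have ReF t : 0 <= complex.Re (F t).
  rewrite /F ReB subr_ge0 /=; apply: (le_trans (ler_norm _)); apply: (le_trans (re_le_nm _)).
  by rewrite nmM u1 mul1r ltW// fD.
have main : nm (cmean (fun t => (F t + (F t)^*) * (ei t)^* ^+ 2)) <= complex.Re (cmean (fun t => 2 * F t)).
  apply: nm_cmean_leR; [exact: ccurveM (ccurveD cF cFc) cce2|exact: ccurveZ|move=> t].
  rewrite expr2 !nmM nm_conj nm_ei !mulr1.
  have -> : F t + (F t)^* = (2 * complex.Re (F t))%:C.
    by case: (F t) => p q; apply/eqP; rewrite eq_complex /=; apply/andP; split; apply/eqP; ring.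
  rewrite nm_real ger0_norm ?mulr_ge0//.
  by case: (F t) => p q /=; rewrite le_eqVlt; apply/orP; left; apply/eqP; ring.
move: main; rewrite FE Fa nmM nmN u1 mul1r.
have -> : complex.Re (2 * (1 - (nm (f a))%:C)) = 2 * (1 - nm (f a)) by rewrite /=; ring.
have := congr1 nm (second_deriv_mean r0 ar); rewrite nmM expr2 nmM nm_real gtr0_norm// -expr2 => ->.
rewrite nmM.
have -> : nm (2 : R[i]) = 2 by rewrite -[2 in LHS](rmorph_nat (real_complex R)) nm_real ger0_norm.
lra.
Qed.
End second.

(** * The logarithmic gap along a radius *)

Section radial. Variable R : realType.
Implicit Types (z w d a c xi : R[i]) (rho t x r : R).
Local Notation nm := (@modulus R).

Lemma analytic_data (f : R[i] -> R[i]) : analytic_self_map f ->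
  exists f2, [/\ (forall z, nm z < 1 -> cdiff f z (cderiv f z)),
   (forall z, nm z < 1 -> cdiff (cderiv f) z (f2 z)) &
   (forall z, nm z < 1 -> nm (f z) < 1)].
Proof.
move=> [rdiff fD].
have h1 z : nm z < 1 -> cdiff f z (cderiv f z) by move=> z1; apply: cderivable_cdiff; apply: rdiff; apply/discE.
have h3 z : nm z < 1 -> nm (f z) < 1 by move=> z1; apply/discE/fD/discE.
have h2 z : exists d, nm z < 1 -> cdiff (cderiv f) z d.
  case: (ltP (nm z) 1) => z1; last by exists 0.
  (* [deriv_cdiff] asks for a disc of radius four times its parameter, here the largest one around
     [z] inside the unit disc. *)
  have hr : 0 < (1 - nm z) / 4 by rewrite divr_gt0// subr_gt0.
  have hD w : nm (w - z) < 4 * ((1 - nm z) / 4) -> nm w < 1.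
    by move=> wz; have := nmD (w - z) z; rewrite subrK; lra.
  have [d hd] := @deriv_cdiff R f (cderiv f) z _ 1 hr (fun w h => h1 w (hD w h)) (fun w h => ltW (h3 w (hD w h))).
  by exists d.
by have [f2 hf2] := choice h2; exists f2.
Qed.

Lemma rdiff_ln (g : R[i] -> R[i]) x t d : cdiff g (x +i* t) d -> nm (g (x +i* t)) < 1 ->
  rdiff (fun y s => ln (1 - nm (g (y +i* s)) ^+ 2)) x t
    (- 2 * complex.Re ((g (x +i* t))^* * d) / (1 - nm (g (x +i* t)) ^+ 2))
    (2 * complex.Im ((g (x +i* t))^* * d) / (1 - nm (g (x +i* t)) ^+ 2)).
Proof.
move=> hg g1; have hU := cdiff_rdiff_Re hg; have hV := cdiff_rdiff_Im hg.
have h1 := rdiffB (rdiff_cst 1 x t) (rdiffD (rdiffM hU hU) (rdiffM hV hV)).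
have p : 0 < 1 - nm (g (x +i* t)) ^+ 2 by have := nm_ge0 (g (x +i* t)); nra.
have p' : 0 < 1 - (complex.Re (g (x +i* t)) * complex.Re (g (x +i* t)) +
    complex.Im (g (x +i* t)) * complex.Im (g (x +i* t))) by rewrite -!expr2 -nm_sqr.
have := rdiff_comp h1 (is_derive1_ln p'); rewrite /= -!expr2 -nm_sqr; apply: eq_rdiff.
- by move=> y s; rewrite -!expr2 -nm_sqr.
- by rewrite [RHS]mulrC; congr (_ * _); case: (g _) d {hg g1 hU hV h1 p} => a b [p q] /=; ring.
- by rewrite [RHS]mulrC; congr (_ * _); case: (g _) d {hg g1 hU hV h1 p} => a b [p q] /=; ring.
Qed.

Variables (f f1 f2 : R[i] -> R[i]).
Hypothesis hf : forall z, nm z < 1 -> cdiff f z (f1 z).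
Hypothesis hf1 : forall z, nm z < 1 -> cdiff f1 z (f2 z).
Hypothesis fD : forall z, nm z < 1 -> nm (f z) < 1.

(* [log_gap] is the logarithm of [(1 - |f|^2) / (1 - r^2) * (1 + r)^2]; its radial
   derivative is [2 / (1 - r^2)] times [radial_defect], which dominates the
   distortion density. *)
Definition log_gap r xi := ln (1 - nm (f (r%:C * xi)) ^+ 2) + (ln (1 + r) - ln (1 - r)).
Definition radial_ratio r xi : R[i] := (f (r%:C * xi))^* * (f1 (r%:C * xi) * xi) *
  ((1 - r ^+ 2) / (1 - nm (f (r%:C * xi)) ^+ 2))%:C.
Definition radial_defect r xi : R := 1 - complex.Re (radial_ratio r xi).
Definition distortion_at z : R := 1 - (1 - nm z ^+ 2) * nm (f1 z) / (1 - nm (f z) ^+ 2).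

Lemma one_sub_sqr_gt0 z : nm z < 1 -> 0 < 1 - nm z ^+ 2.
Proof. by have := nm_ge0 z; nra. Qed.

Lemma rxi_lt1 r xi : nm xi = 1 -> -1 < r < 1 -> nm (r%:C * xi) < 1.
Proof. by move=> x1 /andP[r0 r1]; rewrite nmM x1 mulr1 nm_real ltr_norml r0. Qed.

Lemma nm_rxi r xi : nm xi = 1 -> nm (r%:C * xi) ^+ 2 = r ^+ 2.
Proof. by move=> x1; rewrite nmM x1 mulr1 nm_real real_normK ?num_real. Qed.

Lemma distortion_at_ge0 z : nm z < 1 -> 0 <= distortion_at z.
Proof.
move=> z1; rewrite subr_ge0 ler_pdivrMr ?mul1r; last exact: one_sub_sqr_gt0 (fD z1).
exact: schwarz_pick.
Qed.

Lemma distortion_at_le1 z : nm z < 1 -> distortion_at z <= 1.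
Proof.
move=> z1; rewrite gerBl divr_ge0 ?mulr_ge0 ?nm_ge0//; apply: ltW; apply: one_sub_sqr_gt0 => //.
exact: fD.
Qed.

(** The radius is made a complex variable, so that derivatives along it are x-derivatives at t = 0
    of the two-variable calculus. *)
Lemma cdiff_rxi (g g1 : R[i] -> R[i]) (hg : forall z, nm z < 1 -> cdiff g z (g1 z)) r xi :
  nm xi = 1 -> -1 < r < 1 -> cdiff (fun w => g (w * xi)) (r +i* 0) (g1 (r%:C * xi) * xi).
Proof.
move=> x1 r1; apply: cdiff_eq (cdiff_comp (cdiffM (cdiff_id (r +i* 0)) (cdiff_cst xi _)) (hg _ (rxi_lt1 x1 r1))) _.
by rewrite mul1r mulr0 addr0.
Qed.

Lemma nm_radial_ratio_le r xi : nm xi = 1 -> -1 < r < 1 -> nm (radial_ratio r xi) <= 1 - distortion_at (r%:C * xi).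
Proof.
move=> x1 r1; have z1 := rxi_lt1 x1 r1; have f0 := one_sub_sqr_gt0 (fD z1).
rewrite /radial_ratio !nmM x1 mulr1 nm_conj nm_real ger0_norm; last first.
  by rewrite divr_ge0 ?(ltW f0)// -(nm_rxi r x1) ltW// one_sub_sqr_gt0.
rewrite /distortion_at nm_rxi// subKr -mulrA.
have -> : nm (f1 (r%:C * xi)) * ((1 - r ^+ 2) / (1 - nm (f (r%:C * xi)) ^+ 2)) =
  (1 - r ^+ 2) * nm (f1 (r%:C * xi)) / (1 - nm (f (r%:C * xi)) ^+ 2) by ring.
rewrite ler_piMl//; last exact: ltW (fD z1).
rewrite divr_ge0 ?(ltW f0)// mulr_ge0 ?nm_ge0//.
by rewrite -(nm_rxi r x1) ltW// one_sub_sqr_gt0.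
Qed.

Lemma distortion_at_le_radial_defect r xi : nm xi = 1 -> -1 < r < 1 -> distortion_at (r%:C * xi) <= radial_defect r xi.
Proof.
move=> x1 r1; have := nm_radial_ratio_le x1 r1; have := re_le_nm (radial_ratio r xi); have := ler_norm (complex.Re (radial_ratio r xi)).
by rewrite /radial_defect; lra.
Qed.

Lemma radial_defect_ge0 r xi : nm xi = 1 -> -1 < r < 1 -> 0 <= radial_defect r xi.
Proof. by move=> x1 r1; apply: le_trans (distortion_at_le_radial_defect x1 r1); apply: distortion_at_ge0; exact: rxi_lt1. Qed.

Lemma sqr_lt1 r : -1 < r < 1 -> 0 < 1 - r ^+ 2.
Proof. by move=> /andP[? ?]; nra. Qed.

Lemma log_gap_derive r xi : nm xi = 1 -> -1 < r < 1 ->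
  is_derive r (1 : R) (log_gap^~ xi) (2 / (1 - r ^+ 2) * radial_defect r xi).
Proof.
move=> x1 r1; have z1 := rxi_lt1 x1 r1; have f0 := one_sub_sqr_gt0 (fD z1).
have r2 := sqr_lt1 r1.
have /andP[r3 r4] := r1.
have H1 := rdiff_ln (cdiff_rxi hf x1 r1) (fD z1).
have p1 : 0 < 1 + r by lra.
have p2 : 0 < 1 - r by lra.
have H2 := rdiff_comp (rdiffD (rdiff_cst 1 r 0) (rdiff_fst r 0)) (is_derive1_ln p1).
have H3 := rdiff_comp (rdiffB (rdiff_cst 1 r 0) (rdiff_fst r 0)) (is_derive1_ln p2).
have := rdiff_dx (rdiffD H1 (rdiffB H2 H3)).
move=> H; have H' : is_derive r (1 : R) (log_gap^~ xi) _ := H.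
apply: (@is_derive_eq _ _ _ _ _ _ _ _ H').
rewrite /radial_defect /radial_ratio -[_ +i* 0]/(r%:C).
have ReZr (z : R[i]) (u : R) : complex.Re (z * u%:C) = complex.Re z * u by case: z => p q /=; ring.
rewrite ReZr.
move: f0; set N := nm _ ^+ 2 => f0.
field.
by rewrite (gt_eqF f0) (gt_eqF r2) /= ; apply/andP; split; apply: lt0r_neq0; lra.
Qed.

Lemma log_gap_nondecreasing r s xi : nm xi = 1 -> -1 < r -> r <= s -> s < 1 -> log_gap r xi <= log_gap s xi.
Proof.
move=> x1 r1 rs s1.
have [->//|rs'] := eqVneq r s; have {}rs : r < s by rewrite lt_neqAle rs' rs.
have hd y : r <= y <= s -> is_derive y (1 : R) (log_gap^~ xi) (2 / (1 - y ^+ 2) * radial_defect y xi).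
  by move=> /andP[h1 h2]; apply: log_gap_derive => //; slra.
have [||y] := @MVT R (log_gap^~ xi) (fun y => 2 / (1 - y ^+ 2) * radial_defect y xi) r s rs.
- by move=> y; rewrite in_itv/= => /andP[h1 h2]; apply: hd; slra.
- apply/continuous_in_subspaceT => y; rewrite inE/= in_itv/= => h; exact: derive_cont (hd y h).
rewrite in_itv/= => /andP[h1 h2] E; rewrite -subr_ge0 E.
have y1 : -1 < y < 1 by slra.
rewrite mulr_ge0 ?subr_ge0 ?(ltW rs)// mulr_ge0 ?radial_defect_ge0// divr_ge0// ltW//; exact: sqr_lt1.
Qed.

End radial.

(** * The radial defect tends to zero where the gap is bounded *)

Section julia. Variable R : realType.
Implicit Types (z w d a c xi : R[i]) (rho t x r s : R).
Local Notation nm := (@modulus R).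
Variables (f f1 f2 : R[i] -> R[i]).
Hypothesis hf : forall z, nm z < 1 -> cdiff f z (f1 z).
Hypothesis hf1 : forall z, nm z < 1 -> cdiff f1 z (f2 z).
Hypothesis fD : forall z, nm z < 1 -> nm (f z) < 1.
Local Notation log_gap := (log_gap f).
Local Notation radial_defect := (radial_defect f f1).
Local Notation radial_ratio := (radial_ratio f f1).

(** The algebra of [radial_defect_slope], with H = |f'|, H' = |f''|, n = 1 - |f|^2 and s = 1 - r^2.
    The hyperbolic derivative D = s H / n is at most 1, and the four terms are bounded by 1, 32, 2
    and 2 times 1 / (1 - r), whence 37. *)
Lemma slope_bound (H H' al be n s r : R) : 0 <= r < 1 -> s = 1 - r ^+ 2 -> 0 < n <= 1 ->
  0 <= H -> s * H <= n -> `|al| <= H -> `|be| <= H' -> H' * ((1 - r) / 2) ^+ 2 <= 4 * n ->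
  `|(H ^+ 2 + be) * (s / n) + al * ((- 2 * r * n + 2 * s * al) / n ^+ 2)| <= 37 / (1 - r).
Proof.
move=> /andP[r0 r1] sE /andP[n0 n1] H0 sH alH beH H'b.
have rr : 0 < 1 - r by lra.
have s0 : 0 < s by rewrite sE; nra.
have n0' : n != 0 by rewrite gt_eqF.
have s0' : s != 0 by rewrite gt_eqF.
have rr' : 1 - r != 0 by rewrite gt_eqF.
set D := s * H / n.
have D0 : 0 <= D by rewrite /D divr_ge0 ?(ltW n0)// mulr_ge0// ltW.
have D1 : D <= 1 by rewrite /D ler_pdivrMr// mul1r.
have HE : H = D * n / s by rewrite /D; field; rewrite n0' s0'.
have iS : s^-1 <= (1 - r)^-1 by rewrite lef_pV2 ?posrE// sE; nra.
have iS0 : 0 < s^-1 by rewrite invr_gt0.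
have b1 : `|H ^+ 2 * (s / n)| <= (1 - r)^-1.
  have -> : H ^+ 2 * (s / n) = D ^+ 2 * n / s by rewrite HE; field; rewrite n0' s0'.
  rewrite ger0_norm; last by rewrite divr_ge0 ?(ltW s0)// mulr_ge0 ?sqr_ge0// ltW.
  apply: le_trans iS; rewrite ler_piMl ?(ltW iS0)//.
  have D2 : D ^+ 2 <= 1 by nra.
  have := sqr_ge0 D; nra.
have b2 : `|be * (s / n)| <= 32 * (1 - r)^-1.
  rewrite normrM (ger0_norm (ltW (divr_gt0 s0 n0))).
  have : H' * (s / n) <= 32 * (1 - r)^-1.
    have -> : H' * (s / n) = H' * ((1 - r) / 2) ^+ 2 * (4 * (1 + r) / (n * (1 - r))).
      by rewrite sE; field; rewrite n0' rr'.
    have hq : 0 <= 4 * (1 + r) / (n * (1 - r)) by rewrite divr_ge0 ?mulr_ge0 ?ltW//; lra.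
    apply: (le_trans (ler_wpM2r hq H'b)).
    have -> : 4 * n * (4 * (1 + r) / (n * (1 - r))) = 16 * (1 + r) * (1 - r)^-1.
      by field; rewrite n0' rr'.
    by rewrite ler_pM2r ?invr_gt0//; lra.
  by apply: le_trans; apply: ler_wpM2r => //; exact: ltW (divr_gt0 s0 n0).
have b3 : `|al * (2 * r / n)| <= 2 * (1 - r)^-1.
  have q0 : 0 <= 2 * r / n by rewrite divr_ge0 ?mulr_ge0 ?(ltW n0).
  rewrite normrM (ger0_norm q0); apply: (le_trans (ler_wpM2r q0 alH)).
  have -> : H * (2 * r / n) = 2 * r * D * s^-1 by rewrite HE; field; rewrite n0' s0'.
  have h : 2 * r * D <= 2 by nra.
  apply: (le_trans (ler_wpM2r (ltW iS0) h)).
  by rewrite ler_pM2l.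
have b4 : `|al ^+ 2 * (2 * s / n ^+ 2)| <= 2 * (1 - r)^-1.
  have q0 : 0 <= 2 * s / n ^+ 2 by rewrite divr_ge0 ?sqr_ge0 ?mulr_ge0 ?(ltW s0).
  rewrite normrM (ger0_norm q0) normrX.
  have h : `|al| ^+ 2 <= H ^+ 2 by rewrite ler_pXn2r ?nnegrE.
  apply: (le_trans (ler_wpM2r q0 h)).
  have -> : H ^+ 2 * (2 * s / n ^+ 2) = 2 * D ^+ 2 * s^-1 by rewrite HE; field; rewrite n0' s0'.
  have h' : 2 * D ^+ 2 <= 2 by nra.
  apply: (le_trans (ler_wpM2r (ltW iS0) h')).
  by rewrite ler_pM2l.
have -> : (H ^+ 2 + be) * (s / n) + al * ((- 2 * r * n + 2 * s * al) / n ^+ 2) =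
  H ^+ 2 * (s / n) + be * (s / n) - al * (2 * r / n) + al ^+ 2 * (2 * s / n ^+ 2).
  by field.
apply: (le_trans (ler_normD _ _)); apply: (le_trans (lerD (ler_normB _ _) b4)).
apply: (le_trans (lerD (lerD (ler_normD _ _) b3) (lexx _))).
have := lerD b1 b2; lra.
Qed.

Lemma Re_conjMr z w : complex.Re (z^* * w) = complex.Re z * complex.Re w + complex.Im z * complex.Im w.
Proof. by case: z w => a b [c d] /=; ring. Qed.

(** The defect is thus Lipschitz for hyperbolic distance. Its slope involves f'', controlled by
    [second_deriv_bound] on the disc of radius (1 - r) / 2. *)
Lemma radial_defect_slope r xi : nm xi = 1 -> 0 <= r < 1 ->
  exists2 d, is_derive r (1 : R) (radial_defect^~ xi) d & `|d| <= 37 / (1 - r).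
Proof.
move=> x1 r01; have /andP[r0 r1] := r01.
have r1' : -1 < r < 1 by slra.
have z1 := rxi_lt1 x1 r1'; have f0 := one_sub_sqr_gt0 (fD z1).
have g1 := cdiff_rxi hf x1 r1'.
have g2 := cdiffM (cdiff_rxi hf1 x1 r1') (cdiff_cst xi (r +i* 0)).
have U := cdiff_rdiff_Re g1; have V := cdiff_rdiff_Im g1.
have U1 := cdiff_rdiff_Re g2; have V1 := cdiff_rdiff_Im g2.
have n0 : (fun y s : R => 1 - (complex.Re (f ((y +i* s) * xi)) * complex.Re (f ((y +i* s) * xi)) +
    complex.Im (f ((y +i* s) * xi)) * complex.Im (f ((y +i* s) * xi)))) r 0 != 0.
  by rewrite -!expr2 -nm_sqr gt_eqF.
have Nf := rdiffV (rdiffB (rdiff_cst 1 r 0) (rdiffD (rdiffM U U) (rdiffM V V))) n0.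
have S := rdiffB (rdiff_cst 1 r 0) (rdiffM (rdiff_fst r 0) (rdiff_fst r 0)).
pose z := r%:C * xi; pose h := f1 z * xi; pose h' := f2 z * xi * xi.
pose al := complex.Re ((f z)^* * h); pose be := complex.Re ((f z)^* * h').
pose n := 1 - nm (f z) ^+ 2; pose q := 1 - r ^+ 2.
pose d := - ((nm h ^+ 2 + be) * (q / n) + al * ((- 2 * r * n + 2 * q * al) / n ^+ 2)).
have ncE y s : 1 - (complex.Re (f ((y +i* s) * xi)) * complex.Re (f ((y +i* s) * xi)) +
    complex.Im (f ((y +i* s) * xi)) * complex.Im (f ((y +i* s) * xi))) = 1 - nm (f ((y +i* s) * xi)) ^+ 2.
  by rewrite -!expr2 -nm_sqr.
have nz : 1 - nm (f z) ^+ 2 != 0 by rewrite gt_eqF.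
have ReZr (u : R[i]) (v : R) : complex.Re (u * v%:C) = complex.Re u * v by case: u => a b /=; ring.
have [b' H] : exists b', rdiff (fun y s => 1 - complex.Re ((f ((y +i* s) * xi))^* * (f1 ((y +i* s) * xi) * xi) *
    ((1 - y ^+ 2) / (1 - nm (f ((y +i* s) * xi)) ^+ 2))%:C)) r 0 d b'.
  eexists; apply: (eq_rdiff _ _ erefl (rdiffB (rdiff_cst 1 r 0) (rdiffM (rdiffD (rdiffM U U1) (rdiffM V V1)) (rdiffM S Nf)))).
    by move=> y s; rewrite ReZr ncE Re_conjMr expr2; ring.
  rewrite /d /al /be /n !Re_conjMr !nm_sqr.
  have h'E : h' = f2 z * xi * xi + f1 z * 0 by rewrite mulr0 addr0.
  rewrite h'E /h -[_ +i* 0]/(r%:C) -/z /q expr2; move: nz; rewrite nm_sqr.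
  move: (f z) (f1 z * xi) (f2 z * xi * xi + f1 z * 0) => [u1 u2] [v1 v2] [w1 w2] /= nz.
  by field.
exists d; first exact: rdiff_dx H.
rewrite normrN; apply: (@slope_bound (nm h) (nm h')) => //.
- by rewrite f0 gerBl sqr_ge0.
- exact: nm_ge0.
- by rewrite /h nmM x1 mulr1 /q -(nm_rxi r x1); exact: schwarz_pick.
- by apply: (le_trans (re_le_nm _)); rewrite nmM nm_conj ler_piMl ?nm_ge0// ltW// fD.
- by apply: (le_trans (re_le_nm _)); rewrite nmM nm_conj ler_piMl ?nm_ge0// ltW// fD.
- rewrite /h' !nmM x1 !mulr1.
  have nz' : nm z = r by rewrite /z nmM x1 mulr1 nm_real ger0_norm.
  have := @second_deriv_bound R f f1 f2 hf hf1 fD z ((1 - r) / 2).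
  rewrite nz' => /(_ ltac:(lra) ltac:(lra)) /le_trans; apply.
  by rewrite ler_pM2l// /n; have := nm_ge0 (f z); have := fD z1; rewrite -/z; nra.
Qed.

(* A bounded [log_gap] makes the defect integrable against [2 dr / (1 - r^2)], and
   the slope bound forbids it to stay away from 0 near [r = 1]. *)
Lemma radial_defect_small xi (B : R) : nm xi = 1 -> (forall r, 0 <= r < 1 -> log_gap r xi <= B) ->
  forall e, 0 < e -> exists2 r0 : R, 0 <= r0 < 1 & forall r, r0 < r -> r < 1 -> radial_defect r xi <= e.
Proof.
move=> x1 vB e e0.
pose E := [set log_gap r xi | r in [set r | 0 <= r < 1]].
have E0 : E !=set0 by exists (log_gap 0 xi), 0 => //=; rewrite lexx ltr01.
have supE : has_sup E by split=> //; exists B => _ [r /= r01 <-]; exact: vB.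
(* If the defect exceeds e at r, then on [r, r + del (1 - r)] it drops by at most 74 del <= e / 2,
   because 37 / (1 - x) <= 74 / (1 - r) there. The gap then grows by more than del e / 2, which is
   all that remains beyond [r0]. *)
pose del := Num.min (1 / 2) (e / 148).
have d0 : 0 < del by rewrite lt_min !divr_gt0.
have d1 : del <= 1 / 2 by rewrite ge_min lexx.
have d2 : 74 * del <= e / 2.
  have : del <= e / 148 by rewrite ge_min lexx orbT.
  lra.
have de : 0 < del * (e / 2) by rewrite mulr_gt0// divr_gt0.
have [_ [r0 /= /andP[r00 r01] <-] hr0] := sup_adherent de supE.
exists r0; first by rewrite r00.
move=> r rr r1; rewrite leNgt; apply/negP => ec.
have r0' : 0 <= r by lra.
pose s := r + del * (1 - r).
have rs : r < s by rewrite /s ltrDl mulr_gt0// subr_gt0.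
have s1 : s <= (1 + r) / 2 by rewrite /s; nra.
have hv y : r <= y <= s -> is_derive y (1 : R) (log_gap^~ xi) (2 / (1 - y ^+ 2) * radial_defect y xi).
  by move=> /andP[h1 h2]; apply: log_gap_derive => //; slra.
have cs (y : R) : r <= y <= s -> radial_defect r xi - 74 * del <= radial_defect y xi.
  move=> /andP[ry ys].
  have [->|ry'] := eqVneq y r; first by rewrite gerBl mulr_ge0// ltW.
  have {ry'}ry : r < y by rewrite lt_neqAle eq_sym ry'.
  have hc (x : R) : r <= x <= y -> exists2 d, is_derive x (1 : R) (radial_defect^~ xi) d & `|d| <= 37 / (1 - x).
    by move=> /andP[h1 h2]; apply: radial_defect_slope => //; slra.
  have hc' (x : R) : r <= x <= y -> is_derive x (1 : R) (radial_defect^~ xi) (derive1 (radial_defect^~ xi) x).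
    by move=> /hc[d hd _]; split; [case: hd|rewrite derive1E].
  have [||x] := @MVT R (radial_defect^~ xi) (derive1 (radial_defect^~ xi)) r y ry.
  - by move=> x; rewrite in_itv/= => /andP[h1 h2]; apply: hc'; slra.
  - apply/continuous_in_subspaceT => x; rewrite inE/= in_itv/= => h; exact: derive_cont (hc' x h).
  rewrite in_itv/= => /andP[h1 h2] EE.
  have [|d hd hd37] := hc x; first by slra.
  have dE : derive1 (radial_defect^~ xi) x = d by rewrite derive1E; case: hd.
  have : `|radial_defect y xi - radial_defect r xi| <= 74 * del.
    rewrite EE dE normrM (ger0_norm (_ : 0 <= y - r)); last by lra.
    have q1 : y - r <= del * (1 - r) by rewrite /s in ys; lra.
    have q2 : 37 / (1 - x) <= 74 / (1 - r).
      rewrite ler_pdivrMr; last by lra.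
      rewrite mulrAC ler_pdivlMr; last by lra.
      by lra.
    have q3 : 0 <= y - r by lra.
    have q4 : 0 <= 74 / (1 - r) by rewrite divr_ge0//; lra.
    have -> : 74 * del = 74 / (1 - r) * (del * (1 - r)).
      by field; rewrite gt_eqF// subr_gt0.
    by apply: ler_pM => //; exact: le_trans hd37 q2.
  by rewrite ler_norml => /andP[+ _]; lra.
have [||y] := @MVT R (log_gap^~ xi) (fun y => 2 / (1 - y ^+ 2) * radial_defect y xi) r s rs.
- by move=> y; rewrite in_itv/= => /andP[h1 h2]; apply: hv; slra.
- apply/continuous_in_subspaceT => y; rewrite inE/= in_itv/= => h; exact: derive_cont (hv y h).
rewrite in_itv/= => /andP[h1 h2] EE.
have yc := cs y ltac:(slra).
have y1 : 0 < 1 - y ^+ 2 by nra.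
have k1 : (1 - r)^-1 <= 2 / (1 - y ^+ 2).
  rewrite ler_pdivlMr// mulrC ler_pdivrMr; last by lra.
  by nra.
have sE : log_gap s xi <= sup E by apply: ub_le_sup; [case: supE|exists s => //=; slra].
have r0r : log_gap r0 xi <= log_gap r xi by apply: (log_gap_nondecreasing hf fD x1); lra.
have : del * radial_defect y xi <= log_gap s xi - log_gap r xi.
  rewrite EE /s addrAC subrr add0r.
  have c0 : 0 <= radial_defect y xi by apply: radial_defect_ge0 => //; slra.
  have -> : del * radial_defect y xi = (1 - r)^-1 * radial_defect y xi * (del * (1 - r)).
    by field; rewrite gt_eqF// subr_gt0.
  rewrite ler_wpM2r//; first by rewrite mulr_ge0 ?(ltW d0)// subr_ge0 ltW.
  by rewrite ler_wpM2r.
have : del * (e / 2) < del * radial_defect y xi by rewrite ltr_pM2l//; lra.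
lra.
Qed.
End julia.

(** * The Julia-Caratheodory theorem along a radius *)

Section jc. Variable R : realType.
Implicit Types (z w d a c xi : R[i]) (rho t x r s : R).
Local Notation nm := (@modulus R).

Lemma ImB z w : complex.Im (z - w) = complex.Im z - complex.Im w.
Proof. by case: z w => [? ?] [? ?]. Qed.

Lemma le0_of_linear (del C : R) : (forall r, 0 <= r < 1 -> del <= C * (1 - r)) -> del <= 0.
Proof.
move=> H; rewrite leNgt; apply/negP => d0.
have h0 := H 0; rewrite lexx ltr01 subr0 mulr1 in h0; have {}h0 := h0 isT.
have C0 : 0 < C by apply: lt_le_trans h0.
have p : 0 < del / (2 * C) by rewrite divr_gt0// mulr_gt0.
have q : del / (2 * C) <= 1 by rewrite ler_pdivrMr ?mulr_gt0//; lra.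
have := H (1 - del / (2 * C)); rewrite subr_ge0 q ltrBlDr ltrDl p => /(_ isT).
have -> : C * (1 - (1 - del / (2 * C))) = del / 2 by field; exact: lt0r_neq0.
lra.
Qed.

Lemma at_left1P (h : R -> R) (l : R) : (h r @[r --> (1 : R)^'-] --> l) <->
  forall e : R, 0 < e -> exists2 r0 : R, 0 <= r0 < 1 & forall r, r0 < r -> r < 1 -> `|h r - l| < e.
Proof.
split.
- move=> /cvgrPdist_lt H e e0; have := H e e0; rewrite /prop_near1 /at_left /within.
  move=> [d /= d0 hd]; exists (Num.max 0 (1 - d)).
    by rewrite le_max lexx /= gt_max ltr01 /=; lra.
  move=> r; rewrite gt_max => /andP[r0 rd] r1; rewrite distrC; apply: hd => //=.
  by rewrite ger0_norm; lra.
- move=> H; apply/cvgrPdist_lt => e e0; have [r0 /andP[r00 r01] hr] := H e e0.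
  rewrite /prop_near1 /at_left /within; exists (1 - r0); first by rewrite /= subr_gt0.
  move=> r /= hd r1; rewrite distrC; apply: hr => //.
  by move: hd; rewrite ger0_norm; lra.
Qed.

Lemma at_left1_complexP (h : R -> R[i]) (l : R[i]) : (h r : R[i]^o) @[r --> (1 : R)^'-] --> (l : R[i]^o) <->
  forall e : R, 0 < e -> exists2 r0 : R, 0 <= r0 < 1 & forall r, r0 < r -> r < 1 -> nm (h r - l) < e.
Proof.
split.
- move=> H e e0.
  have : complex.Re (h r) @[r --> (1 : R)^'-] --> complex.Re l.
    by apply: (cvg_comp _ _ H); exact: continuous_Re.
  have : complex.Im (h r) @[r --> (1 : R)^'-] --> complex.Im l.
    by apply: (cvg_comp _ _ H); exact: continuous_Im.
  have e2 : 0 < e / 2 by rewrite divr_gt0.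
  move=> /at_left1P/(_ _ e2)[r1 /andP[r10 r11] h1] /at_left1P/(_ _ e2)[r2 /andP[r20 r21] h2].
  exists (Num.max r1 r2); first by rewrite le_max r10 /= gt_max r11.
  move=> r; rewrite gt_max => /andP[ra rb] rc.
  apply: (le_lt_trans (nm_le _)); rewrite ReB.
  rewrite ImB.
  by have := h1 r ra rc; have := h2 r rb rc; lra.
- move=> H; apply: cvg_complex; apply/at_left1P => e e0; have [r0 r01 hr] := H e e0; exists r0 => // r ra rb.
    by apply: le_lt_trans (hr r ra rb); rewrite -ReB; exact: re_le_nm.
  apply: le_lt_trans (hr r ra rb).
  rewrite -ImB.
  exact: im_le_nm.
Qed.

(** h + K r is nondecreasing and bounded, so the limit of h is its supremum minus K. *)
Lemma lipschitz_at_left (h : R -> R) (K : R) : (forall r s, 0 <= r -> r <= s -> s < 1 -> `|h s - h r| <= K * (s - r)) ->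
  exists l, forall r, 0 <= r < 1 -> `|h r - l| <= K * (1 - r).
Proof.
move=> hK.
have K0 : 0 <= K.
  have := hK 0 (1/2) (lexx _); rewrite subr0 => /(_ ltac:(lra) ltac:(lra)).
  by have := normr_ge0 (h (1/2) - h 0); lra.
pose E := [set h r + K * r | r in [set r | 0 <= r < 1]].
have ub r s : 0 <= r < 1 -> 0 <= s < 1 -> h s + K * s <= h r + K * (1 - r) + K.
  move=> /andP[r0 r1] /andP[s0 s1]; case: (leP r s) => [rs|/ltW sr].
    have := hK r s r0 rs s1; rewrite ler_norml => /andP[_]; nra.
  have := hK s r s0 sr r1; rewrite ler_norml => /andP[+ _]; nra.
have E0 : E !=set0 by exists (h 0 + K * 0), 0 => //=; rewrite lexx ltr01.
have Eub : has_ubound E.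
  by exists (h 0 + K * (1 - 0) + K) => _ [s /= s01 <-]; apply: ub => //; rewrite lexx ltr01.
exists (sup E - K) => r r01; rewrite ler_norml; apply/andP; split.
  have : sup E <= h r + K * (1 - r) + K by apply: ge_sup => // _ [s /= s01 <-]; exact: ub.
  lra.
have : h r + K * r <= sup E by apply: ub_le_sup => //; exists r.
lra.
Qed.

Variables (f f1 f2 : R[i] -> R[i]).
Hypothesis hf : forall z, nm z < 1 -> cdiff f z (f1 z).
Hypothesis hf1 : forall z, nm z < 1 -> cdiff f1 z (f2 z).
Hypothesis fD : forall z, nm z < 1 -> nm (f z) < 1.
Local Notation log_gap := (log_gap f).
Local Notation radial_defect := (radial_defect f f1).
Local Notation radial_ratio := (radial_ratio f f1).

Lemma radial_lip xi (K : R) r s : nm xi = 1 -> 0 <= r -> r <= s -> s < 1 ->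
  (forall y, r <= y <= s -> nm (f1 (y%:C * xi)) <= K) ->
  nm (f (s%:C * xi) - f (r%:C * xi)) <= K * (s - r).
Proof.
move=> x1 r0 rs s1 hK.
have E (y : R) : r%:C * xi + y%:C * ((s - r)%:C * xi) = (r + y * (s - r))%:C * xi.
  by rewrite [in RHS]rmorphD [in RHS]rmorphM; ring.
have yb (y : R) : 0 <= y <= 1 -> r <= r + y * (s - r) <= s.
  by move=> /andP[y0 y1]; apply/andP; split; nra.
have -> : K * (s - r) = K * nm ((s - r)%:C * xi).
  by rewrite nmM x1 mulr1 nm_real ger0_norm// subr_ge0.
have -> : s%:C * xi = r%:C * xi + (s - r)%:C * xi by rewrite -mulrDl -rmorphD addrC subrK.
apply: (@complex_MVT R f f1) => y y01; rewrite E.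
  by apply: hf; apply: rxi_lt1 => //; have /andP[h1 h2] := yb y y01; slra.
exact: hK (yb y y01).
Qed.

Lemma one_sub_normE xi r : nm xi = 1 -> 0 <= r < 1 ->
  1 - nm (f (r%:C * xi)) ^+ 2 = expR (log_gap r xi) * ((1 - r) / (1 + r)).
Proof.
move=> x1 /andP[r0 r1]; rewrite /log_gap expRD expRD expRN !lnK ?posrE; try lra.
  by rewrite -mulrA [X in _ = _ * X](_ : _ = 1) ?mulr1//; field; apply/andP; split; apply: lt0r_neq0; lra.
by apply: one_sub_sqr_gt0; apply: fD; apply: rxi_lt1 => //; slra.
Qed.

Lemma nm_f1_le xi r : nm xi = 1 -> 0 <= r < 1 -> nm (f1 (r%:C * xi)) <= expR (log_gap r xi).
Proof.
move=> x1 r01; have /andP[r0 r1] := r01.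
have z1 : nm (r%:C * xi) < 1 by apply: rxi_lt1 => //; slra.
have := schwarz_pick hf fD z1; rewrite nm_rxi// (one_sub_normE x1 r01).
have e0 := expR_gt0 (log_gap r xi).
have p1 : 0 < 1 - r ^+ 2 by nra.
rewrite mulrC -ler_pdivlMr// => /le_trans; apply.
rewrite -mulrA; apply: ler_piMr; first exact: ltW.
have -> : (1 - r) / (1 + r) / (1 - r ^+ 2) = ((1 + r) ^+ 2)^-1.
  by field; repeat (apply/andP; split); apply: lt0r_neq0; nra.
by rewrite invf_le1 ?exprn_gt0; nra.
Qed.

(** Near r = 1 the derivative is bounded by some K, so |w - f| <= K (1 - r) and 1 - |f|^2 <= 2 K (1
    - r). *)
Lemma log_gap_bounded_of_radial xi w a : nm xi = 1 -> nm w = 1 -> radial_cvg f xi w ->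
  radial_cvg f1 xi a -> exists B, forall r, 0 <= r < 1 -> log_gap r xi <= B.
Proof.
move=> x1 w1 /at_left1_complexP hw /at_left1_complexP ha.
have [r0 /andP[r00 r01] hr0] := ha 1 ltr01.
pose K := nm a + 1.
have K0 : 0 < K by rewrite ltr_wpDl ?nm_ge0.
have hK r : r0 < r -> r < 1 -> nm (f1 (r%:C * xi)) <= K.
  move=> h1 h2; have := hr0 r h1 h2; have := nmD (f1 (r%:C * xi) - a) a; rewrite subrK /K; lra.
have hwr r : r0 < r -> r < 1 -> nm (w - f (r%:C * xi)) <= K * (1 - r).
  move=> h1 h2; apply/ler_addgt0Pr => e e0.
  have [r2 /andP[r20 r21] hr2] := hw e e0.
  pose s := Num.max r ((r2 + 1) / 2).
  have s1 : s < 1 by rewrite gt_max h2 /=; lra.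
  have rs : r <= s by rewrite le_max lexx.
  have r2s : r2 < s by rewrite lt_max; apply/orP; right; lra.
  have := hr2 s r2s s1; rewrite nmB.
  have := @radial_lip xi K r s x1 ltac:(lra) rs s1.
  have := nmD (w - f (s%:C * xi)) (f (s%:C * xi) - f (r%:C * xi)); rewrite addrA subrK.
  move=> h3 h4 h5.
  have h6 : nm (f (s%:C * xi) - f (r%:C * xi)) <= K * (s - r).
    by apply: h4 => y /andP[y1 y2]; apply: hK; lra.
  have : K * (s - r) <= K * (1 - r) by rewrite ler_pM2l//; lra.
  lra.
(* The bound 2 K (1 - r) on 1 - |f|^2 is multiplied by (1 + r) / (1 - r), with 1 + r <= 2. Radii up
   to [r0] are covered by monotonicity, through a larger radius [s]. *)
exists (ln (4 * K)) => r /andP[ra rb].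
pose s := Num.max r ((r0 + 1) / 2).
have s1 : s < 1 by rewrite gt_max rb /=; lra.
have rs : r <= s by rewrite le_max lexx.
have r0s : r0 < s by rewrite lt_max; apply/orP; right; lra.
have s0 : 0 <= s by lra.
apply: (le_trans (log_gap_nondecreasing hf fD x1 _ rs s1)); first lra.
rewrite -ler_expR lnK ?posrE ?mulr_gt0//.
have := hwr s r0s s1; have := nmD (w - f (s%:C * xi)) (f (s%:C * xi)); rewrite subrK w1 => h1 h2.
have sz : nm (s%:C * xi) < 1 by apply: rxi_lt1 => //; slra.
have := fD sz; have := nm_ge0 (f (s%:C * xi)); set N := nm (f _) in h1 h2 * => N0 N1.
have h3 : 1 - N ^+ 2 <= 2 * (K * (1 - s)) by nra.
have := one_sub_normE x1 (_ : 0 <= s < 1); rewrite -/N => /(_ ltac:(slra)) E.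
have p : 0 < (1 - s) / (1 + s) by rewrite divr_gt0; lra.
rewrite -(ler_pM2r p) -E (le_trans h3)//.
have -> : 2 * (K * (1 - s)) = K * ((1 - s) / (1 + s)) * (2 * (1 + s)).
  by field; apply: lt0r_neq0; lra.
have := mulr_gt0 K0 p; nra.
Qed.

Lemma log_gap_cvg xi (B : R) : nm xi = 1 -> (forall r, 0 <= r < 1 -> log_gap r xi <= B) ->
  exists V, (forall r, 0 <= r < 1 -> log_gap r xi <= V) /\ log_gap r xi @[r --> (1 : R)^'-] --> V.
Proof.
move=> x1 vB.
pose E := [set log_gap r xi | r in [set r | 0 <= r < 1]].
have E0 : E !=set0 by exists (log_gap 0 xi), 0 => //=; rewrite lexx ltr01.
have supE : has_sup E by split=> //; exists B => _ [r /= r01 <-]; exact: vB.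
have leS r : 0 <= r < 1 -> log_gap r xi <= sup E.
  by move=> r01; apply: ub_le_sup; [case: supE|exists r].
exists (sup E); split=> //; apply/at_left1P => e e0.
have [_ [r0 /= /andP[r00 r01] <-] hr0] := sup_adherent e0 supE.
exists r0; first by rewrite r00.
move=> r h1 h2; rewrite distrC ger0_norm; last by rewrite subr_ge0; apply: leS; slra.
by have := log_gap_nondecreasing hf fD x1 (_ : -1 < r0) (ltW h1) h2; move=> /(_ ltac:(lra)); lra.
Qed.

(* [log_gap] bounded forces [radial_ratio --> 1], which determines both the radial
   limit and that of the derivative. *)
Lemma julia_caratheodory xi (B : R) : nm xi = 1 -> (forall r, 0 <= r < 1 -> log_gap r xi <= B) ->
  exists V w a, [/\ (forall r, 0 <= r < 1 -> log_gap r xi <= V) /\ (log_gap r xi @[r --> (1 : R)^'-] --> V),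
    nm w = 1, radial_cvg f xi w, radial_cvg f1 xi a & nm a = expR V / 4].
Proof.
move=> x1 vB.
have [V [leV cV]] := log_gap_cvg x1 vB.
have lipf r s : 0 <= r -> r <= s -> s < 1 -> nm (f (s%:C * xi) - f (r%:C * xi)) <= expR B * (s - r).
  move=> r0 rs s1; apply: radial_lip => // y /andP[y1 y2].
  have y01 : 0 <= y < 1 by slra.
  by apply: (le_trans (nm_f1_le x1 y01)); rewrite ler_expR; exact: vB.
have [w hw] : exists w, forall r, 0 <= r < 1 -> nm (f (r%:C * xi) - w) <= 2 * expR B * (1 - r).
  have lipRe r s : 0 <= r -> r <= s -> s < 1 ->
      `|complex.Re (f (s%:C * xi)) - complex.Re (f (r%:C * xi))| <= expR B * (s - r).
    by move=> a b c; rewrite -ReB; exact: le_trans (re_le_nm _) (lipf r s a b c).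
  have lipIm r s : 0 <= r -> r <= s -> s < 1 ->
      `|complex.Im (f (s%:C * xi)) - complex.Im (f (r%:C * xi))| <= expR B * (s - r).
    by move=> a b c; rewrite -ImB; exact: le_trans (im_le_nm _) (lipf r s a b c).
  have [l1 h1] := lipschitz_at_left lipRe; have [l2 h2] := lipschitz_at_left lipIm.
  exists (l1 +i* l2) => r r01; apply: (le_trans (nm_le _)); rewrite ReB ImB /=.
  by have := h1 r r01; have := h2 r r01; lra.
have K0 := expR_gt0 B.
have fw : radial_cvg f xi w.
  apply/at_left1_complexP => e e0.
  exists (Num.max 0 (1 - e / (2 * expR B))).
    by rewrite le_max lexx /= gt_max ltr01 /= gtrBl divr_gt0// mulr_gt0.
  move=> r; rewrite gt_max => /andP[r0 rd] r1.
  have r01 : 0 <= r < 1 by slra.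
  apply: (le_lt_trans (hw r r01)).
  have : 1 - r < e / (2 * expR B) by lra.
  by rewrite ltr_pdivlMr ?mulr_gt0// mulrC.
have fB r : 0 <= r < 1 -> 1 - nm (f (r%:C * xi)) <= expR B * (1 - r).
  move=> r01; have /andP[r0 r1] := r01.
  have z1 : nm (r%:C * xi) < 1 by apply: rxi_lt1 => //; slra.
  have h := fD z1; have h' := nm_ge0 (f (r%:C * xi)).
  have : 1 - nm (f (r%:C * xi)) <= 1 - nm (f (r%:C * xi)) ^+ 2 by nra.
  move=> /le_trans; apply; rewrite (one_sub_normE x1 r01).
  apply: ler_pM; first exact: expR_ge0.
  - by rewrite divr_ge0; lra.
  - by rewrite ler_expR; exact: vB.
  - by rewrite ler_pdivrMr; nra.
have w1 : nm w = 1.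
  apply/eqP; rewrite -subr_eq0 -normr_le0; apply: (@le0_of_linear _ (3 * expR B)) => r r01.
  have /andP[r0 r1] := r01.
  have z1 : nm (r%:C * xi) < 1 by apply: rxi_lt1 => //; slra.
  have := hw r r01; have := fB r r01; have := ler_dist_nm (f (r%:C * xi)) w; have := fD z1.
  move=> h1; rewrite ler_norml (nmB w) => /andP[h2 h3] h4 h5; rewrite ler_norml.
  apply/andP; split; lra.
have w0 : w != 0 by rewrite -nm_eq0 w1 oner_eq0.
have xi0 : xi != 0 by rewrite -nm_eq0 x1 oner_eq0.
(* The limit of [G] below; the leading 1 is the limit of [radial_ratio]. *)
pose a := 1 * (expR V / 4)%:C * (w^*)^-1 * xi^-1.
have na : nm a = expR V / 4.
  rewrite /a !nmM !nmV nm_conj nm1 w1 x1 invr1 mul1r !mulr1 nm_real ger0_norm//.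
pose E r := expR (log_gap r xi) / (1 + r) ^+ 2.
(* The definition of [radial_ratio] solved for f'(r xi), since [E r] is (1 - |f|^2) / (1 - r^2). *)
pose G r := radial_ratio r xi * (E r)%:C * ((f (r%:C * xi))^*)^-1 * xi^-1.
have cE : E r @[r --> (1 : R)^'-] --> expR V / 4.
  apply: cvgM; first by apply: continuous_cvg => //; exact: continuous_expR.
  have -> : (4 : R)^-1 = ((1 + 1) ^+ 2)^-1 by congr (_^-1); ring.
  apply: cvgV; first by rewrite expf_neq0// (_ : 1 + 1 = 2)// .
  apply: (@continuous_cvg _ R R _ _ (fun r => 1 + r) (fun y => y ^+ 2)); first exact: exprn_continuous.
  apply: cvg_at_left_filter; apply: cvgD; [exact: cvg_cst|exact: cvg_id].
have cb : (radial_ratio r xi : R[i]^o) @[r --> (1 : R)^'-] --> (1 : R[i]^o).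
  apply/at_left1_complexP => e e0.
  (* For |b| <= 1 one has |b - 1|^2 <= 2 (1 - Re b), hence at most e^2 / 4 here. *)
  have e8 : 0 < e ^+ 2 / 8 by rewrite divr_gt0// exprn_gt0.
  have [r0 r00 hr] := radial_defect_small hf hf1 fD x1 vB e8.
  exists r0 => // r h1 h2; have c8 := hr r h1 h2.
  have r1' : -1 < r < 1 by move: r00 => /andP[? ?]; slra.
  have b1 : nm (radial_ratio r xi) <= 1.
    apply: (le_trans (nm_radial_ratio_le f1 fD x1 r1')); rewrite gerBl; apply: (distortion_at_ge0 hf fD); exact: rxi_lt1.
  rewrite -(ltr_pXn2r (ltn0Sn 1)) ?nnegrE ?nm_ge0 ?(ltW e0)// nm_sqr.
  have b2 : complex.Re (radial_ratio r xi) ^+ 2 + complex.Im (radial_ratio r xi) ^+ 2 <= 1.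
    by rewrite -nm_sqr; have := nm_ge0 (radial_ratio r xi); nra.
  move: c8; rewrite /radial_defect ReB ImB /= subr0 => c8.
  have := exprn_gt0 2 e0; nra.
have cG : (G r : R[i]^o) @[r --> (1 : R)^'-] --> (a : R[i]^o).
  have c1 : ((E r)%:C : R[i]^o) @[r --> (1 : R)^'-] --> ((expR V / 4)%:C : R[i]^o).
    by apply: cvg_complex => //=; exact: cvg_cst.
  have c2 : ((f (r%:C * xi))^* : R[i]^o) @[r --> (1 : R)^'-] --> (w^* : R[i]^o).
    by apply: (cvg_comp _ _ fw); exact: continuous_conj.
  have c3 : (((f (r%:C * xi))^*)^-1 : R[i]^o) @[r --> (1 : R)^'-] --> ((w^*)^-1 : R[i]^o).
    apply: (@cvgV R[i] R (at_left 1) _ (fun r => (f (r%:C * xi))^* : R[i]^o) (w^*) _ c2).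
    by rewrite -nm_eq0 nm_conj w1 oner_eq0.
  have FF : Filter (at_left (1 : R)) by exact: filter_filter.
  have c4 := @cvgM R[i] R (at_left 1) FF (fun r => radial_ratio r xi : R[i]^o) (fun r => (E r)%:C : R[i]^o) _ _ cb c1.
  have c5 := @cvgM R[i] R (at_left 1) FF (fun r => radial_ratio r xi * (E r)%:C : R[i]^o) _ _ _ c4 c3.
  have c6 : (xi^-1 : R[i]^o) @[r --> (1 : R)^'-] --> (xi^-1 : R[i]^o) by exact: cvg_cst.
  exact: (@cvgM R[i] R (at_left 1) FF (fun r => radial_ratio r xi * (E r)%:C * ((f (r%:C * xi))^*)^-1 : R[i]^o) _ _ _ c5 c6).
exists V, w, a; split; [by split|exact: w1|exact: fw| |exact: na].
apply/at_left1_complexP => e e0.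
move/at_left1_complexP : cG => /(_ e e0)[r1 /andP[r10 r11] h1].
move/at_left1_complexP : fw => /(_ 1 ltr01)[r2 /andP[r20 r21] h2].
exists (Num.max r1 r2); first by rewrite le_max r10 /= gt_max r11.
move=> r; rewrite gt_max => /andP[ra rb] rc.
have <- : G r = f1 (r%:C * xi); last exact: h1.
have fn0 : f (r%:C * xi) != 0.
  by apply: contraTneq (h2 r rb rc) => ->; rewrite sub0r nmN w1 ltxx.
have fn0' : (f (r%:C * xi))^* != 0 by rewrite -nm_eq0 nm_conj nm_eq0.
have r01 : 0 <= r < 1 by slra.
have Er : (1 - r ^+ 2) / (1 - nm (f (r%:C * xi)) ^+ 2) * E r = 1.
  rewrite (one_sub_normE x1 r01) /E; field.
  have e0' := expR_gt0 (log_gap r xi).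
  by repeat (apply/andP; split); apply: lt0r_neq0; lra.
have Er' : ((1 - r ^+ 2) / (1 - nm (f (r%:C * xi)) ^+ 2))%:C * (E r)%:C = 1 by rewrite -rmorphM Er.
rewrite /G /radial_ratio.
have -> : (f (r%:C * xi))^* * (f1 (r%:C * xi) * xi) * ((1 - r ^+ 2) / (1 - nm (f (r%:C * xi)) ^+ 2))%:C * (E r)%:C * ((f (r%:C * xi))^*)^-1 * xi^-1
  = (((1 - r ^+ 2) / (1 - nm (f (r%:C * xi)) ^+ 2))%:C * (E r)%:C) * ((f (r%:C * xi))^* / (f (r%:C * xi))^*) * (xi / xi) * f1 (r%:C * xi) by ring.
by rewrite Er' !divff// !mul1r.
Qed.
End jc.

(** * The gap in logarithmic polar coordinates: gradient and Laplacian *)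

Section green. Variable R : realType.
Implicit Types (z w d a c xi : R[i]) (rho t x y r s : R).
Local Notation nm := (@modulus R).

(** The density 2 dr / (1 - r^2) in the coordinate x = log r, that is, 1 / sinh(-x). *)
Definition kk x : R := 2 * expR x / (1 - expR x ^+ 2).
(** The derivative of [kk], written as its square plus a bounded term: in the Laplacian of W the
    square meets [kk]^2 (1 - mu)^2, mu being the distortion. *)
Definition kk1 x : R := kk x ^+ 2 + 2 * expR x / (1 + expR x) ^+ 2.

Lemma expR_itv01 x : x < 0 -> 0 < expR x < 1.
Proof. by move=> x0; rewrite expR_gt0 -expR0 ltr_expR. Qed.

Lemma kk_den x : x < 0 -> 0 < 1 - expR x ^+ 2.
Proof. by move=> /expR_itv01/andP[? ?]; nra. Qed.

Lemma kk_gt0 x : x < 0 -> 0 < kk x.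
Proof. by move=> x0; rewrite divr_gt0 ?kk_den ?mulr_gt0 ?expR_gt0. Qed.

Lemma rdiff_kk x t : x < 0 -> rdiff (fun y _ => kk y) x t (kk1 x) 0.
Proof.
move=> x0; have E := rdiff_comp (rdiff_fst x t) (is_derive_expR x).
have dn := kk_den x0; have /andP[e0 e1] := expR_itv01 x0.
have dn' : 1 - expR x * expR x != 0 by rewrite -expr2 gt_eqF.
have D := rdiffV (rdiffB (rdiff_cst 1 x t) (rdiffM E E)) dn'.
apply: eq_rdiff (rdiffM (rdiffZ 2 E) D).
- by move=> y s; rewrite /kk expr2.
- rewrite /kk1 /kk; move: dn' dn e0 e1; move: (expR x) => e dn' dn e0 e1; field.
  by repeat (apply/andP; split); apply: lt0r_neq0; nra.
- by ring.
Qed.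

(** This is -x <= sinh(-x). The function [h] vanishes at 0 and decreases, because 1 + y <= e^y. *)
Lemma kk_bound x : x < 0 -> - x * kk x <= 1.
Proof.
move=> x0; rewrite /kk mulrA ler_pdivrMr ?kk_den// mul1r.
pose h (y : R) := 1 - expR y ^+ 2 + 2 * y * expR y.
pose h' (y : R) := 2 * expR y * (1 + y - expR y).
have dh (y : R) : is_derive y (1 : R) h (h' y).
  have E := rdiff_comp (rdiff_fst y 0) (is_derive_expR y).
  have := rdiff_dx (rdiffD (rdiffB (rdiff_cst 1 y 0) (rdiffM E E)) (rdiffM (rdiffZ 2 (rdiff_fst y 0)) E)).
  move=> H; have H' : is_derive y (1 : R) h _ := H.
  by apply: (@is_derive_eq _ _ _ _ _ _ _ _ H'); rewrite /h'; ring.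
have ch : {within `[x, 0], continuous h}.
  by apply: continuous_subspaceT => y; exact: derive_cont (dh y).
have [y] := @MVT R h h' x 0 x0 (fun y _ => dh y) ch.
rewrite in_itv/= => /andP[y1 y2]; rewrite {1}/h expR0 expr1n subrr add0r mulr0 mul0r sub0r.
move=> E; have e := expR_ge1Dx y; have e0 := expR_gt0 y.
have e2 : 1 + y - expR y <= 0 by lra.
have h'0 : h' y <= 0 by rewrite /h' mulr_ge0_le0// mulr_ge0// ltW.
have h'x : h' y * (0 - x) <= 0 by rewrite mulr_le0_ge0// sub0r oppr_ge0 ltW.
have : 0 <= h x by lra.
rewrite /h; lra.
Qed.

Variables (f f1 f2 : R[i] -> R[i]).
Hypothesis hf : forall z, nm z < 1 -> cdiff f z (f1 z).
Hypothesis hf1 : forall z, nm z < 1 -> cdiff f1 z (f2 z).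
Hypothesis fD : forall z, nm z < 1 -> nm (f z) < 1.
Local Notation log_gap := (log_gap f).
Local Notation distortion_at := (distortion_at f f1).

Definition gg w := f (cexp w).
Definition gg1 w := f1 (cexp w) * cexp w.
Definition gg2 w := f2 (cexp w) * cexp w * cexp w + f1 (cexp w) * cexp w.

Lemma cexp_lt1 x t : x < 0 -> nm (cexp (x +i* t)) < 1.
Proof. by move=> x0; rewrite nm_cexp; have /andP[] := expR_itv01 x0. Qed.

Lemma cdiff_gg x t : x < 0 -> cdiff gg (x +i* t) (gg1 (x +i* t)).
Proof. by move=> x0; apply: cdiff_comp (cdiff_cexp _) (hf (cexp_lt1 t x0)). Qed.

Lemma cdiff_gg1 x t : x < 0 -> cdiff gg1 (x +i* t) (gg2 (x +i* t)).
Proof.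
move=> x0; have c := cdiff_cexp (x +i* t).
exact: cdiffM (cdiff_comp c (hf1 (cexp_lt1 t x0))) c.
Qed.

Lemma gg_lt1 x t : x < 0 -> nm (gg (x +i* t)) < 1.
Proof. by move=> x0; apply: fD; exact: cexp_lt1. Qed.

Definition nn x t : R := 1 - nm (gg (x +i* t)) ^+ 2.
Definition PP x t : R := complex.Re ((gg (x +i* t))^* * gg1 (x +i* t)).
Definition QQ x t : R := complex.Im ((gg (x +i* t))^* * gg1 (x +i* t)).
Definition SS x t : R := complex.Re ((gg (x +i* t))^* * gg2 (x +i* t)).

Lemma nn_gt0 x t : x < 0 -> 0 < nn x t.
Proof. by move=> x0; apply: one_sub_sqr_gt0; exact: gg_lt1. Qed.

(* [log_gap] at [z = cexp (x +i* t)], normalized so as to be at least 1; [Wx], [Wt],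
   [Wxx] and [Wtt] are its partial derivatives. *)
Definition polar_gap x t : R := log_gap (expR x) (ei t) + (1 - log_gap 0 1).
Definition Wx x t : R := kk x - 2 * (PP x t / nn x t).
Definition Wt x t : R := 2 * (QQ x t / nn x t).
Definition Wxx x t : R := kk1 x - 2 * ((nm (gg1 (x +i* t)) ^+ 2 + SS x t) / nn x t + 2 * PP x t ^+ 2 / nn x t ^+ 2).
Definition Wtt x t : R := 2 * ((SS x t - nm (gg1 (x +i* t)) ^+ 2) / nn x t - 2 * QQ x t ^+ 2 / nn x t ^+ 2).

Lemma rdiff_polar_gap x t : x < 0 -> rdiff polar_gap x t (Wx x t) (Wt x t).
Proof.
move=> x0; have n0 := nn_gt0 t x0; have /andP[e0 e1] := expR_itv01 x0.
have H := rdiff_ln (cdiff_gg t x0) (gg_lt1 t x0).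
have E := rdiff_comp (rdiff_fst x t) (is_derive_expR x).
have p1 : 0 < 1 + expR x by lra.
have p2 : 0 < 1 - expR x by lra.
have H2 := rdiff_comp (rdiffD (rdiff_cst 1 x t) E) (is_derive1_ln p1).
have H3 := rdiff_comp (rdiffB (rdiff_cst 1 x t) E) (is_derive1_ln p2).
apply: eq_rdiff (rdiffD (rdiffD H (rdiffB H2 H3)) (rdiff_cst (1 - log_gap 0 1) x t)).
- by [].
- rewrite /Wx -/(PP x t) -/(nn x t) /kk; move: (nn x t) n0 => n n0; have d0 := kk_den x0.
  by field; repeat (apply/andP; split); apply: lt0r_neq0; lra.
- rewrite /Wt -/(QQ x t) -/(nn x t); move: (nn x t) n0 => n n0.
  by field; repeat (apply/andP; split); apply: lt0r_neq0; lra.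
Qed.

Lemma rdiff_nn x t : x < 0 -> rdiff nn x t (- 2 * PP x t) (2 * QQ x t).
Proof.
move=> x0; have U := cdiff_rdiff_Re (cdiff_gg t x0); have V := cdiff_rdiff_Im (cdiff_gg t x0).
apply: eq_rdiff (rdiffB (rdiff_cst 1 x t) (rdiffD (rdiffM U U) (rdiffM V V))).
- by move=> y s; rewrite /nn nm_sqr !expr2.
- by rewrite /PP; move: (gg _) (gg1 _) => [a b] [c d] /=; ring.
- by rewrite /QQ; move: (gg _) (gg1 _) => [a b] [c d] /=; ring.
Qed.

Lemma rdiff_PP x t : x < 0 -> exists b, rdiff PP x t (nm (gg1 (x +i* t)) ^+ 2 + SS x t) b.
Proof.
move=> x0; have U := cdiff_rdiff_Re (cdiff_gg t x0); have V := cdiff_rdiff_Im (cdiff_gg t x0).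
have U1 := cdiff_rdiff_Re (cdiff_gg1 t x0); have V1 := cdiff_rdiff_Im (cdiff_gg1 t x0).
eexists; apply: (eq_rdiff _ _ erefl (rdiffD (rdiffM U U1) (rdiffM V V1))).
- by move=> y s; rewrite /PP Re_conjMr.
- by rewrite nm_sqr /SS; move: (gg _) (gg1 _) (gg2 _) => [a b] [c d] [a' b'] /=; ring.
Qed.

Lemma rdiff_QQ x t : x < 0 -> exists b : R, rdiff QQ x t b (SS x t - nm (gg1 (x +i* t)) ^+ 2).
Proof.
move=> x0; have U := cdiff_rdiff_Re (cdiff_gg t x0); have V := cdiff_rdiff_Im (cdiff_gg t x0).
have U1 := cdiff_rdiff_Re (cdiff_gg1 t x0); have V1 := cdiff_rdiff_Im (cdiff_gg1 t x0).
eexists; apply: (eq_rdiff _ erefl _ (rdiffB (rdiffM U V1) (rdiffM V U1))).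
- by move=> y s; rewrite /QQ; move: (gg _) (gg1 _) => [a b] [c d] /=; ring.
- by rewrite nm_sqr /SS; move: (gg _) (gg1 _) (gg2 _) => [a b] [c d] [a' b'] /=; ring.
Qed.

Lemma rdiff_Wx x t : x < 0 -> exists b, rdiff Wx x t (Wxx x t) b.
Proof.
move=> x0; have [b hP] := rdiff_PP t x0; have n0 : nn x t != 0 by rewrite gt_eqF// nn_gt0.
have N := rdiffV (rdiff_nn t x0) n0.
eexists; apply: (eq_rdiff _ _ erefl (rdiffB (rdiff_kk t x0) (rdiffZ 2 (rdiffM hP N)))) => //.
by rewrite /Wxx; field.
Qed.

Lemma rdiff_Wt x t : x < 0 -> exists b : R, rdiff Wt x t b (Wtt x t).
Proof.
move=> x0; have [b hQ] := rdiff_QQ t x0; have n0 : nn x t != 0 by rewrite gt_eqF// nn_gt0.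
have N := rdiffV (rdiff_nn t x0) n0.
eexists; apply: (eq_rdiff _ erefl _ (rdiffZ 2 (rdiffM hQ N))) => //.
by rewrite /Wtt; field.
Qed.

Lemma PPQQ x t : PP x t ^+ 2 + QQ x t ^+ 2 = (1 - nn x t) * nm (gg1 (x +i* t)) ^+ 2.
Proof. by rewrite /nn subKr /PP /QQ !nm_sqr; move: (gg _) (gg1 _) => [a b] [c d] /=; ring. Qed.

(** The terms [SS], with the second derivative, cancel between [Wxx] and [Wtt]; by [PPQQ] the rest
    combines into the pulled-back hyperbolic density. *)
Lemma LaplacianE x t : x < 0 -> Wxx x t + Wtt x t = kk1 x - 4 * (nm (gg1 (x +i* t)) / nn x t) ^+ 2.
Proof.
move=> x0; have n0 : nn x t != 0 by rewrite gt_eqF// nn_gt0.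
have -> : Wxx x t + Wtt x t = kk1 x - 4 * nm (gg1 (x +i* t)) ^+ 2 / nn x t - 4 * (PP x t ^+ 2 + QQ x t ^+ 2) / nn x t ^+ 2.
  by rewrite /Wxx /Wtt; field.
by rewrite PPQQ; field.
Qed.

Definition polar_density x t : R := kk x * distortion_at (cexp (x +i* t)).

Lemma gg1E x t : x < 0 -> 2 * (nm (gg1 (x +i* t)) / nn x t) = kk x * (1 - distortion_at (cexp (x +i* t))).
Proof.
move=> x0; have := kk_den x0; have := nn_gt0 t x0.
rewrite /distortion_at subKr /gg1 nmM !nm_cexp /= -/(gg (x +i* t)) -/(nn x t) /kk => n0 d0.
by field; rewrite !lt0r_neq0.
Qed.

Lemma distortion_at_cexp01 x t : x < 0 -> 0 <= distortion_at (cexp (x +i* t)) <= 1.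
Proof.
move=> x0; have z := cexp_lt1 t x0.
by rewrite (distortion_at_ge0 hf fD z) (distortion_at_le1 f1 fD z).
Qed.

(** The gradient of W is (k, 0) plus the gradient of log (1 - |g|^2), and the latter has length 2
    |g| |g'| / (1 - |g|^2) <= k by Schwarz-Pick. Expanding the square gives the claim. *)
Lemma gradient_le x t : x < 0 -> Wx x t ^+ 2 + Wt x t ^+ 2 <= 2 * kk x * Wx x t.
Proof.
move=> x0; have n0 := nn_gt0 t x0; have k0 := kk_gt0 x0; have /andP[m0 m1] := distortion_at_cexp01 t x0.
have e := gg1E t x0.
set M := nm (gg1 (x +i* t)) / nn x t in e.
have E : (PP x t / nn x t) ^+ 2 + (QQ x t / nn x t) ^+ 2 = (1 - nn x t) * M ^+ 2.
  by rewrite /M !expr_div_n -mulrDl PPQQ -mulrA.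
have M0 : 0 <= M by rewrite /M divr_ge0 ?nm_ge0// ltW.
have M2 : 2 * M <= kk x by rewrite e; nra.
have nn1 : 0 <= nn x t by exact: ltW.
have : (2 * (PP x t / nn x t)) ^+ 2 + (2 * (QQ x t / nn x t)) ^+ 2 <= kk x ^+ 2.
  have -> : (2 * (PP x t / nn x t)) ^+ 2 + (2 * (QQ x t / nn x t)) ^+ 2 = 4 * ((1 - nn x t) * M ^+ 2).
    by rewrite -E; ring.
  have := sqr_ge0 M; nra.
rewrite /Wx /Wt; set a := 2 * _; set b := 2 * _; move=> H; nra.
Qed.

Lemma polar_density_le_Wx x t : x < 0 -> polar_density x t <= Wx x t.
Proof.
move=> x0; have n0 := nn_gt0 t x0.
have e := gg1E t x0.
have : PP x t / nn x t <= nm (gg1 (x +i* t)) / nn x t.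
  rewrite ler_pM2r ?invr_gt0//; apply: (le_trans (ler_norm _)); apply: (le_trans (re_le_nm _)).
  by rewrite nmM nm_conj ler_piMl ?nm_ge0// ltW// gg_lt1.
rewrite /polar_density /Wx; lra.
Qed.

Lemma polar_density_ge0 x t : x < 0 -> 0 <= polar_density x t.
Proof. by move=> x0; rewrite mulr_ge0 ?(ltW (kk_gt0 x0))//; have /andP[] := distortion_at_cexp01 t x0. Qed.

(** With m the distortion, k^2 (1 - (1 - m)^2) <= 2 k (k m), and -x k <= 1 absorbs the spare factor
    k. The condition -1 <= x bounds the remaining part of [kk1]. *)
Lemma Laplacian_le x t : -1 <= x < 0 -> - x * (Wxx x t + Wtt x t) <= 2 * polar_density x t + 2.
Proof.
move=> /andP[x1 x0]; rewrite LaplacianE// /kk1 /polar_density.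
have := kk_bound x0; have := kk_gt0 x0; have /andP[m0 m1] := distortion_at_cexp01 t x0; have := gg1E t x0.
set M := nm (gg1 (x +i* t)) / nn x t; set k := kk x; set m := distortion_at _ in m0 m1 *; move=> e k0 kb.
have -> : 4 * M ^+ 2 = k ^+ 2 * (1 - m) ^+ 2 by rewrite -exprMn -e; ring.
have q : 2 * expR x / (1 + expR x) ^+ 2 <= 2.
  have /andP[e0 e1] := expR_itv01 x0; rewrite ler_pdivrMr; last by rewrite exprn_gt0//; lra.
  nra.
have q0 : 0 <= 2 * expR x / (1 + expR x) ^+ 2.
  by rewrite divr_ge0 ?sqr_ge0// mulr_ge0// expR_ge0.
set Q := 2 * expR x / _ in q q0 *.
have -> : - x * (k ^+ 2 + Q - k ^+ 2 * (1 - m) ^+ 2) = (- x * k) * (k * (1 - (1 - m) ^+ 2)) + - x * Q by ring.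
have a1 : - x * Q <= 2 by nra.
have a2 : k * (1 - (1 - m) ^+ 2) <= 2 * (k * m) by nra.
have a3 : 0 <= k * (1 - (1 - m) ^+ 2) by rewrite mulr_ge0 ?(ltW k0)//; nra.
have a4 : - x * k * (k * (1 - (1 - m) ^+ 2)) <= 1 * (k * (1 - (1 - m) ^+ 2)) by rewrite ler_wpM2r.
lra.
Qed.
End green.

Section rc. Variables (R : realType) (T : topologicalType) (u v : T -> R) (x : T).
Hypotheses (cu : {for x, continuous u}) (cv : {for x, continuous v}).
Lemma rcM : {for x, continuous (fun y => u y * v y)}.
Proof. exact: (@cvgM R _ _ _ u v _ _ cu cv). Qed.
Lemma rcB : {for x, continuous (fun y => u y - v y)}.
Proof. exact: (@cvgB _ _ _ _ _ u v _ _ cu cv). Qed.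
Lemma rcD : {for x, continuous (fun y => u y + v y)}.
Proof. exact: (@cvgD _ _ _ _ _ u v _ _ cu cv). Qed.
Lemma rcV : u x != 0 -> {for x, continuous (fun y => (u y)^-1)}.
Proof. by move=> ux; exact: (@cvgV R _ _ _ u _ ux cu). Qed.
Lemma rc_comp (h : R -> R) : {for u x, continuous h} -> {for x, continuous (fun y => h (u y))}.
Proof. by move=> ch; exact: (@continuous_comp _ _ _ u h x cu ch). Qed.
End rc.
Lemma rc_cst (R : realType) (T : topologicalType) (c : R) (x : T) : {for x, continuous (fun=> c)}.
Proof. exact: cst_continuous. Qed.
Lemma rc_sqr (R : realType) (x : R) : {for x, continuous (fun y : R => y ^+ 2)}.
Proof. exact: exprn_continuous. Qed.

(** * The distortion accumulated along a radius *)

Section distortion_along_radius. Variable R : realType.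
Implicit Types (z w d a c xi : R[i]) (rho t x y r s : R).
Local Notation nm := (@modulus R).
Variables (f f1 f2 : R[i] -> R[i]).
Hypothesis hf : forall z, nm z < 1 -> cdiff f z (f1 z).
Hypothesis hf1 : forall z, nm z < 1 -> cdiff f1 z (f2 z).
Hypothesis fD : forall z, nm z < 1 -> nm (f z) < 1.
Local Notation log_gap := (log_gap f).
Local Notation distortion_at := (distortion_at f f1).

Lemma cont_nm_comp (g : R[i] -> R[i]) z : {for z, continuous (g : R[i]^o -> R[i]^o)} ->
  {for z, continuous (fun w : R[i]^o => nm (g w))}.
Proof. by move=> cg; apply: (@continuous_comp _ _ _ (g : R[i]^o -> R[i]^o) (nm : R[i]^o -> R) z cg); exact: continuous_modulus. Qed.

Lemma cont_distortion_at z : nm z < 1 -> {for z, continuous (distortion_at : R[i]^o -> R)}.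
Proof.
move=> z1.
have c0 := @rc_comp R R[i]^o (nm : R[i]^o -> R) z (@continuous_modulus R z) _ (@rc_sqr R (nm z)).
have c1 := cont_nm_comp (cdiff_cont (hf1 z1)).
have c2 := @rc_comp R R[i]^o _ z (cont_nm_comp (cdiff_cont (hf z1))) _ (@rc_sqr R (nm (f z))).
have c := @rc_cst R R[i]^o 1 z.
have n0 : 1 - nm (f z) ^+ 2 != 0 by rewrite gt_eqF// one_sub_sqr_gt0// fD.
exact: (rcB c (rcM (rcM (rcB c c0) c1) (rcV (rcB c c2) n0))).
Qed.

Definition distortion_rate r xi : R := distortion_at (r%:C * xi) * (2 / (1 - r ^+ 2)).
Definition partial_distortion rho xi : R := itv_int 0 rho (distortion_rate^~ xi).

Lemma cont_dens2 r xi : nm (r%:C * xi) < 1 -> -1 < r < 1 ->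
  {for ((r, xi) : R * R[i]^o), continuous (fun u : R * R[i]^o => distortion_rate u.1 u.2)}.
Proof.
move=> rx r1.
have c1 : (fun u : R * R[i]^o => u.1) @ ((r, xi) : R * R[i]^o) --> r by exact: cvg_fst.
have c2 : (fun u : R * R[i]^o => u.2) @ ((r, xi) : R * R[i]^o) --> (xi : R[i]^o) by exact: cvg_snd.
have c3 : (fun u : R * R[i]^o => u.1%:C : R[i]^o) @ ((r, xi) : R * R[i]^o) --> (r%:C : R[i]^o).
  by apply: cvg_complex => //=; exact: cvg_cst.
have FF : Filter (nbhs ((r, xi) : R * R[i]^o)) by exact: filter_filter.
have c4 := @cvgM R[i] _ _ FF (fun u : R * R[i]^o => u.1%:C : R[i]^o) (fun u : R * R[i]^o => u.2) _ _ c3 c2.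
have c5 : {for ((r, xi) : R * R[i]^o), continuous (fun u : R * R[i]^o => distortion_at (u.1%:C * u.2))}.
  exact: (@continuous_comp _ _ _ (fun u : R * R[i]^o => u.1%:C * u.2 : R[i]^o) (distortion_at : R[i]^o -> R) (r, xi) c4 (cont_distortion_at rx)).
have c6 := @rc_comp R (R * R[i]^o)%type (fun u => u.1) (r, xi) c1 _ (@rc_sqr R r).
have n0 : 1 - r ^+ 2 != 0 by rewrite gt_eqF//; exact: sqr_lt1.
exact: (rcM c5 (rcM (@rc_cst R _ 2 _) (rcV (rcB (@rc_cst R _ 1 _) c6) n0))).
Qed.

Lemma cont_distortion_rate r xi : nm (r%:C * xi) < 1 -> -1 < r < 1 -> {for r, continuous (distortion_rate^~ xi)}.
Proof.
move=> rx r1; apply: (@continuous_comp _ _ _ (fun r : R => (r, xi) : R * R[i]^o) (fun u : R * R[i]^o => distortion_rate u.1 u.2)).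
  by apply: (@cvg_pair R R R[i]^o (nbhs r) (nbhs r) (nbhs (xi : R[i]^o)) _ _ _ id (fun=> xi)); [exact: cvg_id|exact: cvg_cst].
exact: cont_dens2.
Qed.

Lemma distortion_rate_dom rho xi r : rho < 1 -> rho * nm xi < 1 -> 0 <= r <= rho ->
  nm (r%:C * xi) < 1 /\ -1 < r < 1.
Proof.
move=> r1 rx /andP[h1 h2]; split; last by slra.
by rewrite nmM nm_real ger0_norm//; apply: le_lt_trans rx; rewrite ler_wpM2r ?nm_ge0.
Qed.

Lemma itv_intble_distortion_rate (a b rho : R) xi : rho < 1 -> rho * nm xi < 1 -> 0 <= a -> b <= rho -> itv_intble a b (distortion_rate^~ xi).
Proof.
move=> r1 rx a0 br; apply: itv_intble_cont_at => r /andP[h1 h2].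
have rr : 0 <= r <= rho by slra.
have [n1 n2] := distortion_rate_dom r1 rx rr.
exact: cont_distortion_rate.
Qed.

Lemma nbhs_modulus (z : R[i]^o) (A : set R[i]^o) : nbhs z A ->
  exists2 d : R, 0 < d & forall w, nm (w - z) < d -> A w.
Proof.
move=> -[[d d'] /=]; rewrite ltcE/= => /andP[/eqP -> {}d'0] hd; exists d => // w hw.
by apply: hd; rewrite /ball_ /= normE -[_ +i* 0]/(d%:C) ltcR nmB.
Qed.

(** Uniformity in r over the compact segment, by the covering form of compactness. Continuity is
    taken in the plane, as Borel measurability on the circle will need it, so [xi] may leave the
    circle as long as the segment stays in the disc. *)
Lemma partial_distortion_cont rho xi : 0 <= rho < 1 -> rho * nm xi < 1 -> {for xi, continuous (partial_distortion rho : R[i]^o -> R)}.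
Proof.
move=> /andP[r0 r1] rx; apply/crcontP => e e0.
have e2 : 0 < e / 2 by rewrite divr_gt0.
have e4 : 0 < e / 2 / 2 by rewrite divr_gt0.
have /compact_near_coveringP/(_ R[i]^o (nbhs (xi : R[i]^o)) (fun xi' r => `|distortion_rate r xi - distortion_rate r xi'| < e / 2)) := @segment_compact R 0 rho.
have FF : Filter (nbhs (xi : R[i]^o)) by exact: filter_filter.
move=> /(_ FF) cov.
have /cov/nbhs_modulus[d d0 hd] : forall r : R, `[0, rho]%classic r ->
    \forall r' \near r & xi' \near nbhs (xi : R[i]^o), `|distortion_rate r' xi - distortion_rate r' xi'| < e / 2.
  move=> r; rewrite /= in_itv/= => rr; have [n1 n2] := distortion_rate_dom r1 rx rr.
  have /cvgrPdist_lt/(_ _ e4) h1 := cont_dens2 n1 n2.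
  have c1 : {for ((r, xi) : R * R[i]^o), continuous (fun u : R * R[i]^o => distortion_rate u.1 xi)}.
    apply: (@continuous_comp _ _ _ (fun u : R * R[i]^o => u.1) (distortion_rate^~ xi)); first exact: cvg_fst.
    exact: cont_distortion_rate.
  move/cvgrPdist_lt : c1 => /(_ _ e4) h2.
  apply: filterS2 h1 h2 => -[r' xi'] /= h1 h2.
  have -> : distortion_rate r' xi - distortion_rate r' xi' = (distortion_rate r xi - distortion_rate r' xi') - (distortion_rate r xi - distortion_rate r' xi) by ring.
  by rewrite (le_lt_trans (ler_normB _ _))// [ltRHS]splitr ltrD.
(* The second bound keeps the segment up to [rho] times [w] inside the disc. *)
pose d' := Num.min d ((1 - rho * nm xi)).
exists d'; first by rewrite lt_min d0 subr_gt0.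
move=> w; rewrite lt_min => /andP[w1 w2].
have rw : rho * nm w < 1.
  have h : nm w <= nm xi + nm (w - xi) by have := nmD (w - xi) xi; rewrite subrK addrC.
  have h2 : rho * nm w <= rho * nm xi + rho * nm (w - xi) by rewrite -mulrDr ler_wpM2l.
  have := nm_ge0 (w - xi); nra.
have i1 := itv_intble_distortion_rate r1 rw (lexx 0) (lexx rho).
have i2 := itv_intble_distortion_rate r1 rx (lexx 0) (lexx rho).
have hr r : 0 <= r <= rho -> `|distortion_rate r xi - distortion_rate r w| < e / 2.
  by move=> rr; apply: hd => //; rewrite /= in_itv.
rewrite /partial_distortion.
have b1 : itv_int 0 rho (fun r => distortion_rate r w - distortion_rate r xi) <= e / 2 * (rho - 0).
  apply: itv_int_le => //; first exact: itv_intbleB.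
  by move=> r /hr; rewrite ltr_norml => /andP[? ?]; lra.
have b2 : itv_int 0 rho (fun r => distortion_rate r xi - distortion_rate r w) <= e / 2 * (rho - 0).
  apply: itv_int_le => //; first exact: itv_intbleB.
  by move=> r /hr; rewrite ltr_norml => /andP[? ?]; lra.
move: b2; rewrite itv_intB// => b2; move: b1; rewrite itv_intB// => b1.
have : e / 2 * (rho - 0) < e by nra.
rewrite ltr_norml => b3; apply/andP; split; lra.
Qed.

Lemma distortion_rate_le_deriv r xi : nm xi = 1 -> -1 < r < 1 -> distortion_rate r xi <= 2 / (1 - r ^+ 2) * radial_defect f f1 r xi.
Proof.
move=> x1 r1; rewrite /distortion_rate mulrC ler_pM2l ?divr_gt0 ?sqr_lt1//.
exact: distortion_at_le_radial_defect.
Qed.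

Lemma distortion_rate_ge0 r xi : nm xi = 1 -> 0 <= r < 1 -> 0 <= distortion_rate r xi.
Proof.
move=> x1 /andP[r0 r1]; have r1' : -1 < r < 1 by slra.
rewrite mulr_ge0//; last by rewrite divr_ge0// ltW// sqr_lt1.
by apply: (distortion_at_ge0 hf fD); exact: rxi_lt1.
Qed.

Lemma cont_radial_defect r xi : nm xi = 1 -> 0 <= r < 1 -> {for r, continuous ((radial_defect f f1)^~ xi)}.
Proof. by move=> x1 r1; have [d hd _] := radial_defect_slope hf hf1 fD x1 r1; exact: derive_cont hd. Qed.

Lemma partial_distortion_le_log_gap rho xi : nm xi = 1 -> 0 < rho < 1 -> partial_distortion rho xi <= log_gap rho xi - log_gap 0 xi.
Proof.
move=> x1 /andP[r0 r1].
have cdiff' r : 0 <= r <= rho -> {for r, continuous (fun r => 2 / (1 - r ^+ 2) * radial_defect f f1 r xi)}.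
  move=> /andP[h1 h2]; have n0 : 1 - r ^+ 2 != 0 by rewrite gt_eqF// sqr_lt1//; slra.
  apply: (rcM (rcM (@rc_cst R R 2 r) (rcV (rcB (@rc_cst R R 1 r) (@rc_sqr R r)) n0)) (cont_radial_defect x1 _)); slra.
have dv r : 0 <= r <= rho -> is_derive r (1 : R) (log_gap^~ xi) (2 / (1 - r ^+ 2) * radial_defect f f1 r xi).
  by move=> /andP[h1 h2]; apply: (log_gap_derive hf fD x1); slra.
have cw : {within `[0, rho], continuous (fun r => 2 / (1 - r ^+ 2) * radial_defect f f1 r xi)}.
  by apply/continuous_in_subspaceT => r; rewrite inE/= in_itv/=; exact: cdiff'.
rewrite -(itv_int_FTC r0 dv cw); apply: itv_int_leM.
- by apply: (@itv_intble_distortion_rate 0 rho rho xi) => //; rewrite x1 mulr1.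
- by apply: itv_intble_cont_at.
- by move=> r /andP[h1 h2]; apply: distortion_rate_le_deriv => //; slra.
Qed.

Lemma partial_distortion_ge0 rho xi : nm xi = 1 -> 0 <= rho < 1 -> 0 <= partial_distortion rho xi.
Proof.
move=> x1 /andP[r0 r1]; apply: Rintegral_ge0 => r; rewrite /= in_itv/= => /andP[h1 h2].
by apply: distortion_rate_ge0 => //; slra.
Qed.

Lemma partial_distortionB r s xi : nm xi = 1 -> 0 <= r -> r <= s -> s < 1 ->
  partial_distortion s xi - partial_distortion r xi = itv_int r s (distortion_rate^~ xi).
Proof.
move=> x1 r0 rs s1; rewrite /partial_distortion (@itv_int_split R 0 s r)//; first by rewrite addrAC subrr add0r.
by apply: (@itv_intble_distortion_rate 0 s s xi) => //; rewrite x1 mulr1.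
Qed.

Lemma polar_densityE y t : y < 0 -> polar_density f f1 y t = expR y * distortion_rate (expR y) (ei t).
Proof. by move=> y0; rewrite /polar_density /distortion_rate /kk -/(cexp (y +i* t)) /cexp /=; ring. Qed.

(** Since dr = r dx, a lower bound c in x is c / r in r, and its integral c log r is explicit; this
    avoids a change of variables. *)
Lemma partial_distortion_incr (y1 y2 t c : R) : y1 <= y2 -> y2 < 0 ->
  (forall y, y1 <= y <= y2 -> c <= polar_density f f1 y t) ->
  c * (y2 - y1) <= partial_distortion (expR y2) (ei t) - partial_distortion (expR y1) (ei t).
Proof.
move=> y12 y20 hc.
have [->|ne] := eqVneq y1 y2; first by rewrite !subrr mulr0.
have lt12 : y1 < y2 by rewrite lt_neqAle ne.
have e1 := nm_ei t; have /andP[p2 l2] := expR_itv01 y20; have p1 := expR_gt0 y1.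
have e12 : expR y1 < expR y2 by rewrite ltr_expR.
rewrite (partial_distortionB e1 (ltW p1) (ltW e12) l2).
have dl (r : R) : expR y1 <= r <= expR y2 -> is_derive r (1 : R) (fun r => c * ln r) (c * r^-1).
  move=> /andP[h1 h2]; have r0 : 0 < r by lra.
  have H := rdiff_dx (rdiffZ c (rdiff_comp (rdiff_fst r 0) (is_derive1_ln r0))).
  by apply: (@is_derive_eq _ _ _ _ _ _ _ _ H); rewrite mulr1.
have cl (r : R) : expR y1 <= r <= expR y2 -> {for r, continuous (fun r => c * r^-1)}.
  move=> /andP[h1 h2]; have r0 : r != 0 by rewrite gt_eqF//; lra.
  exact: (rcM (@rc_cst R R c r) (@rcV R R id r cvg_id r0)).
have cw : {within `[expR y1, expR y2], continuous (fun r => c * r^-1)}.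
  by apply/continuous_in_subspaceT => r; rewrite inE/= in_itv/=; exact: cl.
have := itv_int_FTC e12 dl cw; rewrite !expRK -mulrBr => <-.
apply: itv_int_leM.
- by apply: itv_intble_cont_at.
- by apply: (@itv_intble_distortion_rate _ _ (expR y2)) => //; rewrite ?e1 ?mulr1// ltW.
- move=> r /andP[h1 h2]; have r0 : 0 < r by lra.
  have E : r = expR (ln r) by rewrite lnK.
  have lr : y1 <= ln r <= y2 by rewrite -[y1]expRK -[y2]expRK !ler_ln ?posrE ?expR_gt0// h1 h2.
  have := hc (ln r) lr; rewrite polar_densityE; last by move/andP : lr => [_ ?]; lra.
  by rewrite -E ler_pdivrMr// [X in _ -> _ <= X]mulrC.
Qed.

Lemma polar_gap_ge_partial_distortion x t : x < 0 -> 1 + partial_distortion (expR x) (ei t) <= polar_gap f x t.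
Proof.
move=> x0; have /andP[e0 e1] := expR_itv01 x0.
have := @partial_distortion_le_log_gap (expR x) (ei t) (nm_ei t); rewrite e0 e1 => /(_ isT).
have -> : log_gap 0 (ei t) = log_gap 0 1 by rewrite /log_gap !mul0r.
rewrite /polar_gap; lra.
Qed.

Lemma cont_polar_density x t : x < 0 -> {for ((x, t) : R * R), continuous (fun u : R * R => polar_density f f1 u.1 u.2)}.
Proof.
move=> x0; have H : {for ((x, t) : R * R), continuous (fun u : R * R => distortion_at (cexp (u.1 +i* u.2)))}.
  have c1 : {for ((x, t) : R * R), continuous (fun u : R * R => cexp (u.1 +i* u.2) : R[i]^o)}.
    apply: (@continuous_comp _ _ _ (fun u : R * R => u.1 +i* u.2 : R[i]^o) (@cexp R : R[i]^o -> R[i]^o)).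
      exact: cont_pair.
    exact: cdiff_cont (cdiff_cexp _).
  exact: (@continuous_comp _ _ _ (fun u : R * R => cexp (u.1 +i* u.2) : R[i]^o) (distortion_at : R[i]^o -> R) (x, t) c1 (cont_distortion_at (cexp_lt1 t x0))).
exact: (rcM (rdiff_cont (rdiff_kk t x0)) H).
Qed.
End distortion_along_radius.

(** * Green's formula for powers of the gap *)

Section meanest. Variable R : realType.
Implicit Types (z w d a c xi : R[i]) (rho t x y r s : R).
Local Notation nm := (@modulus R).
Local Notation twopi := (2 * pi : R).

Lemma increment_xD (F G : R -> R -> R) x t (c1 c2 e : R) : increment_x F x t c1 (e / 2) -> increment_x G x t c2 (e / 2) ->
  increment_x (fun y s => F y s + G y s) x t (c1 + c2) e.
Proof.
move=> [d1 d10 h1] [d2 d20 h2]; exists (Num.min d1 d2); first by rewrite lt_min d10.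
move=> y1 y2 s a b; rewrite !lt_min => /andP[e1 e2] /andP[e3 e4].
by have := h1 y1 y2 s a b e1 e3; have := h2 y1 y2 s a b e2 e4; lra.
Qed.

Variables (f f1 f2 : R[i] -> R[i]).
Hypothesis hf : forall z, nm z < 1 -> cdiff f z (f1 z).
Hypothesis hf1 : forall z, nm z < 1 -> cdiff f1 z (f2 z).
Hypothesis fD : forall z, nm z < 1 -> nm (f z) < 1.
Local Notation W := (polar_gap f).
Local Notation Wx := (Wx f f1).
Local Notation Wt := (Wt f f1).
Local Notation polar_density := (polar_density f f1).
Definition polar_distortion x t : R := partial_distortion f f1 (expR x) (ei t).
Variable p : R.
Hypothesis p0 : 0 < p.

Definition Phi (w : R) : R := w `^ p.
Definition Phi1 (w : R) : R := p * w `^ (p - 1).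
Definition Phi2 (w : R) : R := p * ((p - 1) * w `^ (p - 1 - 1)).

Lemma polar_distortion_ge0 x t : x < 0 -> 0 <= polar_distortion x t.
Proof.
by move=> x0; have /andP[e0 e1] := expR_itv01 x0; apply: (partial_distortion_ge0 hf fD (nm_ei t)); rewrite (ltW e0).
Qed.

Lemma W_ge_polar_distortion x t : x < 0 -> 1 + polar_distortion x t <= W x t.
Proof. by move=> x0; exact: (polar_gap_ge_partial_distortion hf hf1 fD). Qed.

Lemma W_ge1 x t : x < 0 -> 1 <= W x t.
Proof. by move=> x0; have := W_ge_polar_distortion t x0; have := polar_distortion_ge0 t x0; lra. Qed.

Lemma W_gt0 x t : x < 0 -> 0 < W x t.
Proof. by move=> x0; have := W_ge1 t x0; lra. Qed.

Lemma W_nondecreasing x y t : x <= y -> y < 0 -> W x t <= W y t.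
Proof.
move=> xy y0; rewrite lerD2r; have /andP[_ e1] := expR_itv01 y0.
apply: (log_gap_nondecreasing hf fD (nm_ei t)) => //; last by rewrite ler_expR.
by have := expR_gt0 x; lra.
Qed.

Lemma Phi1_ge0 (w : R) : 0 <= Phi1 w.
Proof. by rewrite mulr_ge0 ?powR_ge0// ltW. Qed.

Lemma rdiff_Phi x t : x < 0 -> rdiff (fun y s => Phi (W y s)) x t (Phi1 (W x t) * Wx x t) (Phi1 (W x t) * Wt x t).
Proof.
move=> x0; have w0 := W_gt0 t x0.
exact: rdiff_comp (rdiff_polar_gap hf fD t x0) (is_derive1_powR p w0).
Qed.

Lemma rdiff_Phi1 x t : x < 0 -> rdiff (fun y s => Phi1 (W y s)) x t (Phi2 (W x t) * Wx x t) (Phi2 (W x t) * Wt x t).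
Proof.
move=> x0; have w0 := W_gt0 t x0.
have := rdiffZ p (rdiff_comp (rdiff_polar_gap hf fD t x0) (is_derive1_powR (p - 1) w0)).
by apply: eq_rdiff => // ; rewrite /Phi2; ring.
Qed.

(* Differentiating the mean of [JJ] in [x] leaves [- x] times that of the Laplacian
   of [Phi W], with no boundary term at [x = 0]. *)
Definition JJ x t : R := Phi (W x t) - x * (Phi1 (W x t) * Wx x t).
(** The other component of the Stokes field: the x-derivative of [JJ] minus the t-derivative of [SP]
    is -x times the Laplacian of Phi(W). *)
Definition SP x t : R := x * (Phi1 (W x t) * Wt x t).

Lemma rdiff_JJ x t : x < 0 -> exists b, rdiff JJ x t
  (- x * (Phi2 (W x t) * Wx x t ^+ 2 + Phi1 (W x t) * Wxx f f1 f2 x t)) b.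
Proof.
move=> x0; have [b hW] := rdiff_Wx hf hf1 fD t x0.
eexists; apply: (eq_rdiff _ _ erefl (rdiffB (rdiff_Phi t x0) (rdiffM (rdiff_fst x t) (rdiffM (rdiff_Phi1 t x0) hW)))) => //.
ring.
Qed.

Lemma rdiff_SP x t : x < 0 -> exists a : R, rdiff SP x t a
  (x * (Phi2 (W x t) * Wt x t ^+ 2 + Phi1 (W x t) * Wtt f f1 f2 x t)).
Proof.
move=> x0; have [b hW] := rdiff_Wt hf hf1 fD t x0.
eexists; apply: (eq_rdiff _ erefl _ (rdiffM (rdiff_fst x t) (rdiffM (rdiff_Phi1 t x0) hW))) => //.
ring.
Qed.

(** An upper bound for that divergence, of which the comparison functions below are primitives; the
    maximum discards the gradient term when Phi is concave. *)
Definition TT x t : R := 2 * Num.max (Phi2 (W x t)) 0 * Wx x t + Phi1 (W x t) * (2 * polar_density x t + 2).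

Lemma divergence_le_TT x t : -1 <= x < 0 ->
  - x * (Phi2 (W x t) * Wx x t ^+ 2 + Phi1 (W x t) * Wxx f f1 f2 x t) -
  x * (Phi2 (W x t) * Wt x t ^+ 2 + Phi1 (W x t) * Wtt f f1 f2 x t) <= TT x t.
Proof.
move=> x10; have /andP[x1 x0] := x10.
have g := gradient_le hf fD t x0; have k0 := kk_gt0 x0; have kb := kk_bound x0.
have l := Laplacian_le f2 hf fD t x10.
have wx : 0 <= Wx x t by apply: le_trans (polar_density_le_Wx f1 fD t x0); exact: (polar_density_ge0 hf fD t x0).
have P1 := Phi1_ge0 (W x t).
rewrite /TT; set m := Num.max _ _.
have m0 : 0 <= m by rewrite le_max lexx orbT.
have mP : Phi2 (W x t) <= m by rewrite le_max lexx.
have -> : - x * (Phi2 (W x t) * Wx x t ^+ 2 + Phi1 (W x t) * Wxx f f1 f2 x t) -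
  x * (Phi2 (W x t) * Wt x t ^+ 2 + Phi1 (W x t) * Wtt f f1 f2 x t) =
  Phi2 (W x t) * (- x * (Wx x t ^+ 2 + Wt x t ^+ 2)) + Phi1 (W x t) * (- x * (Wxx f f1 f2 x t + Wtt f f1 f2 x t)).
  by ring.
apply: lerD; last by rewrite ler_wpM2l.
have gr0 : 0 <= - x * (Wx x t ^+ 2 + Wt x t ^+ 2) by rewrite mulr_ge0 ?addr_ge0 ?sqr_ge0// oppr_ge0 ltW.
have h1 : - x * (Wx x t ^+ 2 + Wt x t ^+ 2) <= 2 * Wx x t.
  have : - x * (Wx x t ^+ 2 + Wt x t ^+ 2) <= - x * (2 * kk x * Wx x t) by rewrite ler_wpM2l// oppr_ge0 ltW.
  have : - x * kk x * (2 * Wx x t) <= 1 * (2 * Wx x t) by rewrite ler_wpM2r// mulr_ge0.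
  lra.
apply: (le_trans (ler_wpM2r gr0 mP)); apply: (le_trans (ler_wpM2l m0 h1)); lra.
Qed.

Lemma SP_periodic x : SP x 0 = SP x twopi.
Proof.
have E : cexp (x +i* 0) = cexp (x +i* twopi).
  by rewrite /cexp /ei /= -[twopi]add0r mulr_natl cosD2pi sinD2pi.
have E2 : ei (0 : R) = ei twopi by rewrite /ei -[twopi]add0r mulr_natl cosD2pi sinD2pi.
by rewrite /SP /polar_gap /Wt /QQ /nn /gg /gg1 E E2.
Qed.

(** [K] is a primitive of an upper bound for [TT] only in the sense of increments in x. The mean of
    [JJ] minus [K] then does not increase from -1 to X; the sides t = 0 and t = 2 pi cancel by
    periodicity. *)
Lemma green_est (K : R -> R -> R) (X : R) : -1 < X -> X < 0 ->
  (forall x, -1 <= x <= X -> itv_intble 0 twopi (K x)) ->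
  (forall x t e, -1 <= x <= X -> 0 < e -> increment_x (fun y s => - K y s) x t (- TT x t) e) ->
  itv_int 0 twopi (JJ X) - itv_int 0 twopi (K X) <= itv_int 0 twopi (JJ (-1)) - itv_int 0 twopi (K (-1)).
Proof.
move=> X1 X0 iK hK.
have neg x : -1 <= x <= X -> x < 0 by move=> /andP[? ?]; lra.
have cJ x : -1 <= x <= X -> itv_intble 0 twopi (JJ x).
  move=> /neg x0; apply: itv_intble_cont_at => t _; have [b hJ] := rdiff_JJ t x0.
  exact: derive_cont (rdiff_dt hJ).
have := @stokes_inc R SP (fun x t => JJ x t - K x t) (-1) X 0 twopi X1 (twopi0 R).
rewrite (@eq_itv_int _ _ _ _ (fun=> 0)); last by move=> y _; rewrite SP_periodic subrr.
rewrite itv_int_cst ?mul0r ?add0r ?(ltW X1)//.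
have m1 : -1 <= (-1 : R) <= X by rewrite lexx (ltW X1).
have m2 : -1 <= X <= X by rewrite lexx (ltW X1).
have q1 := itv_intbleB (cJ _ m1) (iK _ m1); have q2 := itv_intbleB (cJ _ m2) (iK _ m2).
rewrite (itv_intB q2 q1) (itv_intB (cJ _ m2) (iK _ m2)) (itv_intB (cJ _ m1) (iK _ m1)) => H.
suff : itv_int 0 twopi (JJ X) - itv_int 0 twopi (K X) - (itv_int 0 twopi (JJ (-1)) - itv_int 0 twopi (K (-1))) <= 0 by rewrite subr_le0.
apply: H.
- move=> t _; apply: itv_intble_cont_at => x /neg x0; have [b hS] := rdiff_SP t x0.
  exact: derive_cont (rdiff_dx hS).
- by move=> x xx; apply: itv_intbleB; [exact: cJ|exact: iK].
- move=> x t e xx tt e0; have x0 := neg x xx; have e2 : 0 < e / 2 by rewrite divr_gt0.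
  have [b hJ] := rdiff_JJ t x0; have [b' hS] := rdiff_SP t x0.
  do 2 eexists; split.
  + exact: increment_xD (rdiff_increment_x hJ e2) (hK x t _ xx e2).
  + exact: rdiff_increment_t (rdiffN hS) e0.
  + have := @divergence_le_TT x t; have -> : -1 <= x < 0 by move/andP: xx => [? ?]; slra.
    move=> /(_ isT); lra.
Qed.
End meanest.

Lemma cont2_small (R : realType) (h : R * R -> R) (x t e : R) : {for (x, t), continuous h} -> 0 < e ->
  exists2 d : R, 0 < d & forall y s, `|y - x| < d -> `|s - t| < d -> `|h (y, s) - h (x, t)| < e.
Proof.
move=> /cvgrPdist_lt ch e0; have := ch _ e0 => -[[A B] /= [[r1 /= r10 hA] [r2 /= r20 hB]] AB].
exists (Num.min r1 r2); first by rewrite lt_min r10.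
move=> y s; rewrite !lt_min => /andP[y1 y2] /andP[s1 s2].
have Ay : A y by apply: hA; rewrite /= distrC.
have Bs : B s by apply: hB; rewrite /= distrC.
by have := AB (y, s) (conj Ay Bs); rewrite /= distrC.
Qed.

(** Lowering both factors of 2 ph (al + 1) by eta costs at most 2 eta (ph + al + 1) <= e, and eta <=
    1 / 2 keeps the second one nonnegative. *)
Lemma increment_arith (R : realType) (al ph eta D dA P e : R) : 0 <= al -> 0 <= ph -> 0 < eta ->
  eta <= 1 / 2 -> eta * (2 * (ph + al + 1)) <= e -> 0 <= D -> (al - eta) * D <= dA ->
  ph - eta <= P -> 0 <= P -> 2 * ph * (al + 1) * D - e * D <= 2 * P * (dA + D).
Proof.
move=> al0 ph0 eta0 eta1 eta2 D0 dA0 l1 P0.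
have c0 : 0 <= al + 1 - eta by lra.
have s1 : (al + 1 - eta) * D <= dA + D by lra.
have s0 : 0 <= (al + 1 - eta) * D by rewrite mulr_ge0.
have s2 : (ph - eta) * ((al + 1 - eta) * D) <= P * ((al + 1 - eta) * D) by rewrite ler_wpM2r.
have s3 : P * ((al + 1 - eta) * D) <= P * (dA + D) by rewrite ler_wpM2l.
have e2 : 0 <= eta ^+ 2 by rewrite sqr_ge0.
have s4 : 2 * (ph * (al + 1)) - e <= 2 * ((ph - eta) * (al + 1 - eta)) by lra.
have := ler_wpM2r D0 s4; lra.
Qed.

(** The discrete product rule for 2 P (2 + A + y). The increment of P carries the factor 2 + A2 +
    y2, which is at least 1 because y2 >= -1; this is the reason for the constant 2. *)
Lemma increment_arith_ge1 (R : realType) (c k P1 P2 A1 A2 y1 y2 e st : R) : 0 <= e -> 0 <= st -> P1 <= P2 ->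
  0 <= A2 -> -1 <= y2 ->
  - P2 - - P1 <= - c * (y2 - y1) + e / 4 * (y2 - y1 + st) ->
  k * (y2 - y1) - e / 2 * (y2 - y1) <= 2 * P1 * (A2 - A1 + (y2 - y1)) ->
  - (2 * P2 * (2 + A2 + y2)) - - (2 * P1 * (2 + A1 + y1)) <= - (2 * c + k) * (y2 - y1) + e * (y2 - y1 + st).
Proof.
move=> e0 st0 P12 A20 y20 l1 l2.
have q1 : P2 - P1 <= (P2 - P1) * (2 + A2 + y2) by rewrite ler_peMr; lra.
have est : 0 <= e * st by rewrite mulr_ge0.
lra.
Qed.

Lemma increment_arith_le1 (R : realType) (p k P B1 B2 A1 A2 y1 y2 e st : R) : 0 <= e -> 0 <= st ->
  P * (A2 - A1) <= B2 - B1 -> P * (y2 - y1) <= p * (y2 - y1) ->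
  k * (y2 - y1) - e * (y2 - y1) <= 2 * P * (A2 - A1 + (y2 - y1)) ->
  - (2 * B2 + 2 * p * y2) - - (2 * B1 + 2 * p * y1) <= - k * (y2 - y1) + e * (y2 - y1 + st).
Proof.
move=> e0 st0 h1 h2 h3.
have est : 0 <= e * st by rewrite mulr_ge0.
lra.
Qed.

(** * Inequalities for real powers *)

Section powers. Variable R : realType.
Implicit Types u v w p : R.

Lemma le0_powR_le u v (a : R) : 0 < u -> u <= v -> a <= 0 -> v `^ a <= u `^ a.
Proof.
move=> u0 uv a0; have -> : a = - (- a) by ring.
rewrite !(powRN _ (- a)) lef_pV2 ?posrE ?powR_gt0//; last exact: lt_le_trans uv.
by apply: ge0_ler_powR; rewrite ?nnegrE ?oppr_ge0// ltW// (lt_le_trans u0).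
Qed.

(** On [u, v] the derivative of the power is smallest at v. *)
Lemma powR_concave p u v : 0 < p -> p <= 1 -> 1 <= u -> u <= v ->
  p * v `^ (p - 1) * (v - u) <= v `^ p - u `^ p.
Proof.
move=> p0 p1 u1 uv; have [->|ne] := eqVneq u v; first by rewrite !subrr mulr0.
have {ne}uv : u < v by rewrite lt_neqAle ne.
have u0 : 0 < u := lt_le_trans ltr01 u1.
have dh (x : R) : u <= x <= v -> is_derive x (1 : R) (fun y : R => y `^ p) (p * x `^ (p - 1)).
  by move=> /andP[h1 h2]; apply: is_derive1_powR; exact: lt_le_trans h1.
have ch : {within `[u, v], continuous (fun y : R => y `^ p)}.
  by apply/continuous_in_subspaceT => x; rewrite inE/= in_itv/= => h; exact: derive_cont (dh x h).
have dh' (x : R) : x \in `]u, v[ -> is_derive x (1 : R) (fun y : R => y `^ p) (p * x `^ (p - 1)).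
  by rewrite in_itv/= => /andP[h1 h2]; apply: dh; rewrite !ltW.
have [x] := MVT uv dh' ch; rewrite in_itv/= => /andP[h1 h2] ->.
rewrite ler_pM2r ?subr_gt0// ler_pM2l//; apply: le0_powR_le; rewrite ?subr_le0//; last exact: ltW.
exact: lt_trans h1.
Qed.

Lemma Phi1_le p u v : 1 <= p -> 0 <= u -> u <= v -> Phi1 p u <= Phi1 p v.
Proof.
move=> p1 u0 uv; rewrite ler_pM2l ?(lt_le_trans ltr01)//.
by apply: ge0_ler_powR; rewrite ?nnegrE ?subr_ge0// (le_trans u0).
Qed.

Lemma Phi1_le_powR p u w : 0 < p -> p <= 1 -> 0 < u -> u <= w -> Phi1 p w <= p * u `^ (p - 1).
Proof. by move=> p0 p1 u0 uw; rewrite ler_pM2l//; apply: le0_powR_le; rewrite ?subr_le0. Qed.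

Lemma Phi1_le_p p w : 0 < p -> p <= 1 -> 1 <= w -> Phi1 p w <= p.
Proof. by move=> p0 p1 w1; have := Phi1_le_powR p0 p1 ltr01 w1; rewrite powR1 mulr1. Qed.

(** With 4 p b <= w the first term on the right suffices, and otherwise w < 4 p b makes the second
    suffice. This treats p = 1 together with p > 1, without a conjugate exponent. *)
Lemma young p w (b : R) : 1 <= p -> 1 <= w -> 0 <= b -> 2 * Phi1 p w * b <= w `^ p / 2 + (4 * p) `^ p / 2 * b `^ p.
Proof.
move=> p1 w1 b0; have p0 : 0 < p := lt_le_trans ltr01 p1; have w0 : 0 <= w by lra.
have E := mulr_powRB1 w0 p0; have P0 : 0 <= w `^ (p - 1) := powR_ge0 _ _.
rewrite /Phi1; case: (leP (4 * p * b) w) => h.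
  have : 2 * (p * w `^ (p - 1)) * b <= w `^ p / 2.
    rewrite -E.
    have := ler_wpM2r P0 h; lra.
  have : 0 <= (4 * p) `^ p / 2 * b `^ p by rewrite mulr_ge0 ?divr_ge0 ?powR_ge0.
  lra.
have q0 : 0 <= 4 * p * b by lra.
have : w `^ (p - 1) <= (4 * p * b) `^ (p - 1).
  by apply: ge0_ler_powR; rewrite ?nnegrE ?subr_ge0// ltW.
move=> /(ler_wpM2r q0); rewrite [X in _ <= X]mulrC (mulr_powRB1 q0 p0) powRM//; last by rewrite mulr_ge0// ltW.
have := powR_ge0 w p; lra.
Qed.

End powers.

(** * The mean estimate for p >= 1 and for p <= 1 *)

Section cases. Variable R : realType.
Implicit Types (z w d a c xi : R[i]) (rho t x y r s : R).
Local Notation nm := (@modulus R).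
Local Notation twopi := (2 * pi : R).
Variables (f f1 f2 : R[i] -> R[i]).
Hypothesis hf : forall z, nm z < 1 -> cdiff f z (f1 z).
Hypothesis hf1 : forall z, nm z < 1 -> cdiff f1 z (f2 z).
Hypothesis fD : forall z, nm z < 1 -> nm (f z) < 1.
Local Notation W := (polar_gap f).
Local Notation Wx := (Wx f f1).
Local Notation polar_density := (polar_density f f1).
Local Notation polar_distortion := (polar_distortion f f1).
Variable p : R.
Hypothesis p0 : 0 < p.
Local Notation Phi := (Phi p).
Local Notation Phi1 := (Phi1 p).
Local Notation Phi2 := (Phi2 p).
Local Notation TT := (TT f f1 p).
Local Notation JJ := (JJ f f1 p).

Lemma polar_distortion_nondecreasing (y1 y2 t : R) : y1 <= y2 -> y2 < 0 -> polar_distortion y1 t <= polar_distortion y2 t.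
Proof.
move=> y12 y20; rewrite -subr_ge0 -(mul0r (y2 - y1)).
by apply: (partial_distortion_incr hf hf1 fD) => // y /andP[h1 h2]; apply: (polar_density_ge0 hf fD); lra.
Qed.

(* No [t]-derivative of [polar_distortion] is available, but it is an integral in [x]
   of a jointly continuous density. *)
Lemma increment_lower x t e : x < 0 -> 0 < e -> exists2 d : R, 0 < d & forall y1 y2 s y,
  y1 <= x -> x <= y2 -> y2 - y1 < d -> `|s - t| < d -> y1 <= y <= y2 ->
  y2 < 0 /\ 2 * Phi1 (W x t) * (polar_density x t + 1) * (y2 - y1) - e * (y2 - y1) <=
  2 * Phi1 (W y s) * (polar_distortion y2 s - polar_distortion y1 s + (y2 - y1)).
Proof.
move=> x0 e0; have al0 := polar_density_ge0 hf fD t x0; have ph0 := Phi1_ge0 p0 (W x t).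
set al := polar_density x t in al0 *; set ph := Phi1 _ in ph0 *.
have M0 : 0 < 2 * (ph + al + 1) by lra.
pose eta := Num.min (1 / 2) (e / (2 * (ph + al + 1))).
have eta0 : 0 < eta by rewrite lt_min !divr_gt0.
have eta1 : eta <= 1 / 2 by rewrite ge_min lexx.
have eta2 : eta * (2 * (ph + al + 1)) <= e by rewrite -ler_pdivlMr// ge_min lexx orbT.
have [d1 d10 h1] := cont2_small (rdiff_cont (rdiff_Phi1 hf hf1 fD p t x0)) eta0.
have [d2 d20 h2] := cont2_small (cont_polar_density hf hf1 fD (t := t) x0) eta0.
(* A width below -x keeps [y2] negative, because y1 <= x. *)
exists (Num.min (- x) (Num.min d1 d2)); first by rewrite !lt_min d10 d20 oppr_gt0 x0.
move=> y1 y2 s y y1x xy2; rewrite !lt_min => /and3P[a1 a2 a3] /and3P[_ b2 b3] /andP[y1y yy2].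
have y20 : y2 < 0 by lra.
split=> //.
have yx (u : R) : y1 <= u <= y2 -> `|u - x| < d1 /\ `|u - x| < d2.
  by move=> /andP[u1 u2]; rewrite !ltr_norml; split; apply/andP; split; lra.
have [yd _] := yx y (introT andP (conj y1y yy2)).
have D0 : 0 <= y2 - y1 by rewrite subr_ge0; exact: le_trans yy2.
apply: (increment_arith al0 ph0 eta0 eta1 eta2 D0); last exact: Phi1_ge0.
- apply: (partial_distortion_incr hf hf1 fD) => //; first by rewrite -subr_ge0.
  move=> u uy; have [_ ud] := yx u uy.
  exact: ltW (ltr_distlCBl (h2 u s ud b3)).
- exact: ltW (ltr_distlCBl (h1 y s yd b2)).
Qed.

Lemma polar_distortion_cont x t : x < 0 -> {for t, continuous (polar_distortion x)}.
Proof.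
move=> x0; have /andP[e0 e1] := expR_itv01 x0.
apply: (@continuous_comp _ _ _ (@ei R : R -> R[i]^o) (partial_distortion f f1 (expR x) : R[i]^o -> R) t).
  exact: ccurveP (ccurve_ei R) t.
by apply: (partial_distortion_cont hf hf1 fD); rewrite ?nm_ei ?mulr1// (ltW e0).
Qed.

Lemma Phi_cont x t : x < 0 -> {for t, continuous (fun s => Phi (W x s))}.
Proof. by move=> x0; exact: derive_cont (rdiff_dt (rdiff_Phi hf hf1 fD p t x0)). Qed.

Lemma phi_le_J x t : x < 0 -> Phi (W x t) <= JJ x t.
Proof.
move=> x0; rewrite /JJ lerDl -mulNr mulr_ge0 ?oppr_ge0 ?(ltW x0)// mulr_ge0 ?(Phi1_ge0 p0)//.
by apply: le_trans (polar_density_le_Wx f1 fD t x0); exact: (polar_density_ge0 hf fD).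
Qed.

Lemma JJ_itv_intble x : x < 0 -> itv_intble 0 twopi (JJ x).
Proof.
move=> x0; apply: itv_intble_cont_at => t _; have [b hJ] := rdiff_JJ hf hf1 fD p t x0.
exact: derive_cont (rdiff_dt hJ).
Qed.

Lemma pow2A_cont x t : x < 0 -> {for t, continuous (fun s => (2 + polar_distortion x s) `^ p)}.
Proof.
move=> x0; have c1 := rcD (@rc_cst R R 2 t) (@polar_distortion_cont x t x0).
have p2 : 0 < 2 + polar_distortion x t by have := polar_distortion_ge0 hf fD t x0; lra.
exact: (rc_comp c1 (derive_cont (is_derive1_powR p p2))).
Qed.

Section big.
Hypothesis p1 : 1 <= p.
Let K x t : R := 2 * Phi1 (W x t) * (2 + polar_distortion x t + x).

Let Phi2_ge0 (w : R) : 0 <= Phi2 w.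
Proof. by rewrite mulr_ge0 ?(ltW p0)// mulr_ge0 ?powR_ge0// subr_ge0. Qed.

(** The discrete product rule leaves Phi'(W) at the left end [y1] next to the increment of the
    distortion, and the differentiability of Phi'(W) handles the other term. *)
Let K_increment_x x t e : -1 <= x < 0 -> 0 < e -> increment_x (fun y s => - K y s) x t (- TT x t) e.
Proof.
move=> /andP[x1 x0] e0; have e4 : 0 < e / 4 by rewrite divr_gt0.
have e2 : 0 < e / 2 by rewrite divr_gt0.
have [d1 d10 h1] := rdiff_increment_x (rdiffN (rdiff_Phi1 hf hf1 fD p t x0)) e4.
have [d2 d20 h2] := increment_lower t x0 e2.
exists (Num.min d1 d2); first by rewrite lt_min d10.
move=> y1 y2 s y1x xy2; rewrite !lt_min => /andP[a1 a2] /andP[b1 b2].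
have y1y : y1 <= y1 <= y2 by rewrite lexx (le_trans y1x).
have [y20 l2] := h2 y1 y2 s y1 y1x xy2 a2 b2 y1y.
have l1 := h1 y1 y2 s y1x xy2 a1 b1.
have y12 : y1 <= y2 := le_trans y1x xy2.
have y10 : y1 < 0 := le_lt_trans y12 y20.
have w1 : 0 <= W y1 s := ltW (W_gt0 hf hf1 fD s y10).
have w12 : W y1 s <= W y2 s := W_nondecreasing hf fD s y12 y20.
have ph12 : Phi1 (W y1 s) <= Phi1 (W y2 s).
  exact: Phi1_le.
have -> : TT x t = 2 * (Phi2 (W x t) * Wx x t) + 2 * Phi1 (W x t) * (polar_density x t + 1).
  by rewrite /TT max_l ?Phi2_ge0//; ring.
apply: increment_arith_ge1 => //; [exact: ltW|exact: (polar_distortion_ge0 hf fD)|exact: le_trans xy2].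
Qed.

(** By [young] the mean of [K] is at most half the mean of Phi(W), finite as X < 0, plus a multiple
    of the wanted mean. Moving that half to the left doubles the constants. *)
Lemma mean_estimate_ge1 : exists C0 C1 : R, 0 <= C1 /\ forall x, -1 < x -> x < 0 ->
  itv_int 0 twopi (fun t => Phi (W x t)) <= C0 + C1 * itv_int 0 twopi (fun t => (2 + polar_distortion x t) `^ p).
Proof.
pose C := itv_int 0 twopi (JJ (-1)) - itv_int 0 twopi (K (-1)).
exists (2 * C), ((4 * p) `^ p); split; first exact: powR_ge0.
move=> X X1 X0.
have iK x : x < 0 -> itv_intble 0 twopi (K x).
  move=> x0; apply: itv_intble_cont_at => t _.
  have c1 := derive_cont (rdiff_dt (rdiff_Phi1 hf hf1 fD p t x0)).
  exact: (rcM (rcM (@rc_cst R R 2 t) c1) (rcD (rcD (@rc_cst R R 2 t) (@polar_distortion_cont x t x0)) (@rc_cst R R x t))).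
have iPhi : itv_intble 0 twopi (fun t => Phi (W X t)) by apply: itv_intble_cont_at => t _; exact: Phi_cont.
have iA : itv_intble 0 twopi (fun t => (2 + polar_distortion X t) `^ p) by apply: itv_intble_cont_at => t _; exact: pow2A_cont.
have G : itv_int 0 twopi (JJ X) - itv_int 0 twopi (K X) <= C.
  apply: (green_est hf hf1 fD p0 X1 X0).
  - by move=> x /andP[h1 h2]; apply: iK; lra.
  - by move=> x t e /andP[h1 h2] e0; apply: K_increment_x => //; slra.
have h1 : itv_int 0 twopi (fun t => Phi (W X t)) <= itv_int 0 twopi (JJ X).
  by apply: itv_int_leM => //; [exact: JJ_itv_intble|move=> t _; exact: phi_le_J].
have h2 : itv_int 0 twopi (K X) <= itv_int 0 twopi (fun t => 1 / 2 * Phi (W X t) + (4 * p) `^ p / 2 * (2 + polar_distortion X t) `^ p).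
  apply: itv_int_leM; [exact: iK|by apply: itv_intbleD; exact: itv_intbleZ|move=> t _].
  have w1 := W_ge1 hf hf1 fD t X0; have A0 := polar_distortion_ge0 hf fD t X0.
  have b0 : 0 <= 2 + polar_distortion X t by lra.
  have := young p1 w1 b0; have : K X t <= 2 * Phi1 (W X t) * (2 + polar_distortion X t).
    by apply: ler_wpM2l; [rewrite mulr_ge0 ?(Phi1_ge0 p0)|rewrite gerDl ltW].
  rewrite /Phi; lra.
move: h2; rewrite itv_intD; [|exact: itv_intbleZ|exact: itv_intbleZ].
by rewrite !itv_intZ//; lra.
Qed.
End big.

Section small.
Hypothesis p1 : p <= 1.
Let K x t : R := 2 * (1 + polar_distortion x t) `^ p + 2 * p * x.

Let Phi2_le0 (w : R) : Phi2 w <= 0.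
Proof. by rewrite mulr_ge0_le0 ?(ltW p0)// mulr_le0_ge0 ?powR_ge0// subr_le0. Qed.

(** Here Phi'(W) is taken at the right end [y2], where the concave power has its smallest slope on
    the interval. The summand 2 p x pays for the constant in [TT], since Phi'(W) <= p. *)
Let K_increment_x x t e : -1 <= x < 0 -> 0 < e -> increment_x (fun y s => - K y s) x t (- TT x t) e.
Proof.
move=> /andP[x1 x0] e0.
have [d2 d20 h2] := increment_lower t x0 e0.
exists d2 => // y1 y2 s y1x xy2 a2 b2.
have y12 : y1 <= y2 := le_trans y1x xy2.
have y2y : y1 <= y2 <= y2 by rewrite lexx y12.
have [y20 l2] := h2 y1 y2 s y2 y1x xy2 a2 b2 y2y.
have y10 : y1 < 0 := le_lt_trans y12 y20.
have A1 := polar_distortion_ge0 hf fD s y10; have A2 := polar_distortion_ge0 hf fD s y20.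
have A12 := polar_distortion_nondecreasing s y12 y20.
have w2 := W_ge_polar_distortion hf hf1 fD s y20.
have a1 : 1 <= 1 + polar_distortion y1 s by rewrite lerDl; exact: A1.
have a12 : 1 + polar_distortion y1 s <= 1 + polar_distortion y2 s by rewrite lerD2l; exact: A12.
have a2' : 0 < 1 + polar_distortion y2 s := ltr_pwDl ltr01 A2.
have p1' : p - 1 <= 0 by rewrite subr_le0.
have -> : TT x t = 2 * Phi1 (W x t) * (polar_density x t + 1).
  by rewrite /TT max_r ?Phi2_le0//; ring.
have q1 := powR_concave p0 p1 a1 a12; rewrite opprD addrACA subrr add0r in q1.
have q2 : Phi1 (W y2 s) <= p * (1 + polar_distortion y2 s) `^ (p - 1).
  exact: Phi1_le_powR.
have q3 : Phi1 (W y2 s) <= p by exact: (Phi1_le_p p0 p1 (W_ge1 hf hf1 fD s y20)).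
apply: (increment_arith_le1 (ltW e0) (normr_ge0 _) _ _ l2).
- by apply: le_trans q1; apply: ler_wpM2r; [rewrite subr_ge0; exact: A12|exact: q2].
- by apply: ler_wpM2r; [rewrite subr_ge0; exact: y12|exact: q3].
Qed.

(** No absorption occurs, since [K] is already a function of the distortion; its part 2 p x is
    nonpositive at X. *)
Lemma mean_estimate_le1 : exists C0 C1 : R, 0 <= C1 /\ forall x, -1 < x -> x < 0 ->
  itv_int 0 twopi (fun t => Phi (W x t)) <= C0 + C1 * itv_int 0 twopi (fun t => (2 + polar_distortion x t) `^ p).
Proof.
pose C := itv_int 0 twopi (JJ (-1)) - itv_int 0 twopi (K (-1)).
exists C, 2; split=> //.
move=> X X1 X0.
have iK x : x < 0 -> itv_intble 0 twopi (K x).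
  move=> x0; apply: itv_intble_cont_at => t _.
  have c1 := rcD (@rc_cst R R 1 t) (@polar_distortion_cont x t x0).
  have p2 : 0 < 1 + polar_distortion x t by have := polar_distortion_ge0 hf fD t x0; lra.
  have c2 := rc_comp c1 (derive_cont (is_derive1_powR p p2)).
  exact: (rcD (rcM (@rc_cst R R 2 t) c2) (@rc_cst R R (2 * p * x) t)).
have iPhi : itv_intble 0 twopi (fun t => Phi (W X t)) by apply: itv_intble_cont_at => t _; exact: Phi_cont.
have iA : itv_intble 0 twopi (fun t => (2 + polar_distortion X t) `^ p) by apply: itv_intble_cont_at => t _; exact: pow2A_cont.
have G : itv_int 0 twopi (JJ X) - itv_int 0 twopi (K X) <= C.
  apply: (green_est hf hf1 fD p0 X1 X0).
  - by move=> x /andP[h1 h2]; apply: iK; lra.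
  - by move=> x t e /andP[h1 h2] e0; apply: K_increment_x => //; slra.
have h1 : itv_int 0 twopi (fun t => Phi (W X t)) <= itv_int 0 twopi (JJ X).
  by apply: itv_int_leM => //; [exact: JJ_itv_intble|move=> t _; exact: phi_le_J].
have h2 : itv_int 0 twopi (K X) <= itv_int 0 twopi (fun t => 2 * (2 + polar_distortion X t) `^ p).
  apply: itv_int_leM; [exact: iK|exact: itv_intbleZ|move=> t _].
  have A0 := polar_distortion_ge0 hf fD t X0.
  have : (1 + polar_distortion X t) `^ p <= (2 + polar_distortion X t) `^ p.
    by apply: ge0_ler_powR; rewrite ?nnegrE ?(ltW p0)//; lra.
  have : p * X <= 0 by rewrite mulr_ge0_le0 ?ltW.
  rewrite /K; lra.
by move: h2; rewrite itv_intZ//; lra.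
Qed.
End small.

Lemma mean_estimate : exists C0 C1 : R, 0 <= C1 /\ forall x, -1 < x -> x < 0 ->
  itv_int 0 twopi (fun t => W x t `^ p) <= C0 + C1 * itv_int 0 twopi (fun t => (2 + polar_distortion x t) `^ p).
Proof. by case: (leP 1 p) => [/mean_estimate_ge1|/ltW/mean_estimate_le1]. Qed.
End cases.

(** * Integration and measurability on the circle *)

Section circlemeasure. Variable R : realType.
Implicit Types (z w d a c xi : R[i]) (rho t x y r s : R).
Local Notation nm := (@modulus R).
Local Notation twopi := (2 * pi : R).
Local Notation cm := (circle_measure R).
Local Notation Circle := (@circle R : set (Cborel R)).

Lemma open_measurable_Cborel (O : set R[i]^o) : open O -> measurable (O : set (Cborel R)).
Proof. by move=> oO; apply: sub_sigma_algebra. Qed.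

Lemma measurable_circle : measurable Circle.
Proof.
have -> : Circle = ~` (~` Circle) by rewrite setCK.
apply: measurableC; apply: open_measurable_Cborel.
have -> : ~` (@circle R : set R[i]^o) = (nm : R[i]^o -> R) @^-1` [set~ 1].
  apply/seteqP; split=> z /=; first by move=> h; apply/eqP; apply: contra_not_neq h => /circleE.
  by move=> h; move/circleE.
apply: open_comp; first by move=> z _; exact: continuous_modulus.
by apply: closed_openC; apply: accessible_closed_set1; exact: hausdorff_accessible.
Qed.

Lemma expi_circle t : circle (expi t).
Proof. by apply/circleE; exact: nm_ei. Qed.

Lemma circle_expi_preimage : (@expi R) @^-1` Circle = setT.
Proof. by apply/seteqP; split=> t //= _; exact: expi_circle. Qed.

Lemma integral_circle (g : R[i] -> \bar R) : measurable_fun Circle (g : Cborel R -> \bar R) ->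
  (forall xi, circle xi -> 0 <= g xi)%E ->
  (\int[cm]_(xi in @circle R) g xi = (twopi^-1)%:E * \int[lebesgue_measure]_(t in `[0%R, twopi]) g (ei t))%E.
Proof.
move=> mg g0.
rewrite /circle_measure /distribution (ge0_integral_pushforward (@measurable_expi R)); last 3 first.
- exact: measurable_circle.
- exact: mg.
- by move=> xi; rewrite inE; exact: g0.
rewrite circle_expi_preimage integral_uniform.
- by rewrite subr0.
- move=> /=; apply: (measurable_comp measurable_circle _ mg).
    by move=> _ [t _ <-]; exact: expi_circle.
  exact: measurable_expi.
- by move=> t; apply: g0; exact: expi_circle.
Qed.

Lemma circle_measure_circle : {ae cm, forall xi, circle xi}.
Proof.
exists (~` Circle); split.
- by apply: measurableC; exact: measurable_circle.
- rewrite -[LHS]/(uniform_prob (@twopi_gt0 R) ((@expi R) @^-1` (~` Circle))) -preimage_setC circle_expi_preimage setCT.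
  exact: measure0.
- by [].
Qed.

Lemma circle_measure_le1 : (cm Circle <= 1)%E.
Proof.
rewrite -[leLHS]/(uniform_prob (@twopi_gt0 R) ((@expi R) @^-1` Circle)) circle_expi_preimage; exact: probability_le1.
Qed.

(** Continuity is known only at points of the circle, so the preimage of an open set need not be
    open; on the circle it coincides with its interior. *)
Lemma measurable_circle_cont (h : R[i]^o -> R) :
  (forall xi : R[i], nm xi = 1 -> {for xi, continuous h}) ->
  measurable_fun Circle (h : Cborel R -> R).
Proof.
move=> ch; apply: (measurability _ (RGenOpens.measurableE R)).
move=> _ [B [a [b BE]] <-].
have oB : open B by rewrite BE; exact: interval_open.
have -> : Circle `&` (h : Cborel R -> R) @^-1` B = Circle `&` (interior (h @^-1` B : set R[i]^o) : set (Cborel R)).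
  apply/seteqP; split=> xi [c1 h1]; split=> //; last exact: interior_subset h1.
  move/circleE: (c1) => n1.
  by apply: (ch xi n1); apply: open_nbhs_nbhs; split.
apply: measurableI; first exact: measurable_circle.
by apply: open_measurable_Cborel; exact: open_interior.
Qed.

End circlemeasure.

(** * A sequence of radii increasing to 1 *)

Section radii. Variable R : realType.
Implicit Types (r : R) (n m : nat).

(** The shift by 2 keeps every term strictly between -1 and 0, the range of [mean_estimate]. *)
Definition xn n : R := - n.+2%:R^-1.
Definition rn n : R := expR (xn n).

Lemma xn_bounds n : -1 < xn n /\ xn n < 0.
Proof.
have h : 0 < (n.+2%:R : R) by rewrite ltr0n.
rewrite /xn ltrN2 oppr_lt0 invr_gt0 h; split=> //.
by rewrite invf_lt1// ltr1n.
Qed.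

Lemma rn_bounds n : 0 < rn n < 1.
Proof. by apply: expR_itv01; case: (xn_bounds n). Qed.

Lemma rn_nondecreasing n m : (n <= m)%N -> rn n <= rn m.
Proof.
by move=> nm; rewrite /rn ler_expR /xn lerN2 lef_pV2 ?posrE ?ltr0n// ler_nat.
Qed.

Lemma rn_cofinal r : r < 1 -> exists n, forall m, (n <= m)%N -> r < rn m.
Proof.
move=> r1; have d0 : 0 < 1 - r by rewrite subr_gt0.
exists (Num.bound (1 - r)^-1) => m nm.
apply: (@lt_le_trans _ _ (1 + xn m)); last exact: expR_ge1Dx.
rewrite /xn ltrBrDl -ltrBrDr -(invrK (1 - r)) ltf_pV2 ?posrE ?invr_gt0 ?ltr0n//.
apply: (lt_le_trans (archi_boundP _)); first by rewrite invr_ge0 ltW.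
by rewrite ler_nat (leq_trans nm)// (leq_trans (leqnSn m)).
Qed.

Lemma cvg_rn (h : R -> R) (l : R) : h r @[r --> (1 : R)^'-] --> l -> (fun n => h (rn n)) @ \oo --> l.
Proof.
move=> /at_left1P hl; apply/cvgrPdist_lt => e e0.
have [r0 /andP[_ r01] hr0] := hl e e0.
have [N hN] := rn_cofinal r01.
exists N => // m /= Nm; rewrite distrC; apply: hr0; first exact: hN.
by have /andP[] := rn_bounds m.
Qed.

End radii.

(** * The accumulated distortion as a monotone limit *)

Section pointwise. Variable R : realType.
Implicit Types (z w d a c xi : R[i]) (rho t x y r s : R).
Local Notation nm := (@modulus R).
Local Notation rn := (@rn R).
Variables (f f2 : R[i] -> R[i]).
Local Notation f1 := (cderiv f).
Hypothesis hf : forall z, nm z < 1 -> cdiff f z (f1 z).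
Hypothesis hf1 : forall z, nm z < 1 -> cdiff f1 z (f2 z).
Hypothesis fD : forall z, nm z < 1 -> nm (f z) < 1.
Local Notation log_gap := (log_gap f).
Local Notation partial_distortion := (partial_distortion f f1).
Local Notation distortion_rate := (distortion_rate f f1).
Local Notation mu := (@lebesgue_measure R).

Lemma EFin_itv_int (a b : R) (h : R -> R) : itv_intble a b h ->
  (\int[mu]_(x in `[a, b]) (h x)%:E = (itv_int a b h)%:E)%E.
Proof. by move=> ih; rewrite /itv_int /Rintegral fineK//; exact: integrable_fin_num. Qed.

Lemma partial_distortion_cvg xi : nm xi = 1 ->
  (fun n => (partial_distortion (rn n) xi)%:E) @ \oo --> total_distortion f xi.
Proof.
move=> x1.
have E0 : \bigcup_n [set` `[0, rn n]] = [set` `[0, 1[] :> set R.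
  apply/seteqP; split=> r /=.
    move=> [n _] /=; rewrite !in_itv/= => /andP[-> h]/=.
    by have /andP[_] := rn_bounds R n; exact: le_lt_trans.
  rewrite in_itv/= => /andP[r0 /rn_cofinal[n hn]]; exists n => //=.
  by rewrite in_itv/= r0 ltW// hn.
have ih n : itv_intble 0 (rn n) (distortion_rate^~ xi).
  have /andP[r0 r1] := rn_bounds R n.
  by apply: (itv_intble_distortion_rate hf hf1 fD r1); rewrite ?x1 ?mulr1.
rewrite /total_distortion -E0.
under eq_fun do rewrite -EFin_itv_int//.
apply: ge0_nondecreasing_set_cvg_integral.
- move=> n m nm; apply/subsetPset => r /=; rewrite !in_itv/= => /andP[-> h]/=.
  by apply: (le_trans h); exact: rn_nondecreasing.
- by move=> n; exact: measurable_itv.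
- by move=> n; have /integrableP[] := ih n.
- move=> n r /=; rewrite in_itv/= => /andP[r0 rr]; rewrite lee_fin.
  by apply: (distortion_rate_ge0 hf fD x1); rewrite r0; have /andP[_] := rn_bounds R n; exact: le_lt_trans.
Qed.

End pointwise.

(** * Powers of extended reals and domination in L^p *)

Section powers. Variable R : realType.
Variable p : R.
Hypothesis p0 : 0 < p.

Lemma powR_cvge (u : nat -> R) (M : \bar R) : (forall n, 1 <= u n) ->
  (fun n => (u n)%:E) @ \oo --> M -> (fun n => ((u n) `^ p)%:E) @ \oo --> (M `^ p)%E.
Proof.
move=> u1 uM.
have M1 : (1%:E <= M)%E by apply: cvge_ge uM; apply: nearW => n; rewrite lee_fin.
case: M M1 uM => [m| |] // m1 uM.
- rewrite poweR_EFin; rewrite lee_fin in m1.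
  apply: cvg_EFin; first by apply: nearW.
  have um : u @ \oo --> m by have /fine_cvgP[_] := uM.
  have m0 : 0 < m by apply: lt_le_trans m1.
  have cp : {for m, continuous (fun x : R => x `^ p)} := derive_cont (is_derive1_powR p m0).
  exact: (cvg_comp u (fun x : R => x `^ p) um cp).
- rewrite poweRyr ?gt_eqF//; apply/cvgeyPge => A.
  have /cvgeyPge/(_ (`|A| `^ p^-1)) [N _ hN] := uM.
  exists N => // n /hN /=; rewrite !lee_fin => h.
  apply: (le_trans (ler_norm A)).
  rewrite -[leLHS]powRr1// -(mulVf (lt0r_neq0 p0)) powRrM.
  by apply: ge0_ler_powR => //; rewrite ?nnegrE ?powR_ge0 ?(ltW p0)//; exact: le_trans h.
Qed.

(** For finite a the sum is at most twice the larger term, which holds for every p > 0. *)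
Lemma poweR_affine (a : \bar R) (b : R) : (0 <= a)%E -> 0 <= b ->
  ((a + b%:E) `^ p <= (2 `^ p)%:E * a `^ p + ((2 * b) `^ p)%:E)%E.
Proof.
move=> a0 b0; have P2 : 0 < (2 : R) `^ p by rewrite powR_gt0.
case: a a0 => [a| |] // a0; last first.
  by rewrite addye// poweRyr ?gt_eqF// mulry gtr0_sg// mul1e addye.
rewrite lee_fin in a0.
rewrite -EFinD !poweR_EFin -EFinM -EFinD lee_fin -powRM//.
have [ab|ba] := leP a b.
  apply: (@le_trans _ _ ((2 * b) `^ p)); last by rewrite lerDr powR_ge0.
  by apply: ge0_ler_powR; rewrite ?nnegrE ?addr_ge0 ?mulr_ge0 ?(ltW p0)//; lra.
apply: (@le_trans _ _ ((2 * a) `^ p)); last by rewrite lerDl powR_ge0.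
by apply: ge0_ler_powR; rewrite ?nnegrE ?addr_ge0 ?mulr_ge0 ?(ltW p0)//; lra.
Qed.

End powers.

Section dominate. Variable R : realType.
Variable p : R.
Hypothesis p0 : 0 < p.
Local Notation cm := (circle_measure R).
Local Notation Circle := (@circle R : set (Cborel R)).

Lemma measurable_Lp (g : R[i] -> \bar R) : measurable_fun Circle (g : Cborel R -> \bar R) ->
  measurable_fun Circle (fun xi : Cborel R => `|g xi| `^ p)%E.
Proof.
move=> mg; apply: (measurableT_comp (@measurable_poweR R p)).
exact: measurableT_comp.
Qed.

(* [p < 1] is allowed, so constants are absorbed by [poweR_affine] in place of
   Minkowski's inequality. *)
Lemma Lp_dominated (g h : R[i] -> \bar R) (b : R) : 0 <= b ->
  measurable_fun Circle (g : Cborel R -> \bar R) ->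
  measurable_fun Circle (h : Cborel R -> \bar R) ->
  (forall xi, circle xi -> (`|g xi| <= `|h xi| + b%:E)%E) ->
  (\int[cm]_(xi in @circle R) (`|h xi| `^ p) < +oo)%E ->
  (\int[cm]_(xi in @circle R) (`|g xi| `^ p) < +oo)%E.
Proof.
move=> b0 mg mh gh hoo.
have mC := @measurable_circle R.
have mH := measurable_Lp mh.
have h0 xi : (0 <= `|h xi| `^ p)%E by exact: poweR_ge0.
have P2 : (0 <= (2 : R) `^ p) by rewrite powR_ge0.
apply: (@le_lt_trans _ _ (\int[cm]_(xi in @circle R) ((2 `^ p)%:E * `|h xi| `^ p + ((2 * b) `^ p)%:E))%E).
  apply: ge0_le_integral.
  - exact: mC.
  - by move=> xi _; exact: poweR_ge0.
  - exact: measurable_Lp.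
  - apply: emeasurable_funD; last exact: measurable_cst.
    exact: emeasurable_funM.
  - move=> xi cxi; apply: le_trans (poweR_affine p0 _ b0); last exact: abse_ge0.
    apply: gt0_ler_poweR; first exact: ltW.
    + by rewrite in_itv/= abse_ge0 leey.
    + by rewrite in_itv/= adde_ge0 ?abse_ge0 ?lee_fin ?leey.
    + exact: gh.
rewrite ge0_integralD//; first last.
  - by move=> xi _; rewrite lee_fin powR_ge0.
  - exact: emeasurable_funM.
  - by move=> xi _; rewrite mule_ge0 ?lee_fin.
rewrite ge0_integralZl// integral_cst//.
apply: lte_add_pinfty; first by rewrite lte_mul_pinfty ?lee_fin.
apply: (@le_lt_trans _ _ (((2 * b) `^ p)%:E * 1)%E); last by rewrite mule1 ltry.
by apply: lee_wpmul2l; rewrite ?lee_fin ?powR_ge0//; exact: circle_measure_le1.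
Qed.

End dominate.

(** * Pointwise limits on the circle and the direct implication *)

Section pointwise_limits. Variable R : realType.
Implicit Types (z w d a c xi : R[i]) (rho t x y r s : R).
Local Notation nm := (@modulus R).
Local Notation rn := (@rn R).
Variables (f f2 : R[i] -> R[i]).
Local Notation f1 := (cderiv f).
Hypothesis hf : forall z, nm z < 1 -> cdiff f z (f1 z).
Hypothesis hf1 : forall z, nm z < 1 -> cdiff f1 z (f2 z).
Hypothesis fD : forall z, nm z < 1 -> nm (f z) < 1.
Local Notation log_gap := (log_gap f).
Local Notation partial_distortion := (partial_distortion f f1).
Local Notation logder := (fun xi => lne (abs_angular_derivative f xi)).
Local Notation Circle := (@circle R : set (Cborel R)).

Lemma rn_lt1 n : rn n < 1. Proof. by have /andP[] := rn_bounds R n. Qed.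
Lemma rn_ge0 n : 0 <= rn n. Proof. by have /andP[/ltW] := rn_bounds R n. Qed.

Lemma abs_angular_derivativeE xi w a : nm w = 1 -> radial_cvg f xi w -> radial_cvg f1 xi a ->
  abs_angular_derivative f xi = (nm a)%:E.
Proof.
move=> w1 hw ha; rewrite /abs_angular_derivative asboolT; last first.
  by split; [exists w => //; apply/circleE|exists a].
congr (_%:E); apply: cvg_lim; first exact: Rhausdorff.
apply/at_left1P => e e0.
have [r0 r01 hr] := (at_left1_complexP _ _).1 ha e e0.
exists r0 => // r h1 h2; apply: le_lt_trans (hr r h1 h2).
exact: ler_dist_nm.
Qed.

(** This holds at every point of the circle: where the gap is unbounded there is no finite angular
    derivative, and both sides are +oo. It gives measurability of log |f'| and lets limits be taken
    without exceptional sets. *)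
Lemma lne_angular_cvg xi : nm xi = 1 ->
  (fun n => (log_gap (rn n) xi - ln 4)%:E) @ \oo --> logder xi.
Proof.
move=> x1.
have [[B hB]|nB] := pselect (exists B, forall r, 0 <= r < 1 -> log_gap r xi <= B).
  have [V [w [a [[_ hV] w1 hw ha aE]]]] := julia_caratheodory hf hf1 fD x1 hB.
  rewrite (abs_angular_derivativeE w1 hw ha) aE lne_EFin ?divr_gt0 ?expR_gt0//.
  rewrite ln_div ?posrE ?expR_gt0// expRK.
  apply/fine_cvgP; split; first exact: nearW.
  exact: (cvgB (cvg_rn hV) (cvg_cst (ln 4))).
rewrite /abs_angular_derivative asboolF; last first.
  move=> [[w /circleE w1 hw] [a ha]]; apply: nB.
  exact: (log_gap_bounded_of_radial hf fD x1 w1 hw ha).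
apply/cvgeyPge => A.
have [r [/andP[r0 r1] hr]] : exists r, 0 <= r < 1 /\ A + ln 4 < log_gap r xi.
  apply: contra_notP nB => h; exists (A + ln 4) => r hr; rewrite leNgt.
  by apply/negP => h'; apply: h; exists r.
have [N hN] := rn_cofinal r1; exists N => // m /= Nm.
rewrite lee_fin lerBrDr; apply: (le_trans (ltW hr)).
apply: (log_gap_nondecreasing hf fD x1); last exact: rn_lt1.
  by apply: lt_le_trans r0; rewrite ltrN10.
exact: ltW (hN m Nm).
Qed.

Lemma log_gap_cont rho xi : 0 <= rho < 1 -> nm xi = 1 ->
  {for xi, continuous (log_gap rho : R[i]^o -> R)}.
Proof.
move=> /andP[r0 r1] x1.
have rx : nm (rho%:C * xi) < 1 by apply: rxi_lt1 => //; rewrite r1 (lt_le_trans _ r0)// ltrN10.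
have c1 : {for xi, continuous ((fun w => f (rho%:C * w)) : R[i]^o -> R[i]^o)}.
  exact: cdiff_cont (cdiff_comp (cdiffM (cdiff_cst _ _) (cdiff_id _)) (hf rx)).
have c2 := @rc_comp R R[i]^o _ xi (cont_nm_comp c1) _ (@rc_sqr R (nm (f (rho%:C * xi)))).
have c3 := rcB (@rc_cst R R[i]^o 1 xi) c2.
have c4 := @rc_comp R R[i]^o _ xi c3 _ (continuous_ln (one_sub_sqr_gt0 (fD rx))).
exact: (rcD c4 (@rc_cst R R[i]^o _ xi)).
Qed.

Lemma measurable_log_gap n : measurable_fun Circle (log_gap (rn n) : Cborel R -> R).
Proof. by apply: measurable_circle_cont => xi x1; apply: log_gap_cont => //; rewrite rn_ge0 rn_lt1. Qed.

Lemma measurable_partial_distortion n : measurable_fun Circle (partial_distortion (rn n) : Cborel R -> R).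
Proof.
apply: measurable_circle_cont => xi x1.
by apply: (partial_distortion_cont hf hf1 fD); rewrite ?rn_ge0 ?x1 ?mulr1 rn_lt1.
Qed.

Lemma measurable_logder : measurable_fun Circle (logder : Cborel R -> \bar R).
Proof.
apply: (@emeasurable_fun_cvg _ (Cborel R) R Circle (fun n xi => (log_gap (rn n) xi - ln 4)%:E)) => [n|xi /circleE x1].
  apply/measurable_EFinP; apply: measurable_funB; first exact: measurable_log_gap.
  exact: measurable_cst.
exact: lne_angular_cvg.
Qed.

Lemma measurable_total_distortion :
  measurable_fun Circle (total_distortion f : Cborel R -> \bar R).
Proof.
apply: (@emeasurable_fun_cvg _ (Cborel R) R Circle (fun n xi => (partial_distortion (rn n) xi)%:E)) => [n|xi /circleE x1].
  by apply/measurable_EFinP; exact: measurable_partial_distortion.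
exact: (partial_distortion_cvg hf hf1 fD x1).
Qed.

Lemma partial_distortion_le_total_distortion n xi : nm xi = 1 ->
  ((partial_distortion (rn n) xi)%:E <= total_distortion f xi)%E.
Proof.
move=> x1; apply: (cvge_ge _ (partial_distortion_cvg hf hf1 fD x1)).
exists n; first exact: I.
move=> m /= nm; rewrite lee_fin -subr_ge0.
have rr := rn_nondecreasing R nm.
rewrite (partial_distortionB hf hf1 fD x1 (rn_ge0 n) rr (rn_lt1 m)).
rewrite -[leLHS](mul0r (rn m - rn n)) -itv_int_cst//.
apply: itv_int_leM; first exact: itv_intble_cst.
  by apply: (itv_intble_distortion_rate hf hf1 fD (rn_lt1 m)); rewrite ?x1 ?mulr1 ?rn_lt1 ?rn_ge0.
move=> r /andP[h1 h2]; apply: (distortion_rate_ge0 hf fD x1).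
by rewrite (le_trans (rn_ge0 n) h1) (le_lt_trans h2 (rn_lt1 m)).
Qed.

Lemma total_distortion_ge0 xi : nm xi = 1 -> (0 <= total_distortion f xi)%E.
Proof.
move=> x1; apply: le_trans (partial_distortion_le_total_distortion 0 x1).
by rewrite lee_fin; apply: (partial_distortion_ge0 hf fD x1); rewrite rn_ge0 rn_lt1.
Qed.

Lemma log_gap0 xi : log_gap 0 xi = log_gap 0 1.
Proof. by rewrite /log_gap !mul0r. Qed.

Lemma total_distortion_le xi : nm xi = 1 ->
  (`|total_distortion f xi| <= `|logder xi| + `|ln 4 - log_gap 0 1|%:E)%E.
Proof.
move=> x1; rewrite gee0_abs; last exact: total_distortion_ge0.
apply: (@le_trans _ _ (logder xi + (ln 4 - log_gap 0 1)%:E)%E); last first.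
  by apply: leeD; [exact: lee_abs|rewrite lee_fin ler_norm].
have cA := partial_distortion_cvg hf hf1 fD x1.
have cV := lne_angular_cvg x1.
have cV' : (fun n => ((log_gap (rn n) xi - ln 4)%:E + (ln 4 - log_gap 0 1)%:E)%E) @ \oo -->
    (logder xi + (ln 4 - log_gap 0 1)%:E)%E.
  by apply: cvgeD => //; [exact: fin_num_adde_defl|exact: cvg_cst].
apply: (lee_cvg_to cA cV'); apply: nearW => n; rewrite -EFinD lee_fin.
have := partial_distortion_le_log_gap hf hf1 fD x1 (rn_bounds R n); rewrite log_gap0.
lra.
Qed.

End pointwise_limits.

(** * The converse implication *)

Section backward. Variable R : realType.
Implicit Types (z w d a c xi : R[i]) (rho t x y r s : R).
Local Notation nm := (@modulus R).
Local Notation rn := (@rn R).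
Local Notation twopi := (2 * pi : R).
Local Notation cm := (circle_measure R).
Variables (f f2 : R[i] -> R[i]).
Local Notation f1 := (cderiv f).
Hypothesis hf : forall z, nm z < 1 -> cdiff f z (f1 z).
Hypothesis hf1 : forall z, nm z < 1 -> cdiff f1 z (f2 z).
Hypothesis fD : forall z, nm z < 1 -> nm (f z) < 1.
Local Notation log_gap := (log_gap f).
Local Notation partial_distortion := (partial_distortion f f1).
Local Notation logder := (fun xi => lne (abs_angular_derivative f xi)).
Local Notation Circle := (@circle R : set (Cborel R)).
Variable p : R.
Hypothesis p0 : 0 < p.

Lemma integral_circle_itv_int (h : R[i] -> R) :
  measurable_fun Circle (h : Cborel R -> R) -> (forall xi, nm xi = 1 -> 0 <= h xi) ->
  itv_intble 0 twopi (fun t => h (ei t)) ->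
  (\int[cm]_(xi in @circle R) (h xi)%:E = (twopi^-1 * itv_int 0 twopi (fun t => h (ei t)))%:E)%E.
Proof.
move=> mh h0 ih.
rewrite (@integral_circle R (fun xi => (h xi)%:E)).
- by rewrite (EFin_itv_int ih) EFinM.
- exact/measurable_EFinP.
- by move=> xi /circleE x1; rewrite lee_fin; exact: h0.
Qed.

(** This is [polar_gap] at abscissa [xn n], seen as a function on the circle. *)
Local Notation u := (fun n xi => log_gap (rn n) xi + (1 - log_gap 0 1)).

Lemma u_ge1 n xi : nm xi = 1 -> 1 <= u n xi.
Proof.
move=> x1; have := partial_distortion_ge0 hf fD x1; have := partial_distortion_le_log_gap hf hf1 fD x1 (rn_bounds R n).
move=> h /(_ (rn n)); rewrite rn_ge0 rn_lt1 => /(_ isT); move: h; rewrite log_gap0; lra.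
Qed.

Lemma measurable_u n : measurable_fun Circle (u n : Cborel R -> R).
Proof.
apply: measurable_funD; first exact: measurable_log_gap hf fD n.
exact: measurable_cst.
Qed.

Lemma measurable_circle_powR (h : R[i] -> R) : measurable_fun Circle (h : Cborel R -> R) ->
  measurable_fun Circle (fun xi : Cborel R => h xi `^ p).
Proof. exact: measurableT_comp (measurable_powR p). Qed.

(** Transfers [mean_estimate] to the circle measure. The truncated distortion on the right is
    bounded by the total one, which makes the bound uniform in [n]. *)
Lemma mean_u_le : (\int[cm]_(xi in @circle R) (`|total_distortion f xi| `^ p) < +oo)%E ->
  exists K : R, forall n, (\int[cm]_(xi in @circle R) (u n xi `^ p)%:E <= K%:E)%E.
Proof.
move=> Too; have tp0 := @twopi_gt0 R.
have mT := measurable_total_distortion hf hf1 fD.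
have mT2 : measurable_fun Circle (fun xi : Cborel R => (total_distortion f xi + 2%:E)%E).
  by apply: emeasurable_funD => //; exact: measurable_cst.
have T2oo : (\int[cm]_(xi in @circle R) (`|total_distortion f xi + 2%:E| `^ p) < +oo)%E.
  apply: (@Lp_dominated R p p0 (fun xi => (total_distortion f xi + 2%:E)%E) (total_distortion f) 2) => //.
  by move=> xi _; apply: le_trans (lee_abs_add _ _) _; rewrite leeD2l// lee_fin ger0_norm.
have [C0 [C1 [C10 hC]]] := mean_estimate hf hf1 fD p0.
have T20 : (0 <= \int[cm]_(xi in @circle R) (`|total_distortion f xi + 2%:E| `^ p))%E.
  by apply: integral_ge0 => xi _; exact: poweR_ge0.
set K0 := (\int[cm]_(xi in @circle R) (`|total_distortion f xi + 2%:E| `^ p))%E in T2oo T20 *.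
have K0E : K0 = (fine K0)%:E by rewrite fineK// ge0_fin_numE.
exists (twopi^-1 * (C0 + C1 * (twopi * fine K0))) => n.
have [x1 x0] := xn_bounds R n.
have iA : itv_intble 0 twopi (fun t => (2 + partial_distortion (rn n) (ei t)) `^ p).
  by apply: itv_intble_cont_at => t _; exact: (@pow2A_cont R f f1 f2 hf hf1 fD p _ t x0).
have iW : itv_intble 0 twopi (fun t => u n (ei t) `^ p).
  by apply: itv_intble_cont_at => t _; exact: (@Phi_cont R f f1 f2 hf hf1 fD p _ t x0).
have mA : measurable_fun Circle (fun xi : Cborel R => (2 + partial_distortion (rn n) xi) `^ p).
  apply: measurable_circle_powR; apply: measurable_funD; first exact: measurable_cst.
  exact: measurable_partial_distortion hf hf1 fD n.
have mW : measurable_fun Circle (fun xi : Cborel R => u n xi `^ p).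
  by apply: measurable_circle_powR; exact: measurable_u.
rewrite (@integral_circle_itv_int (fun xi => u n xi `^ p) mW)//; last by move=> xi _; exact: powR_ge0.
rewrite lee_fin ler_pM2l ?invr_gt0//.
apply: (le_trans (hC _ x1 x0)); rewrite lerD2l ler_wpM2l// -ler_pdivrMl//.
rewrite -lee_fin -K0E.
rewrite -(@integral_circle_itv_int (fun xi => (2 + partial_distortion (rn n) xi) `^ p) mA)//; last by move=> xi _; exact: powR_ge0.
apply: ge0_le_integral.
- exact: measurable_circle.
- by move=> xi _; rewrite lee_fin powR_ge0.
- exact/measurable_EFinP.
- exact: (measurable_Lp p (g := fun xi => (total_distortion f xi + 2%:E)%E)).
- move=> xi /circleE n1; rewrite -poweR_EFin.
  have a0 := @partial_distortion_ge0 R f f1 hf fD (rn n) xi n1.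
  have A0 : 0 <= partial_distortion (rn n) xi by apply: a0; rewrite rn_ge0 rn_lt1.
  apply: gt0_ler_poweR; first exact: ltW.
  + by rewrite in_itv/= leey lee_fin addr_ge0.
  + by rewrite in_itv/= leey abse_ge0.
  + apply: le_trans (lee_abs _); rewrite EFinD addeC leeD2r//.
    exact: (partial_distortion_le_total_distortion hf hf1 fD n n1).
Qed.

Lemma logder_Lp : (\int[cm]_(xi in @circle R) (`|total_distortion f xi| `^ p) < +oo)%E ->
  (\int[cm]_(xi in @circle R) (`|logder xi| `^ p) < +oo)%E.
Proof.
move=> /mean_u_le[K hK].
(* With this shift the logarithm of the angular derivative becomes the limit [M] of the increasing
   sequence [u], hence nonnegative. *)
pose c := ln 4 + (1 - log_gap 0 1).
pose M xi := (logder xi + c%:E)%E.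
have mM : measurable_fun Circle (M : Cborel R -> \bar R).
  by apply: emeasurable_funD; [exact: measurable_logder hf hf1 fD|exact: measurable_cst].
have uM xi : nm xi = 1 -> (fun n => (u n xi)%:E) @ \oo --> M xi.
  move=> x1; have h : (fun n => ((log_gap (rn n) xi - ln 4)%:E + c%:E)%E) @ \oo --> M xi.
    apply: cvgeD; first exact: fin_num_adde_defl.
      exact: (lne_angular_cvg hf hf1 fD x1).
    exact: cvg_cst.
  apply: cvg_trans h; apply: near_eq_cvg; apply: nearW => n.
  by rewrite -EFinD /c addrA subrK.
have M0 xi : nm xi = 1 -> (0 <= M xi)%E.
  move=> x1; apply: (cvge_ge _ (uM xi x1)); apply: nearW => n.
  by rewrite lee_fin (le_trans ler01)// u_ge1.
apply: (@Lp_dominated R p p0 logder M `|c|) => //.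
- exact: measurable_logder hf hf1 fD.
- move=> xi _; have -> : logder xi = (M xi - c%:E)%E by rewrite /M addeK.
  by apply: le_trans (lee_abs_sub _ _) _.
apply: (@le_lt_trans _ _ K%:E); last exact: ltry.
have mC := @measurable_circle R.
have mU n : measurable_fun Circle (fun xi : Cborel R => (u n xi `^ p)%:E).
  apply/measurable_EFinP; apply: measurable_circle_powR.
  exact: measurable_u.
have U0 n xi : circle xi -> (0 <= (u n xi `^ p)%:E)%E by rewrite lee_fin powR_ge0.
have Uhomo (xi : Cborel R) : circle xi -> {homo (fun n => (u n xi `^ p)%:E) : n m / (n <= m)%N >-> (n <= m)%E}.
  move=> /circleE x1 n m nm; rewrite lee_fin.
  have u1 k := le_trans ler01 (u_ge1 k x1).
  apply: ge0_ler_powR; rewrite ?nnegrE ?(ltW p0)// lerD2r.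
  apply: (log_gap_nondecreasing hf fD x1); last exact: rn_lt1.
    by apply: lt_le_trans (rn_ge0 R n); rewrite ltrN10.
  exact: rn_nondecreasing.
have -> : (\int[cm]_(xi in @circle R) (`|M xi| `^ p))%E =
    (\int[cm]_(xi in @circle R) (limn (fun n => (u n xi `^ p)%:E)))%E.
  apply: eq_integral => xi; rewrite inE => /circleE x1.
  rewrite gee0_abs ?M0//; apply/esym/cvg_lim => //.
  by apply: (powR_cvge p0 _ (uM xi x1)) => n; exact: u_ge1.
rewrite monotone_convergence//.
apply: lime_le; last by apply: nearW => n; exact: hK.
apply: ereal_nondecreasing_is_cvgn => n m nm; apply: ge0_le_integral.
- exact: mC.
- by move=> xi cxi; exact: U0.
- exact: mU.
- exact: mU.
- by move=> xi cxi; exact: Uhomo.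
Qed.

(** An infinite angular derivative makes the integrand +oo, which integrability excludes almost
    everywhere. *)
Lemma angular_derivative_ae : (\int[cm]_(xi in @circle R) (`|logder xi| `^ p) < +oo)%E ->
  {ae cm, forall xi, (abs_angular_derivative f xi < +oo)%E}.
Proof.
move=> h.
have mC := @measurable_circle R.
have ig : cm.-integrable Circle (fun xi : Cborel R => `|logder xi| `^ p)%E.
  apply/integrableP; split; first exact: (measurable_Lp p (measurable_logder hf hf1 fD)).
  by under eq_integral do rewrite gee0_abs ?poweR_ge0//.
apply: (@filterS2 _ _ (ae_filter_ringOfSetsType cm) _ _ _ _ (circle_measure_circle R) (integrable_ae mC ig)) => xi cxi /(_ cxi).
rewrite ltey; apply: contraTneq => ->.
rewrite -[X in X \is a fin_num]/((+oo `^ p)%E) poweRyr; last by rewrite gt_eqF.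
by [].
Qed.

End backward.

Theorem theorem1p1 (R : realType) (p : R) (f : R[i] -> R[i])
    (p_gt0 : 0 < p) (f_inner : inner_function f) :
  finite_entropy p f <-> mem_Lp p (total_distortion f).
Proof.
have [f2 [hf hf1 fD]] := analytic_data f_inner.1.
have mT := measurable_total_distortion hf hf1 fD.
have mL := measurable_logder hf hf1 fD.
split=> [[_ [_ Loo]]|[_ Too]].
  split; first exact: mT.
  apply: (Lp_dominated p_gt0 (normr_ge0 (ln 4 - log_gap f 0 1)) mT mL _ Loo) => xi /circleE x1.
  exact: (total_distortion_le hf hf1 fD x1).
have Loo := logder_Lp hf hf1 fD p_gt0 Too.
by split; [exact: (angular_derivative_ae hf hf1 fD p_gt0 Loo)|split].
Qed.
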